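(* Let $w$ be the solution of the continuous closed-loop system and $w_h$ the solution of the semi-discrete finite element scheme, both described in the context, with $w_{0h}=\tilde w_h(0)$. Suppose that assumptions (A1) and (A2) of the context hold. Then there exists a constant $C=C(\|w_0\|_3)$ independent of $h$ such that for all $t>0$ $$\|w(t)-w_h(t)\|_j\le Ch^{2-j}\exp(C\|w_0\|_2),\qquad j=0,1,$$ and $$\|w(t)-w_h(t)\|_\infty\le Ch^2\exp(C\|w_0\|_2).$$
   Context: Notation: $(\cdot,\cdot)$ and $\|\cdot\|=\|\cdot\|_0$ are the inner product and norm of $L^2(0,1)$; $\|\cdot\|_m$ is the norm of the Sobolev space $H^m(0,1)$; $\|\cdot\|_\infty$ is the norm of $L^\infty(0,1)$; $\||f|\|:=\sqrt{\|f_x\|^2+f^2(0)+f^2(1)}$. Parameters: $\nu,\rho,\delta,c_0,c_1,\lambda>0$ and $w_d\ge 0$ are constants. Continuous closed-loop system: $w_t-\nu w_{xx}+ww_x+w_dw_x=\rho z_x$, $z_t+\delta z=w_x$ on $(0,1)\times(0,\infty)$, $w_x(0,t)=v_0(t)$, $w_x(1,t)=v_1(t)$, $w(x,0)=w_0(x)$, $z(x,0)=0$ (so $z(x,t)=\int_0^te^{-\delta(t-s)}w_x(x,s)ds$), with $v_0(t)=\frac1\nu((c_0+w_d)w(0,t)+\frac{2}{9c_0}w^3(0,t)-\rho z(0,t))$ and $v_1(t)=-\frac1\nu((c_1+w_d)w(1,t)+\frac{2}{9c_1}w^3(1,t)+\rho z(1,t))$. Its weak form is: for all $\phi\in H^1(0,1)$,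 $(w_t,\phi)+\nu(w_x,\phi_x)+w_d(w_x,\phi)+(ww_x,\phi)+\rho(z,\phi_x)+\sum_{i=0}^1((c_i+w_d)w(i,t)+\frac{2}{9c_i}w^3(i,t))\phi(i)=0$. Assumption (A1): $w_0\in H^3(0,1)$ and $w_{0x}(0)=v_0(0)$, $w_{0x}(1)=v_1(0)$, $w_{0xt}(0)=v_{0t}(0)$, $w_{0xt}(1)=v_{1t}(0)$ (here $w_{0xt}(i)$ means $w_{xt}(i,0)$). Assumption (A2): for $w_0\in H^3(0,1)$ there is a unique weak solution $w$ and it satisfies, with a positive constant $C$, $\|w\|_2^2+\|w_t\|_1^2+\|z\|^2+\int_0^t(\||w(s)|\|^2+\|w_t(s)\|_2^2+\|z(s)\|^2)ds\le C\|w_0\|_3^2$. Finite element space: for a partition $0=x_0<x_1<\dots<x_N=1$ with $I_j=(x_{j-1},x_j)$, $h=\max_j(x_j-x_{j-1})$, let $S_h=\{v_h\in C^0([0,1]): v_h|_{I_j}\text{ is a polynomial of degree}\le1,\ 1\le j\le N\}$. Semi-discrete scheme: find $w_h(t)\in S_h$ with $w_h(0)=w_{0h}$ such that for all $\phi\in S_h$ and $t>0$, with $z_h(t)=\int_0^te^{-\delta(t-s)}w_{hx}(s)ds$, $$(w_{ht},\phi)+\nu(w_{hx},\phi_x)+w_d(w_{hx},\phi)+(w_hw_{hx},\phi)+\rho(z_h,\phi_x)+\sum_{i=0}^1\Big((c_i+w_d)w_h(i,t)+\tfrac{2}{9c_i}w_h^3(i,t)\Big)\phi(i)=0.$$ Ritz–Volterra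 projection: $\tilde w_h(t)\in S_h$ is defined by $$\nu((w-\tilde w_h)_x,\phi_x)+\rho\Big(\int_0^te^{-\delta(t-s)}(w(s)-\tilde w_h(s))_xds,\phi_x\Big)+\lambda(w-\tilde w_h,\phi)=0\quad\forall\phi\in S_h.$$ *)

(* Defs.v *)
From HB Require Import structures.
From mathcomp Require Import all_boot all_order all_algebra.
From mathcomp Require Import all_classical all_reals all_analysis.
Set Implicit Arguments.
Unset Strict Implicit.
Unset Printing Implicit Defensive.
Import Order.TTheory GRing.Theory Num.Theory.
Import numFieldNormedType.Exports.
Local Open Scope classical_set_scope.
Local Open Scope ring_scope.

(* A function f : R -> R stands for a function on (0,1), up to equality almost
   everywhere; its values outside (0,1) are irrelevant. A function of (t, x) is
   a path u : R -> R -> R, where u t is the function at time t >= 0. *)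

Section Sobolev.
Context {R : realType}.
Implicit Types (f g : R -> R) (D : set R).

Local Notation mu := (@lebesgue_measure R).
Local Notation I01 := (`]0, 1[%classic : set R).

Definition L2 f : Prop := f \_ I01 \in Lfun mu 2%:E.

Definition L2norm f : R := fine 'N[mu]_2%:E[EFin \o (f \_ I01)]%E.

Definition Linfnorm f : \bar R := 'N[mu]_+oo[EFin \o (f \_ I01)]%E.

Definition inner f g : R := \int[mu]_(x in I01) (f x * g x).

(* Testing against C^1 rather than C^oo functions of compact support gives the
   same weak derivatives (the convention of Brezis in dimension one). *)
Definition test_function D (theta : R -> R) : Prop :=
  [/\ forall x, derivable theta x 1,
      continuous (derive1 theta) &
      exists K : set R, [/\ compact K, K `<=` D & forall x, ~ K x -> theta x = 0]].

Definition weak_deriv D f g : Prop :=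
  [/\ locally_integrable D f, locally_integrable D g &
      forall theta, test_function D theta ->
        \int[mu]_(x in D) (f x * derive1 theta x) =
        - \int[mu]_(x in D) (g x * theta x)].

(* A weak derivative of f on (0,1), if there is one. *)
Definition wD f : R -> R := get [set g : R -> R | weak_deriv I01 f g].

Fixpoint sobolev (m : nat) f : Prop :=
  if m is m'.+1 then [/\ L2 f, weak_deriv I01 f (wD f) & sobolev m' (wD f)]
  else L2 f.

(* Meaningful only when sobolev m f holds. *)
Definition sobolev_norm (m : nat) f : R :=
  Num.sqrt (\sum_(k < m.+1) L2norm (iter k wD f) ^+ 2).

(* Functions of H^1 are evaluated at points through their continuous
   representative on [0,1]. *)
Definition cont_rep f : R -> R :=
  get [set g : R -> R | {within `[0, 1], continuous g} /\ ae_eq mu I01 f g].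

Definition triple_norm f : R :=
  Num.sqrt (L2norm (wD f) ^+ 2 + cont_rep f 0 ^+ 2 + cont_rep f 1 ^+ 2).

(* Z t = \int_0^t e^(- delta (t - s)) u s ds as an integral in L^2(0,1), that
   is, tested against every element of L^2(0,1). *)
Definition memory (delta : R) (u Z : R -> R -> R) : Prop :=
  forall t : R, 0 <= t -> L2 (Z t) /\
    forall phi, L2 phi ->
      mu.-integrable `[0, t]
        (fun s => (expR (- delta * (t - s)) * inner (u s) phi)%:E) /\
      inner (Z t) phi =
        \int[mu]_(s in `[0, t]) (expR (- delta * (t - s)) * inner (u s) phi).

(* ut is the weak derivative in time on (0,+oo) of the L^2(0,1)-valued u. *)
Definition weak_time_deriv (u ut : R -> R -> R) : Prop :=
  forall phi, L2 phi ->
    weak_deriv `]0, +oo[ (fun t => inner (u t) phi) (fun t => inner (ut t) phi).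

Definition right_deriv0 f (d : R) : Prop :=
  (f e - f 0) / e @[e --> 0^'+] --> d.

End Sobolev.

Section Burgers.
Context {R : realType}.
Local Notation mu := (@lebesgue_measure R).
Context (nu rho delta c0 c1 wd : R).
Implicit Types (w wt z : R -> R -> R) (v vt zeta phi : R -> R).

(* The left-hand side of the weak form for v = w(t), vt = w_t(t),
   zeta = z(t). *)
Definition weak_form v vt zeta phi : R :=
  inner vt phi + nu * inner (wD v) (wD phi) + wd * inner (wD v) phi
  + inner (fun x => v x * wD v x) phi + rho * inner zeta (wD phi)
  + (((c0 + wd) * cont_rep v 0 + 2 / (9 * c0) * cont_rep v 0 ^+ 3)
       * cont_rep phi 0
   + ((c1 + wd) * cont_rep v 1 + 2 / (9 * c1) * cont_rep v 1 ^+ 3)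
       * cont_rep phi 1).

(* w is in C([0,oo); L^2), in L^2(0,T; H^1) for all T, and w_t = wt is in
   L^2(0,T; L^2) for all T. *)
Definition weak_solution (w0 : R -> R) w wt z : Prop :=
  [/\ ae_eq mu `]0, 1[%classic (w 0) w0,
      forall t : R, 0 <= t -> sobolev 1 (w t) /\
        L2norm (w s \- w t) @[s --> within `[0, +oo[ (nbhs t)] --> (0 : R),
      (forall t : R, 0 < t -> L2 (wt t)) /\ weak_time_deriv w wt,
      forall T, 0 < T ->
        mu.-integrable `]0, T[ (fun s => (sobolev_norm 1 (w s) ^+ 2)%:E) /\
        mu.-integrable `]0, T[ (fun s => (L2norm (wt s) ^+ 2)%:E) &
      memory delta (fun s => wD (w s)) z /\
      forall t : R, 0 < t -> forall phi, sobolev 1 phi ->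
        weak_form (w t) (wt t) (z t) phi = 0].

Definition control0 w z (t : R) : R :=
  nu^-1 * ((c0 + wd) * cont_rep (w t) 0
           + 2 / (9 * c0) * cont_rep (w t) 0 ^+ 3 - rho * cont_rep (z t) 0).

Definition control1 w z (t : R) : R :=
  - nu^-1 * ((c1 + wd) * cont_rep (w t) 1
           + 2 / (9 * c1) * cont_rep (w t) 1 ^+ 3 + rho * cont_rep (z t) 1).

(* w_xt(i,0) is the derivative at t = 0 of the boundary value w_x(i,t). *)
Definition assumption_A1 (w0 : R -> R) w z : Prop :=
  [/\ sobolev 3 w0,
      cont_rep (wD w0) 0 = control0 w z 0,
      cont_rep (wD w0) 1 = control1 w z 0,
      exists d : R, right_deriv0 (fun t => cont_rep (wD (w t)) 0) d /\
                    right_deriv0 (control0 w z) d &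
      exists d : R, right_deriv0 (fun t => cont_rep (wD (w t)) 1) d /\
                    right_deriv0 (control1 w z) d].

(* Well-posedness for the given initial value w0, with the constant K in the
   a priori bound. Every integral in the bound is of an integrable function, and
   every Sobolev norm is of a member of the space. *)
Definition assumption_A2 (K : R) (w0 : R -> R) : Prop :=
  [/\ exists w wt z, weak_solution w0 w wt z,
      forall w wt z w' wt' z',
        weak_solution w0 w wt z -> weak_solution w0 w' wt' z' ->
        forall t : R, 0 <= t -> ae_eq mu `]0, 1[%classic (w t) (w' t) &
      forall w wt z, weak_solution w0 w wt z ->
        {ae mu, forall s, 0 < s -> sobolev 2 (wt s)} /\
        forall t : R, 0 < t ->
          let energy s := triple_norm (w s) ^+ 2 + sobolev_norm 2 (wt s) ^+ 2
                          + L2norm (z s) ^+ 2 in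
          [/\ sobolev 2 (w t), sobolev 1 (wt t),
              mu.-integrable `]0, t[ (EFin \o energy) &
              sobolev_norm 2 (w t) ^+ 2 + sobolev_norm 1 (wt t) ^+ 2
              + L2norm (z t) ^+ 2 + \int[mu]_(s in `]0, t[) energy s
              <= K * sobolev_norm 3 w0 ^+ 2]].

End Burgers.

Section FiniteElements.
Context {R : realType}.
Context (N : nat) (xs : nat -> R).

Definition is_partition : Prop :=
  [/\ xs 0%N = 0, xs N = 1 & forall j, (j < N)%N -> xs j < xs j.+1].

Definition mesh_size : R := \big[Num.max/0]_(j < N) (xs j.+1 - xs j).

Definition fe_space (v : R -> R) : Prop :=
  {within `[0, 1], continuous v} /\
  forall j, (j < N)%N -> exists p : {poly R},
    (size p <= 2)%N /\ forall x, xs j < x < xs j.+1 -> v x = p.[x].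

(* On the finite-dimensional space S_h the time derivative is the classical
   one, taken at each point x of [0,1]. *)
Definition semi_discrete (nu rho delta c0 c1 wd : R) (wh : R -> R -> R) : Prop :=
  [/\ forall t : R, 0 <= t -> fe_space (wh t),
      forall x, 0 <= x <= 1 -> wh s x @[s --> 0^'+] --> wh 0 x,
      forall t x, 0 < t -> 0 <= x <= 1 -> derivable (wh ^~ x) t 1 &
      exists zh : R -> R -> R, memory delta (fun s => wD (wh s)) zh /\
        forall t : R, 0 < t -> forall phi, fe_space phi ->
          weak_form nu rho c0 c1 wd
            (wh t) (fun x => derive1 (wh ^~ x) t) (zh t) phi = 0].

Definition ritz_volterra (nu rho delta lambda : R) (w wtil : R -> R -> R) : Prop :=
  (forall t : R, 0 <= t -> fe_space (wtil t)) /\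
  exists E : R -> R -> R,
    memory delta (fun s => wD (w s \- wtil s)) E /\
    forall t : R, 0 <= t -> forall phi, fe_space phi ->
      nu * inner (wD (w t \- wtil t)) (wD phi) + rho * inner (E t) (wD phi)
      + lambda * inner (w t \- wtil t) phi = 0.

End FiniteElements.

(* Main.v *)
(* The finite element solution is compared with the nodal interpolant V of w, not
   with the Ritz-Volterra projection. The interpolation error eta = w - V vanishes
   at the nodes, so (eta_x, phi_x) = 0 for every phi in S_h, also under the memory
   integral, and the boundary terms do not see eta; what is left of eta in the
   equation for theta = V - w_h is (eta_t, phi) and, after an integration by parts
   on each cell, the integrals X_j of w_d eta + (w^2 - V^2) / 2. The projection is
   used at t = 0 only, where its memory term vanishes and an elliptic estimate
   gives theta(0) = O(h^2).

   No bound on w_xx in L^oo is assumed. Testing the weak form with trapezoids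
   bounds nu D + rho int_0^t e^(- delta (t - s)) D(s) ds, D being a difference of
   mean values of w_x; this Volterra inequality makes w_x Lipschitz in space,
   uniformly in time, whence eta = O(h^2) pointwise.

   Testing the equation for theta with theta and with theta_t gives
   H' <= - al H + K1 (|V|^2 + |w_h|^2) H + K2 (|eta_t|^2 + h^4) for an energy H
   equivalent to |theta|^2 and the norm |f|^2 = |f_x|^2 + f(0)^2 + f(1)^2. Both
   coefficients of H are integrable in time: |V|^2 by (A2), |w_h|^2 by the energy
   inequality of the scheme itself. Hence |theta|^2 = O(h^4), which bounds theta
   pointwise. *)
Require Import Defs.
From mathcomp Require Import all_boot all_order all_algebra.
From mathcomp Require Import all_classical all_reals all_analysis.
From mathcomp Require Import measurable_realfun.
From mathcomp Require Import ring lra.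
Import Order.TTheory GRing.Theory Num.Theory.
Import numFieldNormedType.Exports.
Local Open Scope classical_set_scope.
Local Open Scope ring_scope.
Set Implicit Arguments.
Unset Strict Implicit.
Unset Printing Implicit Defensive.

(** * Integrals over intervals of the real line *)

Section RealIntegral.
Context {R : realType}.
Local Notation mu := (@lebesgue_measure R).
Implicit Types (f g F : R -> R) (a b c x y k : R).

(** The energy identities need nodal values of w that are differentiable in time, whereas w_t is
    only a weak derivative with values in L^2(0,1). The trapezoids that make w_x Lipschitz settle
    this too: in the weak form tested with one of them all other terms can be expressed through w
    without w_x and are continuous in t, and as the trapezoid shrinks (w_t, phi) recovers point
    values of w_t uniformly in t.

    Testing with theta alone bounds theta_x only in time average; theta_t is tested to bound it at
    each t. The price is a term |theta|^4, from convection and from the cubic feedback. Since theta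
    = V - w_h, one factor |theta|^2 is charged to |V|^2 + |w_h|^2, which keeps the inequality linear
    in H and asks for no smallness of h.

    Part of the forcing is O(h^4) at each time but not known to be integrable over (0,oo); the decay
    term - al H is what makes the bound uniform in t. The constants depend on the parameters and on
    M = K ||w0||_3^2 alone, and the exponential of the Gronwall step is absorbed in C. *)

Definition rint (a b : R) (f : R -> R) : R := \int[mu]_(x in `]a, b[) f x.
Definition rintegrable (a b : R) (f : R -> R) : Prop :=
  mu.-integrable `]a, b[ (EFin \o f).

Lemma mu_itvoo a b : a <= b -> mu `]a, b[ = (b - a)%:E.
Proof.
move=> ab; rewrite lebesgue_measure_itv/= lte_fin; case: ltP => ba.
  by rewrite -EFinD.
by congr EFin; lra.
Qed.

Lemma rint_nil a b f : b <= a -> rint a b f = 0.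
Proof. by move=> ba; rewrite /rint set_itv_ge ?Rintegral_set0// bnd_simp -leNgt. Qed.

Lemma rintegrable_nil a b f : b <= a -> rintegrable a b f.
Proof.
move=> ba; rewrite /rintegrable set_itv_ge ?bnd_simp -?leNgt//.
exact: integrable_set0.
Qed.

Lemma rintegrable_meas a b f : rintegrable a b f -> measurable_fun `]a, b[ f.
Proof. by move=> /integrableP[/measurable_EFinP]. Qed.

Lemma rintegrable_sub a b c d f : rintegrable a b f -> a <= c -> d <= b ->
  rintegrable c d f.
Proof.
move=> fi ac db; apply: integrableS fi => //.
by apply: subset_itvW.
Qed.

Lemma rintegrable_cont a b f : {within `[a, b], continuous f} -> rintegrable a b f.
Proof.
move=> cf; have : mu.-integrable `[a, b] (EFin \o f).
  by apply: continuous_compact_integrable => //; exact: segment_compact.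
by apply: integrableS => //; apply: subset_itv_oo_cc.
Qed.

Lemma rintegrableD a b f g : rintegrable a b f -> rintegrable a b g ->
  rintegrable a b (fun x => f x + g x).
Proof.
move=> fi gi; rewrite /rintegrable.
have -> : EFin \o (fun x => f x + g x) = (EFin \o f) \+ (EFin \o g) by [].
exact: integrableD.
Qed.

Lemma rintegrableZ a b k f : rintegrable a b f -> rintegrable a b (fun x => k * f x).
Proof.
move=> fi; rewrite /rintegrable.
have -> : EFin \o (fun x => k * f x) = (fun x => (k%:E * (EFin \o f) x)%E) by [].
exact: integrableZl.
Qed.

Lemma rintegrableN a b f : rintegrable a b f -> rintegrable a b (fun x => - f x).
Proof.
move=> /(rintegrableZ (-1)).
by rewrite (_ : (fun x => -1 * f x) = (fun x => - f x))//; apply/funext => x; rewrite mulN1r.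
Qed.

Lemma rintegrableB a b f g : rintegrable a b f -> rintegrable a b g ->
  rintegrable a b (fun x => f x - g x).
Proof. by move=> fi /rintegrableN gi; exact: rintegrableD. Qed.

Lemma rintegrable_cst a b k : rintegrable a b (fun=> k).
Proof. by apply: rintegrable_cont; apply: continuous_subspaceT => x; exact: cvg_cst. Qed.

Lemma rintegrable_norm a b f : rintegrable a b f -> rintegrable a b (fun x => `|f x|).
Proof. by move=> /integrable_abse. Qed.

Lemma rintegrable_le a b f g : measurable_fun `]a, b[ f -> rintegrable a b g ->
  (forall x, a < x < b -> `|f x| <= g x) -> rintegrable a b f.
Proof.
move=> mf gi fg; apply: le_integrable gi => //; first exact/measurable_EFinP.
move=> x /=; rewrite in_itv/= lee_fin => xab.
by apply: (le_trans (fg _ xab)); exact: ler_norm.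
Qed.

Lemma rintegrable_bounded a b f k : measurable_fun `]a, b[ f ->
  (forall x, a < x < b -> `|f x| <= k) -> rintegrable a b f.
Proof. by move=> mf fk; apply: rintegrable_le (rintegrable_cst a b k) fk. Qed.

Lemma rintegrableM_bounded a b f g k : rintegrable a b f -> measurable_fun `]a, b[ g ->
  (forall x, a < x < b -> `|g x| <= k) -> rintegrable a b (fun x => f x * g x).
Proof.
move=> fi mg gk.
apply: (@rintegrable_le _ _ _ (fun x => k * `|f x|)).
- by apply: measurable_funM => //; exact: rintegrable_meas.
- by apply: rintegrableZ; exact: rintegrable_norm.
- by move=> x /gk gx; rewrite normrM mulrC ler_wpM2r.
Qed.

Lemma rintegrable_of_sqr a b f : measurable_fun `]a, b[ f ->
  rintegrable a b (fun x => f x ^+ 2) -> rintegrable a b f.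
Proof.
move=> mf fi; apply: (@rintegrable_le _ _ _ (fun x => f x ^+ 2 + 1)) => //.
- by apply: rintegrableD => //; exact: rintegrable_cst.
- move=> x _; rewrite -(real_normK (num_real (f x))).
  have := sqr_ge0 (`|f x| - 1); nra.
Qed.

Lemma rintD a b f g : rintegrable a b f -> rintegrable a b g ->
  rint a b (fun x => f x + g x) = rint a b f + rint a b g.
Proof. by move=> fi gi; rewrite /rint RintegralD. Qed.

Lemma rintB a b f g : rintegrable a b f -> rintegrable a b g ->
  rint a b (fun x => f x - g x) = rint a b f - rint a b g.
Proof. by move=> fi gi; rewrite /rint RintegralB. Qed.

Lemma rintZ a b k f : rintegrable a b f -> rint a b (fun x => k * f x) = k * rint a b f.
Proof. by move=> fi; rewrite /rint RintegralZl. Qed.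

Lemma rint_cst a b k : a <= b -> rint a b (fun=> k) = k * (b - a).
Proof.
move=> ab; rewrite /rint Rintegral_cst//; congr (_ * _).
exact: (congr1 fine (mu_itvoo ab)).
Qed.

Lemma eq_rint a b f g : (forall x, a < x < b -> f x = g x) -> rint a b f = rint a b g.
Proof. by move=> fg; apply: eq_Rintegral => x; rewrite inE/= in_itv/=; exact: fg. Qed.

Lemma ae_eq_rint a b f g : measurable_fun `]a, b[ f -> measurable_fun `]a, b[ g ->
  ae_eq mu (`]a, b[%classic : set R) f g -> rint a b f = rint a b g.
Proof.
move=> mf mg fg; congr fine; apply: ae_eq_integral => //;
  try exact/measurable_EFinP.
by apply: filterS fg => x /= fg xab; rewrite fg.
Qed.

Lemma ae_eq_rintegrable a b f g : measurable_fun `]a, b[ g ->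
  ae_eq mu (`]a, b[%classic : set R) f g -> rintegrable a b f -> rintegrable a b g.
Proof.
move=> mg fg fi; have mf := rintegrable_meas fi.
move/integrableP : fi => [_ fy]; apply/integrableP; split; first exact/measurable_EFinP.
apply: le_lt_trans fy; rewrite le_eqVlt; apply/orP; left; apply/eqP.
apply: ae_eq_integral => //.
- by apply/measurableT_comp => //; exact/measurable_EFinP.
- by apply/measurableT_comp => //; exact/measurable_EFinP.
- by apply: filterS fg => x /= fg xab; rewrite fg.
Qed.

Lemma le_rint a b f g : rintegrable a b f -> rintegrable a b g ->
  (forall x, a < x < b -> f x <= g x) -> rint a b f <= rint a b g.
Proof. by move=> fi gi fg; apply: le_Rintegral => // x /=; rewrite in_itv/=; exact: fg. Qed.

Lemma rint_ge0 a b f : (forall x, a < x < b -> 0 <= f x) -> 0 <= rint a b f.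
Proof. by move=> f0; apply: Rintegral_ge0 => x /=; rewrite in_itv/=; exact: f0. Qed.

Lemma ler_norm_rint a b f : rintegrable a b f -> `|rint a b f| <= rint a b (fun x => `|f x|).
Proof. by move=> fi; apply: le_normr_Rintegral. Qed.

Lemma norm_rint_le a b f k : a <= b -> rintegrable a b f ->
  (forall x, a < x < b -> `|f x| <= k) -> `|rint a b f| <= k * (b - a).
Proof.
move=> ab fi fk; apply: (le_trans (ler_norm_rint fi)); rewrite -rint_cst//.
by apply: le_rint => //; [exact: rintegrable_norm|exact: rintegrable_cst].
Qed.

Lemma rint_split a c b f : a <= c -> c <= b -> rintegrable a b f ->
  rint a b f = rint a c f + rint c b f.
Proof.
move=> ac; rewrite le_eqVlt => /predU1P[<-|cb fi].
  by rewrite [rint c c f]rint_nil// addr0.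
rewrite /rint -(@Rintegral_itvB _ f (BRight a) (BLeft b) c) ?bnd_simp//.
rewrite -(@Rintegral_itv_bndo_bndc _ (BRight a) c); first by ring.
by apply: rintegrable_sub fi _ _ => //; exact: ltW.
Qed.

End RealIntegral.

(** * Square integrable functions on (0,1) *)

Section L2space.
Context {R : realType}.
Local Notation mu := (@lebesgue_measure R).
Local Notation I01 := (`]0, 1[%classic : set R).
Implicit Types (f g : R -> R).

Lemma L2P f : L2 f <-> measurable_fun I01 f /\ rintegrable 0 1 (fun x => f x ^+ 2).
Proof.
have restr2 : (fun x => (f \_ I01) x ^+ 2) = (fun x => f x ^+ 2) \_ I01.
  by apply/funext => x; rewrite /patch; case: ifP => // _; rewrite expr0n.
split=> [fL|[mf fi]].
- split.
    apply/measurable_restrictT => //; move: fL; rewrite /L2 inE => /andP[].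
    by rewrite inE.
  have := Lfun2_integrable_sqr fL; rewrite restr2 => fi.
  by apply/integrable_mkcond => //; rewrite restrict_EFin.
- have mfr : measurable_fun setT (f \_ I01) by exact: (measurable_restrictT f (measurable_itv `]0, 1[)).1 mf.
  rewrite /L2 inE; apply/andP; split; first by rewrite inE.
  rewrite inE/= /finite_norm.
  apply: (@lty_poweRy _ _ 2) => //; rewrite powR_Lnorm//.
  have : mu.-integrable setT (EFin \o (fun x => (f \_ I01) x ^+ 2)).
    have := (@integrable_mkcond _ _ R mu I01 (EFin \o (fun x => f x ^+ 2)) (measurable_itv `]0, 1[)).1 fi; by rewrite restr2 restrict_EFin.
  move=> /integrableP[_]; apply: le_lt_trans.
  rewrite le_eqVlt; apply/orP; left; apply/eqP; apply: eq_integral => x _ /=.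
  by rewrite normrX powR_mulrn.
Qed.

Lemma L2norm_ge0 f : 0 <= L2norm f.
Proof. by rewrite /L2norm fine_ge0// Lnorm_ge0. Qed.

Lemma L2norm_sqr f : L2norm f ^+ 2 = rint 0 1 (fun x => f x ^+ 2).
Proof.
rewrite -powR_mulrn ?L2norm_ge0// /L2norm -fine_poweR powR_Lnorm//.
rewrite /rint Rintegral_mkcond; congr fine; apply: eq_integral => x _.
rewrite /= powR_mulrn// real_normK ?num_real//; congr EFin.
by rewrite /patch; case: ifP => // _; rewrite expr0n.
Qed.

End L2space.

(** * Almost everywhere statements, the fundamental theorem and Lebesgue points *)

Section Calculus.
Context {R : realType}.
Local Notation mu := (@lebesgue_measure R).
Implicit Types (f g F : R -> R) (a b c x y k e d r : R).

Lemma ae_imp (P Q : R -> Prop) : (forall x, P x -> Q x) ->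
  {ae mu, forall x, P x} -> {ae mu, forall x, Q x}.
Proof. move=> PQ; exact: (@filterS _ _ (ae_filter_ringOfSetsType mu) P Q). Qed.

Lemma ae_and (P Q : R -> Prop) : {ae mu, forall x, P x} -> {ae mu, forall x, Q x} ->
  {ae mu, forall x, P x /\ Q x}.
Proof. exact: (@filterI _ _ (ae_filter_ringOfSetsType mu)). Qed.

Lemma ae_point a b (P : R -> Prop) : a < b -> {ae mu, forall x, P x} ->
  exists2 x, a < x < b & P x.
Proof.
move=> ab [N [mN N0 PN]]; apply: contrapT => noP.
have leN : (mu `]a, b[ <= mu N)%E.
  apply: le_measure; rewrite ?inE//; move=> x /=; rewrite in_itv/= => xab.
  by apply: PN => /= Px; apply: noP; exists x.
have : ((b - a)%:E <= 0)%E.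
  apply: (@le_trans _ _ (mu N)); last by rewrite le_eqVlt; apply/orP; left; apply/eqP.
  by apply: le_trans leN; rewrite le_eqVlt; apply/orP; left; rewrite eq_sym; apply/eqP/mu_itvoo/ltW.
by rewrite lee_fin subr_le0 leNgt ab.
Qed.

Lemma rint_FTC a b f F : a <= b -> {within `[a, b], continuous f} ->
  (forall x, a < x < b -> is_derive x 1 F (f x)) ->
  {within `[a, b], continuous F} -> rint a b f = F b - F a.
Proof.
rewrite le_eqVlt => /predU1P[->|ab] cf dF cF; first by rewrite rint_nil// subrr.
rewrite /rint Rintegral_itv_bndo_bndc; last exact: rintegrable_cont.
rewrite Rintegral_itv_obnd_cbnd; last first.
  apply: (@integrableS _ _ _ mu `[a, b]) => //.
    by apply: subset_itvr; rewrite bnd_simp.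
  by apply: continuous_compact_integrable => //; exact: segment_compact.
rewrite /Rintegral (@continuous_FTC2 _ f F a b)//.
- have [_ cFa cFb] := (continuous_within_itvP _ ab).1 cF.
  split => // x; rewrite in_itv/= => xab.
  by have [] := dF _ xab.
- move=> x; rewrite in_itv/= => xab; rewrite derive1E.
  by have [_] := dF _ xab.
Qed.

(** Absolute continuity of the integral: the length d does not depend on the position x. *)
Lemma rint_small a b g : rintegrable a b g -> forall e, 0 < e ->
  exists2 d, 0 < d & forall x r, a <= x -> x + r <= b -> 0 <= r < d ->
    rint x (x + r) (fun s => `|g s|) < e.
Proof.
move=> gi e e0.
have gT : mu.-integrable setT (EFin \o (g \_ `]a, b[)).
  have := (@integrable_mkcond _ _ R mu `]a, b[%classic (EFin \o g) (measurable_itv _)).1 gi.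
  by rewrite restrict_EFin.
have [d [d0 dP]] := integral_normr_continuous gT e0.
exists d => // x r ax xrb /andP[r0 rd].
rewrite (@eq_rint _ _ _ _ (fun s => `|(g \_ `]a, b[) s|)).
  have xr : x <= x + r by rewrite lerDl.
  apply: dP => //; apply: (le_lt_trans (_ : _ <= (x + r - x)%:E)%E).
    by rewrite -(mu_itvoo xr).
  by rewrite lte_fin; lra.
move=> s /andP[xs sx]; rewrite /patch ifT// inE/= in_itv/=; apply/andP; split; lra.
Qed.

(* Right Lebesgue points. *)
Definition lpt f x : Prop := forall e, 0 < e -> exists2 d, 0 < d &
  forall r, 0 < r < d -> rint x (x + r) (fun s => `|f s - f x|) <= e * r.

(** Lebesgue differentiation for the extension of f by 0; the one-sided intervals are halves of the
    centred balls used there. *)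
Lemma lpt_ae a b f : rintegrable a b f ->
  {ae mu, forall x, `]a, b[%classic x -> lpt f x}.
Proof.
move=> fi; have fl := integrable_locally_restrict (measurable_itv `]a, b[) fi.
have : {ae mu, forall x, lebesgue_pt (f \_ `]a, b[) x}.
  exact: lebesgue_differentiation.
apply: ae_imp => x lx; rewrite /= in_itv/= => /andP[ax xb].
move=> e e0.
(* The centred ball has measure 2 r, so an average of at most e / 2 over it gives an integral of at
   most e r. *)
move: lx => /fine_cvgP[lfin /cvgrPdist_le/(_ (e / 2))].
have e20 : 0 < e / 2 by rewrite divr_gt0.
move=> /(_ e20) lle.
have rab : \forall r \near (0:R)^'+, r < b - x.
  by apply: nbhs_right_lt; rewrite subr_gt0.
have rax : \forall r \near (0:R)^'+, r < x - a.
  by apply: nbhs_right_lt; rewrite subr_gt0.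
have : \forall r \near (0:R)^'+, 0 < r -> rint x (x + r) (fun s => `|f s - f x|) <= e * r.
  near=> r => r0.
  set G := f \_ `]a, b[.
  have Gf s : x - r < s < x + r -> G s = f s.
    move=> /andP[s1 s2]; rewrite /G /patch ifT// inE/= in_itv/=.
    have : r < b - x by near: r.
    have : r < x - a by near: r.
    by move=> ? ?; apply/andP; split; lra.
  have mG : measurable_fun setT G.
    have mf := rintegrable_meas fi.
    by exact: (measurable_restrictT f (measurable_itv `]a, b[)).1 mf.
  have dfin : davg G x r \is a fin_num by near: r.
  have : `|0 - fine (davg G x r)| <= e / 2 by near: r.
  rewrite sub0r normrN ger0_norm; last by rewrite fine_ge0// davg_ge0.
  rewrite -lee_fin fineK// /davg /iavg (lebesgue_measure_ball _ (ltW r0)).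
  rewrite inver mulrn_eq0/= gt_eqF// lee_pdivrMl; last by rewrite mulrn_wgt0.
  move=> le1; rewrite -lee_fin /rint /Rintegral fineK; last first.
    apply: integrable_fin_num => //.
    apply: rintegrable_norm; apply: rintegrableB; last exact: rintegrable_cst.
    apply: rintegrable_sub fi _ _; first exact: ltW.
    have : r < b - x by near: r.
    by lra.
  rewrite (_ : e * r = r *+ 2 * (e / 2)); last by rewrite mulr2n; lra.
  rewrite EFinM; apply: le_trans le1.
  have -> : (\int[mu]_(y in `]x, (x + r)%R[) (`|f y - f x|)%:E = \int[mu]_(y in `]x, (x + r)%R[) (`|G y - G x|)%:E)%E.
    apply: eq_integral => s; rewrite inE/= in_itv/= => /andP[xs sx].
    by rewrite !Gf//; apply/andP; split; lra.
  apply: ge0_subset_integral => //.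
  - exact: measurable_ball.
  - have m1 : measurable_fun setT (fun y => G y - G x).
      by apply: measurable_funB.
    have m2 : measurable_fun setT (fun y => `|G y - G x|).
      exact: (measurableT_comp _ m1).
    apply: (measurable_funS measurableT (@subsetT _ _)).
    exact/measurable_EFinP.
  - by move=> s /=; rewrite in_itv/= ball_itv/= in_itv/= => /andP[xs sx]; apply/andP; split; lra.
move=> [d /= d0 dP]; exists d => // r /andP[r0 rd].
by apply: dP => //=; rewrite sub0r normrN gtr0_norm.
Unshelve. all: by end_near. Qed.

End Calculus.

(** * A C^1 transition function *)

Section Smoothstep.
Context {R : realType}.
Implicit Types (s x y r h : R).

(** A quadratic remainder with one constant for all h gives differentiability whatever pieces meet
    at x; this settles the square of [pos_part] at its kink. *)
Lemma is_derive_of_quadratic (F : R -> R) x d k :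
  (forall h, `|F (x + h) - F x - d * h| <= k * h ^+ 2) -> is_derive x 1 F d.
Proof.
move=> Fk.
have k0 : 0 <= k by have := Fk 1; rewrite expr1n !mulr1; have := normr_ge0 (F (x + 1) - F x - d); lra.
have cv : h^-1 *: (F (h + x) - F x) @[h --> 0^'] --> d.
  apply/cvgrPdist_le => /= e e0.
  have ek0 : 0 < e / (k + 1) by rewrite divr_gt0// ltr_wpDl.
  near=> h.
  have h0 : h != 0 by near: h; exact: nbhs_dnbhs_neq.
  have hs : `|h| <= e / (k + 1).
    near: h; apply: dnbhs0_le => //.
  rewrite -(@ler_pM2r _ `|h|) ?normr_gt0// -normrM mulrBl /GRing.scale/= mulrAC mulVf// mul1r.
  rewrite distrC (addrC h) (le_trans (Fk h))//.
  rewrite -(real_normK (num_real h)) expr2 mulrA ler_wpM2r//.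
  apply: (le_trans (ler_wpM2l k0 hs)).
  by rewrite mulrA ler_pdivrMr ?ltr_wpDl//; nra.
apply: DeriveDef.
  by apply/cvg_ex; exists d; under eq_fun do rewrite /GRing.scale/= mulr1; exact: cv.
rewrite /derive; apply: cvg_lim => //.
by under eq_fun do rewrite /GRing.scale/= mulr1; exact: cv.
Unshelve. all: by end_near. Qed.

Definition pos_part s : R := Num.max s 0.

Lemma pos_partE s : pos_part s = if 0 <= s then s else 0.
Proof. by rewrite /pos_part maxEle; case: (leP s 0) => ?; case: (leP 0 s) => ?; lra. Qed.

Lemma is_derive_pos_part_sqr s : is_derive s 1 (fun s => pos_part s ^+ 2) (2 * pos_part s).
Proof.
apply: (@is_derive_of_quadratic _ _ _ 1) => h; rewrite !pos_partE mul1r !expr2.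
rewrite ler_norml; case: (leP 0 (s + h)) => ?; case: (leP 0 s) => ?;
  by apply/andP; split; nra.
Qed.

(* A C^1 quadratic spline rising from 0 at s = 0 to 1 at s = 1: a difference of two
   rescaled copies is an admissible test function in weak_deriv. *)
Definition smoothstep s : R :=
  2 * (pos_part s ^+ 2 - 2 * pos_part (s - 2^-1) ^+ 2 + pos_part (s - 1) ^+ 2).
Definition smoothstep' s : R :=
  4 * (pos_part s - 2 * pos_part (s - 2^-1) + pos_part (s - 1)).

Ltac pp_cases s := rewrite /smoothstep /smoothstep' !pos_partE ?expr2;
  case: (leP 0 s) => ?; case: (leP 0 (s - 2^-1)) => ?; case: (leP 0 (s - 1)) => ?.

Lemma smoothstep_le0 s : s <= 0 -> smoothstep s = 0.
Proof. move=> ?; pp_cases s; nra. Qed.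
Lemma smoothstep_ge1 s : 1 <= s -> smoothstep s = 1.
Proof. move=> ?; pp_cases s; nra. Qed.
Lemma smoothstep_itv s : 0 <= smoothstep s <= 1.
Proof. by pp_cases s; apply/andP; split; nra. Qed.
Lemma smoothstep'_le0 s : s <= 0 -> smoothstep' s = 0.
Proof. move=> ?; pp_cases s; nra. Qed.
Lemma smoothstep'_ge1 s : 1 <= s -> smoothstep' s = 0.
Proof. move=> ?; pp_cases s; nra. Qed.
Lemma smoothstep'_itv s : 0 <= smoothstep' s <= 2.
Proof. by pp_cases s; apply/andP; split; nra. Qed.

Lemma continuous_pos_part : continuous pos_part.
Proof.
move=> x; rewrite /pos_part; apply: continuous_max; [exact: cvg_id|exact: cvg_cst].
Qed.

Lemma continuous_smoothstep' : continuous smoothstep'.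
Proof.
have c k : continuous (fun s : R => pos_part (s - k)).
  move=> x; apply: (@continuous_comp _ _ _ (fun s => s - k) pos_part).
    by apply: cvgB; [exact: cvg_id|exact: cvg_cst].
  exact: continuous_pos_part.
move=> x; apply: cvgM; first exact: cvg_cst.
apply: cvgD; last exact: c.
apply: cvgB; first exact: continuous_pos_part.
by apply: cvgM; [exact: cvg_cst|exact: c].
Qed.

Lemma is_derive_comp_affine (F : R -> R) x r s d : is_derive ((s - x) / r) 1 F d ->
  is_derive s 1 (fun s => F ((s - x) / r)) (d / r).
Proof.
move=> dF; have dl : is_derive s 1 (fun s => (s - x) / r) r^-1.
  have -> : (fun s => (s - x) / r) = (fun s => r^-1 *: (s - x)) by apply/funext => u; rewrite mulrC.
  by apply: is_derive_eq; rewrite subr0 /GRing.scale/= mulr1.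
exact: (@is_derive1_comp _ F (fun s => (s - x) / r) s d r^-1 dF dl).
Qed.

Lemma is_derive_smoothstep s : is_derive s 1 smoothstep (smoothstep' s).
Proof.
have d1 (k u : R) : is_derive u 1 (fun s : R => pos_part (s - k) ^+ 2) (2 * pos_part (u - k)).
  have := @is_derive_comp_affine (fun s => pos_part s ^+ 2) k 1 u (2 * pos_part (u - k)).
  rewrite !divr1.
  have -> : (fun s : R => pos_part ((s - k) / 1) ^+ 2) = (fun s => pos_part (s - k) ^+ 2).
    by apply/funext => v; rewrite divr1.
  by apply; exact: is_derive_pos_part_sqr.
have -> : smoothstep = (fun s => 2 *: ((pos_part s ^+ 2 - 2 *: pos_part (s - 2^-1) ^+ 2) + pos_part (s - 1) ^+ 2)).
  by [].
have ? := is_derive_pos_part_sqr s; have ? := d1 2^-1 s; have ? := d1 1 s.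
apply: is_derive_eq; rewrite /smoothstep' /GRing.scale/=; lra.
Qed.

Definition ramp x r s : R := smoothstep ((s - x) / r).
Definition ramp' x r s : R := smoothstep' ((s - x) / r) / r.

Lemma is_derive_ramp x r s : is_derive s 1 (ramp x r) (ramp' x r s).
Proof. exact/is_derive_comp_affine/is_derive_smoothstep. Qed.

Lemma continuous_ramp' x r : continuous (ramp' x r).
Proof.
move=> s; apply: cvgM; last exact: cvg_cst.
apply: (@continuous_comp _ _ _ (fun s => (s - x) / r) smoothstep').
  apply: cvgM; last exact: cvg_cst.
  by apply: cvgB; [exact: cvg_id|exact: cvg_cst].
exact: continuous_smoothstep'.
Qed.

Lemma continuous_ramp x r : continuous (ramp x r).
Proof.
move=> s; apply: differentiable_continuous; apply/derivable1_diffP.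
by have [] := is_derive_ramp x r s.
Qed.

Lemma ramp_le x r s : 0 < r -> s <= x -> ramp x r s = 0.
Proof. by move=> r0 sx; apply: smoothstep_le0; rewrite ler_pdivrMr// mul0r subr_le0. Qed.
Lemma ramp_ge x r s : 0 < r -> x + r <= s -> ramp x r s = 1.
Proof. by move=> r0 sx; apply: smoothstep_ge1; rewrite ler_pdivlMr// mul1r; lra. Qed.
Lemma ramp_itv x r s : 0 <= ramp x r s <= 1. Proof. exact: smoothstep_itv. Qed.
Lemma ramp'_le x r s : 0 < r -> s <= x -> ramp' x r s = 0.
Proof. by move=> r0 sx; rewrite /ramp' smoothstep'_le0 ?mul0r// ler_pdivrMr// mul0r subr_le0. Qed.
Lemma ramp'_ge x r s : 0 < r -> x + r <= s -> ramp' x r s = 0.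
Proof. by move=> r0 sx; rewrite /ramp' smoothstep'_ge1 ?mul0r// ler_pdivlMr// mul1r; lra. Qed.
Lemma ramp'_itv x r s : 0 < r -> 0 <= ramp' x r s <= 2 / r.
Proof.
move=> r0; have /andP[S0 S2] := smoothstep'_itv ((s - x) / r).
by apply/andP; split; [rewrite divr_ge0// ltW|rewrite ler_wpM2r// invr_ge0 ltW].
Qed.

Lemma rint_ramp' x r : 0 < r -> rint x (x + r) (ramp' x r) = 1.
Proof.
move=> r0; rewrite (_ : 1 = ramp x r (x + r) - ramp x r x); last first.
  by rewrite ramp_ge// ramp_le// subr0.
apply: rint_FTC.
- by rewrite lerDl ltW.
- by apply: continuous_subspaceT; exact: continuous_ramp'.
- by move=> s _; exact: is_derive_ramp.
- by apply: continuous_subspaceT; exact: continuous_ramp.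
Qed.

End Smoothstep.

(** * Sobolev functions on (0,1) *)

Section WeakDerivative.
Context {R : realType}.
Local Notation mu := (@lebesgue_measure R).
Implicit Types (f g : R -> R) (x y r a b e : R) (D : set R).

Lemma continuous_measurable_itv a b f : continuous f -> measurable_fun `]a, b[ f.
Proof. by move=> cf; apply: (measurable_funS measurableT (@subsetT _ _)); exact: continuous_measurable_fun. Qed.

Arguments continuous_measurable_itv a b {f}.

Lemma locally_rintegrable D a b f : locally_integrable D f -> `[a, b] `<=` D ->
  rintegrable a b f.
Proof.
move=> [mf oD fD] abD; have fy := fD _ abD (@segment_compact _ a b).
have : mu.-integrable `[a, b] (EFin \o f).
  apply/integrableP; split=> //; apply/measurable_EFinP.
  by apply: measurable_funS mf => //; exact: open_measurable.
by apply: integrableS => //; exact: subset_itv_oo_cc.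
Qed.

Lemma Rintegral_support D a b f : `]a, b[ `<=` D ->
  (forall s, ~ (a < s < b) -> f s = 0) -> \int[mu]_(s in D) f s = rint a b f.
Proof.
move=> abD f0; rewrite /rint Rintegral_mkcond [RHS]Rintegral_mkcond.
congr (Rintegral _ _ _); apply/funext => s; rewrite /patch.
case: (boolP (s \in `]a, b[%classic)) => sab.
  by rewrite ifT// inE; apply: abD; rewrite inE in sab.
case: ifP => // _; apply: f0 => sab'.
by move/negP: sab; apply; rewrite inE/= in_itv.
Qed.

Lemma ramp_test_function D x y r : 0 < r -> x <= y -> `[x, y + r] `<=` D ->
  test_function D (fun s => ramp x r s - ramp y r s) /\
  derive1 (fun s => ramp x r s - ramp y r s) = (fun s => ramp' x r s - ramp' y r s).
Proof.
move=> r0 xy xyD.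
have dv (s : R) : is_derive s 1 (fun s => ramp x r s - ramp y r s) (ramp' x r s - ramp' y r s).
  by have := is_derive_ramp x r s; have := is_derive_ramp y r s => ? ?; apply: is_derive_eq.
have dE : derive1 (fun s => ramp x r s - ramp y r s) = (fun s => ramp' x r s - ramp' y r s).
  by apply/funext => s; rewrite derive1E; have [] := dv s.
split=> //; split.
- by move=> s; have [] := dv s.
- by rewrite dE => s; apply: cvgB; exact: continuous_ramp'.
- exists `[x, y + r]%classic; split => //; first exact: segment_compact.
  move=> s /= /negP; rewrite in_itv/= negb_and -!ltNge => /orP[sx|sy].
    by rewrite !ramp_le ?subrr//; lra.
  by rewrite !ramp_ge ?subrr//; lra.
Qed.

(** [ramp' x r] is a nonnegative kernel of mass 1 carried by [x, x + r] and bounded by 2 / r; this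
    bound times the integrated deviation e r is 2 e. *)
Lemma rint_ramp'_near f x r e : 0 < r -> rintegrable x (x + r) f ->
  rint x (x + r) (fun s => `|f s - f x|) <= e * r ->
  `|rint x (x + r) (fun s => f s * ramp' x r s) - f x| <= 2 * e.
Proof.
move=> r0 fi fe; have xr : x <= x + r by rewrite lerDl ltW.
have mr := continuous_measurable_itv x (x + r) (@continuous_ramp' _ x r).
have br s : x < s < x + r -> `|ramp' x r s| <= 2 / r.
  by move=> _; have /andP[? ?] := ramp'_itv x s r0; rewrite ger0_norm.
have fri := rintegrableM_bounded fi mr br.
have cri : rintegrable x (x + r) (fun s => f x * ramp' x r s).
  exact: rintegrableM_bounded (rintegrable_cst _ _ _) mr br.
have fxE : f x = rint x (x + r) (fun s => f x * ramp' x r s).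
  rewrite rintZ ?rint_ramp' ?mulr1//.
  by apply: rintegrable_cont; apply: continuous_subspaceT; exact: continuous_ramp'.
rewrite [X in _ - X]fxE -rintB//; apply: (le_trans (ler_norm_rint (rintegrableB fri cri))).
have fxi : rintegrable x (x + r) (fun s => `|f s - f x|).
  by apply: rintegrable_norm; apply: rintegrableB => //; exact: rintegrable_cst.
apply: (@le_trans _ _ (rint x (x + r) (fun s => 2 / r * `|f s - f x|))).
  apply: le_rint.
  - exact/rintegrable_norm/rintegrableB.
  - exact: rintegrableZ.
  - by move=> s xs; rewrite -mulrBl normrM mulrC ler_wpM2r// br.
rewrite rintZ// mulrAC ler_pdivrMr//; lra.
Qed.

(** The derivative of the test function [ramp x r - ramp y r] is close to a unit mass at x minus one
    at y, while the function itself is close to the indicator of [x, y]; as r tends to 0 the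
    definition of the weak derivative turns into the claim. Right Lebesgue points suffice because
    both ramps rise to the right of their base point; [r0] leaves room for the second one. *)
Lemma weak_deriv_rint D f g x y r0 : weak_deriv D f g -> x < y -> 0 < r0 ->
  `[x, y + r0] `<=` D -> lpt f x -> lpt f y -> f y - f x = rint x y g.
Proof.
move=> [lf lg wfg] xy r00 xyD lx ly.
have fi := locally_rintegrable lf xyD; have gi := locally_rintegrable lg xyD.
have gai := rintegrable_norm gi.
apply/eqP; rewrite -subr_eq0 -normr_eq0 eq_le normr_ge0 andbT.
apply/ler_addgt0Pl => e e0; rewrite addr0.
(* Error budget: 2 (e / 8) at each of x and y from [rint_ramp'_near], and e / 8 for each of the two
   intervals of length r where a ramp is between 0 and 1. *)
have e8 : 0 < e / 8 by rewrite divr_gt0.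
have [d1 d10 l1] := lx _ e8; have [d2 d20 l2] := ly _ e8.
have [d3 d30 l3] := rint_small gi e8.
pose r := Num.min (Num.min (d1 / 2) (d2 / 2)) (Num.min (d3 / 2) (Num.min (y - x) r0)).
have /and4P[r_gt0 rd1 rd2 /and3P[rd3 ryx rr0]] :
    [&& 0 < r, r < d1, r < d2 & [&& r < d3, r <= y - x & r <= r0]].
  rewrite /r !lt_min !gt_min !ge_min !lexx ?orbT/= ?andbT subr_gt0 xy r00 !divr_gt0//=.
  have h (d : R) : 0 < d -> d / 2 < d by move=> ?; lra.
  by rewrite !h ?orbT.
have xyrD : `[x, y + r] `<=` D.
  by apply: subset_trans xyD; apply: subset_itvl; rewrite bnd_simp lerD2l.
have [tf dE] := ramp_test_function r_gt0 (ltW xy) xyrD.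
have := wfg _ tf; rewrite dE.
have oD : `]x, y + r[ `<=` D by apply: subset_trans xyrD; exact: subset_itv_oo_cc.
rewrite !(Rintegral_support oD); first last.
- move=> s xsy; case: (leP s x) => sx; first by rewrite !ramp'_le ?subrr ?mulr0//; lra.
  case: (leP (y + r) s) => sy; first by rewrite !ramp'_ge ?subrr ?mulr0//; lra.
  by exfalso; apply: xsy; rewrite sx sy.
- move=> s xsy; case: (leP s x) => sx; first by rewrite !ramp_le ?subrr ?mulr0//; lra.
  case: (leP (y + r) s) => sy; first by rewrite !ramp_ge ?subrr ?mulr0//; lra.
  by exfalso; apply: xsy; rewrite sx sy.
have fi' : rintegrable x (y + r) f by apply: rintegrable_sub fi _ _; lra.
have gi' : rintegrable x (y + r) g by apply: rintegrable_sub gi _ _; lra.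
have mr' z a b := continuous_measurable_itv a b (@continuous_ramp' _ z r).
have br' z a b s : a < s < b -> `|ramp' z r s| <= 2 / r.
  by move=> _; have /andP[? ?] := ramp'_itv z s r_gt0; rewrite ger0_norm.
have mr z a b := continuous_measurable_itv a b (@continuous_ramp _ z r).
have br z a b s : a < s < b -> `|ramp z r s| <= 1.
  by move=> _; have /andP[? ?] := ramp_itv z r s; rewrite ger0_norm.
have fxi := rintegrableM_bounded fi' (mr' x _ _) (br' x _ _).
have fyi := rintegrableM_bounded fi' (mr' y _ _) (br' y _ _).
rewrite (@eq_rint _ _ _ _ (fun s => f s * ramp' x r s - f s * ramp' y r s)); last first.
  by move=> s _; rewrite mulrBr.
rewrite rintB// (@rint_split _ _ (x + r))//; [|lra|lra].
rewrite [X in (_ + X) - _](@eq_rint _ _ _ _ (fun=> 0)); last first.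
  by move=> s /andP[xs _]; rewrite ramp'_ge ?mulr0// ltW.
rewrite rint_cst ?mul0r ?addr0; last by lra.
rewrite (@rint_split _ x y _ (fun s => f s * ramp' y r s))//; [|lra|lra].
rewrite [X in _ - (X + _)](@eq_rint _ _ _ _ (fun=> 0)); last first.
  by move=> s /andP[_ sy]; rewrite ramp'_le ?mulr0// ltW.
rewrite rint_cst ?mul0r ?add0r; last by lra.
have Fx : `|rint x (x + r) (fun s => f s * ramp' x r s) - f x| <= 2 * (e / 8).
  apply: rint_ramp'_near => //; last by apply: l1; rewrite r_gt0.
  by apply: rintegrable_sub fi' _ _; lra.
have Fy : `|rint y (y + r) (fun s => f s * ramp' y r s) - f y| <= 2 * (e / 8).
  apply: rint_ramp'_near => //; last by apply: l2; rewrite r_gt0.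
  by apply: rintegrable_sub fi' _ _; lra.
have mth a b : measurable_fun `]a, b[ (fun s => ramp x r s - ramp y r s).
  by apply: measurable_funB; exact: mr.
have bth a b s : a < s < b -> `|ramp x r s - ramp y r s| <= 1.
  move=> _; have /andP[? ?] := ramp_itv x r s; have /andP[? ?] := ramp_itv y r s.
  by rewrite ler_norml; apply/andP; split; lra.
have gti : rintegrable x (y + r) (fun s => g s * (ramp x r s - ramp y r s)).
  exact: rintegrableM_bounded gi' (mth _ _) (bth _ _).
rewrite (@rint_split _ x y (y + r))//; [|lra|lra].
have giy : rintegrable y (y + r) g by apply: rintegrable_sub gi' _ _; lra.
have gix : rintegrable x (x + r) g by apply: rintegrable_sub gi' _ _; lra.
have gixy : rintegrable x y g by apply: rintegrable_sub gi' _ _; lra.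
have Gy : `|rint y (y + r) (fun s => g s * (ramp x r s - ramp y r s))| <= e / 8.
  apply: (@le_trans _ _ (rint y (y + r) (fun s => `|g s|))).
    have gtyi := rintegrableM_bounded giy (mth _ _) (bth _ _).
    apply: (le_trans (ler_norm_rint gtyi)); apply: le_rint.
    - exact: rintegrable_norm.
    - exact: rintegrable_norm.
    - by move=> s sy; rewrite normrM ler_piMr// (bth y (y + r)).
  by apply/ltW/l3; [lra|lra|apply/andP; split; lra].
have gtxyi := rintegrableM_bounded gixy (mth _ _) (bth _ _).
have Gxy : `|rint x y (fun s => g s * (ramp x r s - ramp y r s)) - rint x y g| <= e / 8.
  rewrite -rintB// (@rint_split _ x (x + r)); [|lra|lra|exact: rintegrableB].
  rewrite [X in _ + X](@eq_rint _ _ _ _ (fun=> 0)); last first.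
    move=> s /andP[xs sy]; rewrite ramp_ge ?(ltW xs)// ramp_le ?(ltW sy)//; lra.
  rewrite rint_cst ?mul0r ?addr0; last by lra.
  apply: (@le_trans _ _ (rint x (x + r) (fun s => `|g s|))).
    have gtxi := rintegrableB (rintegrableM_bounded gix (mth _ _) (bth _ _)) gix.
    apply: (le_trans (ler_norm_rint gtxi)); apply: le_rint.
    - exact: rintegrable_norm.
    - exact: rintegrable_norm.
    - move=> s /andP[xs sx]; rewrite -[X in _ - X]mulr1 -mulrBr normrM ler_piMr//.
      rewrite [ramp y r s]ramp_le ?subr0//; last by lra.
      by have /andP[? ?] := ramp_itv x r s; rewrite ler_norml; apply/andP; split; lra.
  by apply/ltW/l3; [lra|lra|apply/andP; split; lra].
move: Fx Fy Gy Gxy; rewrite !ler_norml => /andP[? ?] /andP[? ?] /andP[? ?] /andP[? ?].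
move=> ?; apply/andP; split; lra.
Qed.

End WeakDerivative.
Arguments continuous_measurable_itv {R} a b {f}.

Section H1.
Context {R : realType}.
Local Notation mu := (@lebesgue_measure R).
Local Notation I01 := (`]0, 1[%classic : set R).
Implicit Types (f g F G : R -> R) (x y r a b e d k : R).

Lemma within_continuousP a b F : {within `[a, b], continuous F} <->
  forall x, a <= x <= b -> forall e, 0 < e -> exists2 d, 0 < d &
    forall y, a <= y <= b -> `|y - x| < d -> `|F x - F y| <= e.
Proof.
split=> [/subspace_continuousP cF x xab e e0|cF].
  have xI : `[a, b]%classic x by rewrite /= in_itv.
  have /cvgrPdist_le/(_ _ e0) := cF x xI.
  rewrite near_withinE => -[d /= d0 dP]; exists d => // y yab yx.
  by apply: dP => //=; rewrite ?in_itv// distrC.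
apply/subspace_continuousP => x /=; rewrite in_itv/= => xab.
apply/cvgrPdist_le => e e0; have [d d0 dP] := cF x xab e e0.
rewrite near_withinE; exists d => //= y /= yx; rewrite in_itv/= => yab.
by apply: dP => //; rewrite distrC.
Qed.

Lemma rint_antideriv_continuous a b F g : rintegrable a b g ->
  (forall x y, a <= x -> x <= y -> y <= b -> F y - F x = rint x y g) ->
  {within `[a, b], continuous F}.
Proof.
move=> gi FE; apply/within_continuousP => x /andP[ax xb] e e0.
have [d d0 dP] := rint_small gi e0; exists d => // y /andP[ay yb].
have sm u v : a <= u -> u <= v -> v <= b -> `|v - u| < d -> `|F v - F u| <= e.
  move=> au uv vb; rewrite ger0_norm ?subr_ge0// => vud; rewrite FE//.
  have gi' : rintegrable u v g by exact: rintegrable_sub gi _ _.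
  apply: (le_trans (ler_norm_rint gi')); rewrite -{1}(subrKC u v); apply/ltW/dP => //; lra.
case: (leP x y) => xy yx; last by apply: sm => //; [exact: ltW|rewrite distrC].
by rewrite distrC; exact: sm.
Qed.

(** Cauchy-Schwarz against the constant 1, read off from the nonnegative variance of g about its
    mean m. *)
Lemma sqr_rint_le a b g : a <= b -> measurable_fun `]a, b[ g ->
  rintegrable a b (fun s => g s ^+ 2) ->
  rint a b g ^+ 2 <= (b - a) * rint a b (fun s => g s ^+ 2).
Proof.
rewrite le_eqVlt => /predU1P[->|ab] mg g2.
  by rewrite !rint_nil// expr0n mulr0.
have gi := rintegrable_of_sqr mg g2.
set m := rint a b g / (b - a).
have ba : 0 < b - a by rewrite subr_gt0.
have h : 0 <= rint a b (fun s => (g s - m) ^+ 2) by apply: rint_ge0 => s _; exact: sqr_ge0.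
have E : rint a b (fun s => (g s - m) ^+ 2) =
   rint a b (fun s => g s ^+ 2) - 2 * m * rint a b g + m ^+ 2 * (b - a).
  rewrite -rintZ// -rintB//; last exact: rintegrableZ.
  rewrite -rint_cst ?ltW// -rintD//; last exact: rintegrable_cst.
    by apply: eq_rint => s _; ring.
  by apply: rintegrableB => //; exact: rintegrableZ.
have mE : rint a b g = m * (b - a) by rewrite /m divfK// gt_eqF.
move: h; rewrite E mE => h.
have : 0 <= (b - a) * (rint a b (fun s => g s ^+ 2) - 2 * m * (m * (b - a)) + m ^+ 2 * (b - a)).
  by rewrite mulr_ge0// ltW.
by lra.
Qed.

Lemma lpt_continuous f x d : 0 < d -> rintegrable x (x + d) f ->
  f s @[s --> x^'+] --> f x -> lpt f x.
Proof.
move=> d0 fi /cvgrPdist_le cf e e0; have [d' /= d'0 dP] := cf e e0.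
exists (Num.min d d'); first by rewrite lt_min d0.
move=> r /andP[r0]; rewrite lt_min => /andP[rd rd'].
rewrite [X in _ <= _ * X](_ : r = x + r - x); last by lra.
have xr : x <= x + r by lra.
rewrite -(rint_cst e xr); apply: le_rint.
- apply: rintegrable_norm; apply: rintegrableB; last exact: rintegrable_cst.
  by apply: rintegrable_sub fi _ _; lra.
- exact: rintegrable_cst.
- move=> s /andP[xs sx]; rewrite distrC; apply: dP => //=.
  by rewrite distrC gtr0_norm ?subr_gt0//; lra.
Qed.

(** At a right Lebesgue point x the deviation from g(x) integrates to at most e r, while the
    integral of g vanishes; so |g(x)| r <= e r. *)
Lemma rint0_ae a b g : rintegrable a b g ->
  (forall x y, a < x -> x < y -> y < b -> rint x y g = 0) ->
  {ae mu, forall x, `]a, b[%classic x -> g x = 0}.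
Proof.
move=> gi g0; apply: ae_imp (lpt_ae gi) => x lx /= xab.
move: (lx xab) => {}lx; move: xab; rewrite in_itv/= => /andP[ax xb].
apply/eqP; rewrite -normr_eq0 eq_le normr_ge0 andbT; apply/ler_addgt0Pl => e e0.
rewrite addr0; have [d d0 dP] := lx e e0.
pose r := Num.min (d / 2) ((b - x) / 2).
have /andP[r0 /andP[rd rb]] : [&& 0 < r, r < d & r < b - x].
  rewrite /r lt_min !gt_min !divr_gt0 ?subr_gt0//=; apply/andP; split; apply/orP.
  - by left; lra.
  - by right; lra.
have gi' : rintegrable x (x + r) g by apply: rintegrable_sub gi _ _; lra.
have := dP r; rewrite r0 rd => /(_ isT) le1.
have gig : rintegrable x (x + r) (fun s => g s - g x).
  by apply: rintegrableB => //; exact: rintegrable_cst.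
have := le_trans (ler_norm_rint gig) le1.
rewrite rintB// ?rint_cst ?g0//; last exact: rintegrable_cst; try lra.
rewrite sub0r normrN normrM (_ : x + r - x = r); last by lra.
by rewrite (gtr0_norm r0) ler_pM2r.
Qed.

Lemma continuous_ae_eq a b F G : a < b -> {within `[a, b], continuous F} ->
  {within `[a, b], continuous G} -> ae_eq mu (`]a, b[%classic : set R) F G ->
  forall x, a <= x <= b -> F x = G x.
Proof.
move=> ltab /within_continuousP cF /within_continuousP cG FG x xab.
apply/eqP; rewrite -subr_eq0 -normr_eq0 eq_le normr_ge0 andbT.
apply/ler_addgt0Pl => e e0; rewrite addr0.
have e2 : 0 < e / 2 by rewrite divr_gt0.
have [d1 d10 F1] := cF x xab _ e2; have [d2 d20 G2] := cG x xab _ e2.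
have d0 : 0 < Num.min d1 d2 by rewrite lt_min d10.
set d := Num.min d1 d2 in d0 *.
have ab : Num.max a (x - d) < Num.min b (x + d).
  by rewrite lt_min !gt_max; move/andP: xab => [? ?]; apply/andP; split; apply/andP; split; lra.
have [s /andP[s1 s2] FGs] := ae_point ab FG.
move: s1 s2; rewrite gt_max lt_min => /andP[s0 sx] /andP[s1 xs].
have s01 : a <= s <= b by rewrite !ltW.
have : `|s - x| < d by rewrite ltr_norml; apply/andP; split; lra.
rewrite lt_min => /andP[sd1 sd2].
have := F1 s s01 sd1; have := G2 s s01 sd2.
have -> : F s = G s by apply: FGs; rewrite /= in_itv/= s0 s1.
rewrite !ler_norml => /andP[? ?] /andP[? ?]; apply/andP; split; lra.
Qed.

Lemma weak_deriv_rep f g : weak_deriv I01 f g -> rintegrable 0 1 f -> rintegrable 0 1 g ->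
  exists F, [/\ {within `[0, 1], continuous F}, ae_eq mu I01 f F &
    forall x y, 0 <= x -> x <= y -> y <= 1 -> F y - F x = rint x y g].
Proof.
move=> wfg fi gi.
have lf := lpt_ae fi.
have [x0 /andP[x00 x01] lx0] := ae_point ltr01 lf.
have {}lx0 : lpt f x0 by apply: lx0; rewrite /= in_itv/= x00.
(* The constant of integration is fixed by the value of f at one Lebesgue point; [weak_deriv_rint]
   then gives equality at all the others. *)
pose F x := f x0 + (rint 0 x g - rint 0 x0 g).
have FE x y : 0 <= x -> x <= y -> y <= 1 -> F y - F x = rint x y g.
  move=> x0' xy y1; rewrite /F (@rint_split _ 0 x y)//; first by ring.
  by apply: rintegrable_sub gi _ _.
exists F; split => //; first exact: rint_antideriv_continuous gi FE.
apply: ae_imp lf => x lx x01'; have {}lx := lx x01'.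
move: x01'; rewrite /= in_itv/= => /andP[x0' x1].
have F0 : F x0 = f x0 by rewrite /F subrr addr0.
have H u v : 0 < u -> u < v -> v < 1 -> lpt f u -> lpt f v -> f v - f u = F v - F u.
  move=> u0 uv v1 lu lv; rewrite FE ?ltW//.
  apply: (@weak_deriv_rint _ I01 f g u v ((1 - v) / 2)) => //; first by rewrite divr_gt0// subr_gt0.
  by move=> s /=; rewrite !in_itv/= => /andP[us sv]; apply/andP; split; lra.
have [xx0|xx0|->] := ltgtP x x0; last by [].
- by have := H x x0 x0' xx0 x01 lx lx0; lra.
- by have := H x0 x x00 xx0 x1 lx0 lx; lra.
Qed.

Lemma L2_rintegrable f : L2 f -> rintegrable 0 1 f.
Proof. by move=> /L2P[mf f2]; exact: rintegrable_of_sqr. Qed.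

(** [cont_rep f] is a mere choice; it coincides on [0,1] with the primitive of [wD f] constructed
    above, since continuous functions that are equal almost everywhere are equal. *)
Lemma sobolev1_rep f : sobolev 1 f ->
  [/\ {within `[0, 1], continuous (cont_rep f)}, ae_eq mu I01 f (cont_rep f) &
    forall x y, 0 <= x -> x <= y -> y <= 1 ->
      cont_rep f y - cont_rep f x = rint x y (wD f)].
Proof.
move=> [fL wf gL]; have [F [cF fF FE]] := weak_deriv_rep wf (L2_rintegrable fL) (L2_rintegrable gL).
have /getPex[cG fG] : exists G, {within `[0, 1], continuous G} /\ ae_eq mu I01 f G by exists F.
rewrite -/(cont_rep f) in cG fG.
have EG : forall x, 0 <= x <= 1 -> cont_rep f x = F x.
  apply: (continuous_ae_eq ltr01) => //; apply: ae_imp (ae_and fF fG) => x [h1 h2] x01.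
  by rewrite -h1// -h2.
split=> // x y x0 xy y1; rewrite !EG ?FE//; apply/andP; split => //; lra.
Qed.

Lemma cont_rep_eq f F : {within `[0, 1], continuous F} -> ae_eq mu I01 f F ->
  forall x, 0 <= x <= 1 -> cont_rep f x = F x.
Proof.
move=> cF fF.
have /getPex[cG fG] : exists G, {within `[0, 1], continuous G} /\ ae_eq mu I01 f G by exists F.
rewrite -/(cont_rep f) in cG fG.
apply: (continuous_ae_eq ltr01) => //; apply: ae_imp (ae_and fF fG) => x [h1 h2] x01.
by rewrite -h1// -h2.
Qed.

Lemma within_continuous_meas a b F : {within `[a, b], continuous F} -> measurable_fun `]a, b[ F.
Proof. by move=> /rintegrable_cont/rintegrable_meas. Qed.

Lemma within_continuous_sqr a b F : {within `[a, b], continuous F} ->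
  {within `[a, b], continuous (fun x => F x ^+ 2)}.
Proof. by move=> cF x; apply: cvgM; exact: cF. Qed.

Lemma sobolev1_holder f : sobolev 1 f -> forall x y, 0 <= x <= 1 -> 0 <= y <= 1 ->
  (cont_rep f y - cont_rep f x) ^+ 2 <= `|y - x| * L2norm (wD f) ^+ 2.
Proof.
move=> f1; have [cF fF FE] := sobolev1_rep f1; have [_ _ gL] := f1.
have [mg g2] := (L2P _).1 gL.
have H x y : 0 <= x -> x <= y -> y <= 1 ->
    (cont_rep f y - cont_rep f x) ^+ 2 <= `|y - x| * L2norm (wD f) ^+ 2.
  move=> x0 xy y1; rewrite FE// L2norm_sqr ger0_norm ?subr_ge0//.
  have mg' : measurable_fun `]x, y[ (wD f).
    by apply: measurable_funS mg => //; apply: subset_itvW.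
  apply: (le_trans (sqr_rint_le xy mg' (rintegrable_sub g2 x0 y1))).
  rewrite ler_wpM2l ?subr_ge0//.
  rewrite (@rint_split _ 0 x 1)//; last by lra.
  rewrite (@rint_split _ x y 1)//; last by apply: rintegrable_sub g2 _ _.
  have : 0 <= rint 0 x (fun s => wD f s ^+ 2) by apply: rint_ge0 => s _; exact: sqr_ge0.
  have : 0 <= rint y 1 (fun s => wD f s ^+ 2) by apply: rint_ge0 => s _; exact: sqr_ge0.
  by lra.
move=> x y /andP[x0 x1] /andP[y0 y1]; case: (leP x y) => xy; first exact: H.
by rewrite -sqrrN opprB distrC; apply: H => //; exact: ltW.
Qed.

(** f(x)^2 <= 2 f(s)^2 + 2 (f(x) - f(s))^2, with the Hoelder bound for the last term, averaged over
    s in (0,1). *)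
Lemma sobolev1_sup f : sobolev 1 f -> forall x, 0 <= x <= 1 ->
  cont_rep f x ^+ 2 <= 2 * (L2norm f ^+ 2 + L2norm (wD f) ^+ 2).
Proof.
move=> f1 x x01; have [cF fF FE] := sobolev1_rep f1; have [fL _ _] := f1.
have [mf f2] := (L2P _).1 fL.
have -> : L2norm f ^+ 2 = rint 0 1 (fun s => cont_rep f s ^+ 2).
  rewrite L2norm_sqr; apply: ae_eq_rint.
  - exact: measurable_funX.
  - by apply: within_continuous_meas; exact: within_continuous_sqr.
  - by apply: ae_imp fF => s /[apply] ->.
set I := L2norm (wD f) ^+ 2.
have -> : cont_rep f x ^+ 2 = rint 0 1 (fun=> cont_rep f x ^+ 2).
  by rewrite rint_cst ?subr0 ?mulr1.
have -> : 2 * (rint 0 1 (fun s => cont_rep f s ^+ 2) + I) =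
    rint 0 1 (fun s => 2 * cont_rep f s ^+ 2 + 2 * I).
  have ci : rintegrable 0 1 (fun s => cont_rep f s ^+ 2).
    by apply: rintegrable_cont; exact: within_continuous_sqr.
  rewrite rintD; [|exact: rintegrableZ|exact: rintegrable_cst].
  by rewrite rintZ// rint_cst// subr0 mulr1 mulrDr.
apply: le_rint; first exact: rintegrable_cst.
  apply: rintegrableD; last exact: rintegrable_cst.
  by apply: rintegrableZ; apply: rintegrable_cont; exact: within_continuous_sqr.
move=> s /andP[s0 s1]; have s01 : 0 <= s <= 1 by rewrite !ltW.
have := sobolev1_holder f1 s01 x01; rewrite -/I.
have I0 : 0 <= I by exact: sqr_ge0.
have : `|x - s| <= 1.
  by move: x01 => /andP[? ?]; rewrite ler_norml; apply/andP; split; lra.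
have := sqr_ge0 (cont_rep f s - (cont_rep f x - cont_rep f s)).
have := normr_ge0 (x - s).
set u := cont_rep f x; set v := cont_rep f s; set n := `|_|; nra.
Qed.

End H1.

(** * Partitions of [0,1] and piecewise C^1 functions *)

Section Partition.
Context {R : realType}.
Local Notation mu := (@lebesgue_measure R).
Local Notation I01 := (`]0, 1[%classic : set R).
Context (N : nat) (xs : nat -> R) (part : is_partition N xs).
Implicit Types (f g F k v : R -> R) (x y : R).

Lemma partition_le i j : (i <= j)%N -> (j <= N)%N -> xs i <= xs j.
Proof.
have [_ _ lt] := part; elim: j => [|j IH]; first by rewrite leqn0 => /eqP->.
rewrite leq_eqVlt => /predU1P[->//|]; rewrite ltnS => ij jN.
by apply: (le_trans (IH ij (ltnW jN))); exact/ltW/lt.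
Qed.

Lemma partition_itv j : (j <= N)%N -> 0 <= xs j <= 1.
Proof.
have [x0 x1 _] := part => jN.
by rewrite -{1}x0 -x1 !partition_le.
Qed.

Lemma partition_cell x : 0 <= x <= 1 -> exists2 j, (j < N)%N & xs j <= x <= xs j.+1.
Proof.
have [x0 x1 lt] := part => /andP[x_ge0 x_le1].
suff H n : (n <= N)%N -> (0 < n)%N -> x <= xs n ->
    exists2 j, (j < n)%N & xs j <= x <= xs j.+1.
  have N0 : (0 < N)%N.
    by case: (N) x1 => // /eqP; rewrite x0 eq_sym oner_eq0.
  by apply: H => //; rewrite x1.
elim: n => // -[|n] IH nN _ xn; first by exists 0%N => //; rewrite x0 x_ge0.
case: (leP x (xs n.+1)) => xxn; last by exists n.+1 => //; rewrite xn ltW.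
by have [j jn xj] := IH (ltnW nN) isT xxn; exists j => //; exact: ltnW.
Qed.

Lemma rint_cells f : rintegrable 0 1 f ->
  rint 0 1 f = \sum_(j < N) rint (xs j) (xs j.+1) f.
Proof.
have [x0 x1 lt] := part => fi.
suff H n : (n <= N)%N -> rint 0 (xs n) f = \sum_(j < n) rint (xs j) (xs j.+1) f.
  by rewrite -H// x1.
elim: n => [|n IH] nN; first by rewrite big_ord0 x0 rint_nil.
rewrite big_ord_recr/= -IH ?(ltnW nN)// -rint_split//.
- by have /andP[] := partition_itv (ltnW nN).
- exact/ltW/lt.
- by apply: rintegrable_sub fi _ _ => //; have /andP[] := partition_itv nN.
Qed.

(** [kj] is the derivative extended continuously to the closed cell; [k] itself may jump at the
    nodes. *)
Definition piecewise_C1 F k : Prop := forall j, (j < N)%N -> exists kj : R -> R,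
  [/\ {within `[xs j, xs j.+1], continuous kj},
      forall x, xs j < x < xs j.+1 -> is_derive x 1 F (kj x) &
      forall x, xs j < x < xs j.+1 -> k x = kj x].

Lemma test_function_01 (theta : R -> R) : test_function I01 theta ->
  [/\ theta 0 = 0 /\ theta 1 = 0, continuous theta, continuous (derive1 theta),
     (forall x, is_derive x 1 theta (derive1 theta x)) &
     exists M, forall x, `|theta x| <= M /\ `|derive1 theta x| <= M].
Proof.
move=> [dth cdth [K [cK KI th0]]].
have cth : continuous theta.
  by move=> x; apply: differentiable_continuous; exact/derivable1_diffP.
split=> //.
- split; apply: th0 => /KI /=; rewrite in_itv/= ltxx//.
  by rewrite andbF.
- by move=> x; apply: DeriveDef => //; rewrite derive1E.
- have [M1 M1P] : exists M, forall x, 0 <= x <= 1 -> `|theta x| <= M.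
    have [c _ cP] := @EVT_max R (fun x => `|theta x|) 0 1 ler01 (continuous_subspaceT (fun x => cvg_norm (cth x))).
    by exists `|theta c| => x x01; apply: cP; rewrite in_itv.
  have [M2 M2P] : exists M, forall x, 0 <= x <= 1 -> `|derive1 theta x| <= M.
    have [c _ cP] := @EVT_max R (fun x => `|derive1 theta x|) 0 1 ler01 (continuous_subspaceT (fun x => cvg_norm (cdth x))).
    by exists `|derive1 theta c| => x x01; apply: cP; rewrite in_itv.
  have d0 x : ~~ (0 <= x <= 1) -> derive1 theta x = 0.
    rewrite negb_and -!ltNge => x01.
    have : \forall y \near x, theta y = 0.
      have : open ([set y : R | y < 0] `|` [set y | 1 < y]).
        by apply: openU; [exact: open_lt|exact: open_gt].
      move=> oA; have : nbhs x ([set y : R | y < 0] `|` [set y | 1 < y]).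
        by apply: open_nbhs_nbhs; split => //=; move/orP: x01.
      apply: filterS => y yA; apply: th0 => /KI /=; rewrite in_itv/= => /andP[? ?].
      by case: yA => /=; lra.
    move=> nth; rewrite derive1E (@near_eq_derive _ _ _ theta (cst 0))// ?derive_cst//.
  exists (Num.max M1 M2) => x; case: (boolP (0 <= x <= 1)) => x01.
    by split; rewrite le_max ?M1P ?M2P ?orbT.
  have M0 : 0 <= Num.max M1 M2.
    by rewrite le_max; apply/orP; left; rewrite (le_trans (normr_ge0 _) (M1P 0 _))// lexx ler01.
  rewrite d0// normr0; split => //; rewrite th0 ?normr0// => /KI /=; rewrite in_itv/=.
  by move=> /andP[? ?]; move/negP: x01; apply; rewrite !ltW.
Qed.

(** On each cell F theta has derivative F theta' + k theta; the sum over the cells telescopes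
    because F is continuous at the nodes, and theta vanishes at 0 and 1. *)
Lemma piecewise_C1_weak_deriv F k M : {within `[0, 1], continuous F} ->
  measurable_fun I01 k -> (forall x, 0 < x < 1 -> `|k x| <= M) ->
  piecewise_C1 F k -> weak_deriv I01 F k.
Proof.
move=> cF mk kM pw.
have Fi := rintegrable_cont cF; have ki := rintegrable_bounded mk kM.
split; [exact: open_integrable_locally|exact: open_integrable_locally|].
move=> theta /test_function_01[[th0 th1] cth cdth dth [B BP]].
rewrite -!/(rint 0 1 _); apply/eqP; rewrite -subr_eq0 opprK.
have Fth : rintegrable 0 1 (fun x => F x * derive1 theta x).
  apply: (@rintegrableM_bounded _ _ _ _ _ B) => //; last by move=> x _; case: (BP x).
  exact: continuous_measurable_itv.
have kth : rintegrable 0 1 (fun x => k x * theta x).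
  apply: (@rintegrableM_bounded _ _ _ _ _ B) => //; last by move=> x _; case: (BP x).
  exact: continuous_measurable_itv.
rewrite -rintD// rint_cells; last exact: rintegrableD.
have [x0 x1 lt] := part.
rewrite (eq_bigr (fun j : 'I_N => F (xs j.+1) * theta (xs j.+1) - F (xs j) * theta (xs j))); last first.
  move=> j _; have [kj [ckj dF kE]] := pw j (ltn_ord j).
  have cFj : {within `[xs j, xs j.+1], continuous F}.
    apply: continuous_subspaceW cF => s /=; rewrite !in_itv/= => /andP[? ?].
    have /andP[? ?] := partition_itv (ltnW (ltn_ord j)).
    by have /andP[? ?] := partition_itv (ltn_ord j); apply/andP; split; lra.
  rewrite (@eq_rint _ _ _ _ (fun x => F x * derive1 theta x + kj x * theta x)); last first.
    by move=> x xj; rewrite kE.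
  apply: (rint_FTC (F := fun x => F x * theta x)).
  - exact/ltW/lt.
  - move=> x; apply: cvgD; apply: cvgM.
    + exact: cFj.
    + by apply: (continuous_subspaceT cdth).
    + exact: ckj.
    + by apply: (continuous_subspaceT cth).
  - move=> x xj; have ? := dF x xj; have ? := dth x.
    by apply: is_derive_eq; rewrite /GRing.scale/=; ring.
  - by move=> x; apply: cvgM; [exact: cFj|exact: (continuous_subspaceT cth)].
rewrite -(big_mkord xpredT (fun j => F (xs j.+1) * theta (xs j.+1) - F (xs j) * theta (xs j))).
rewrite (telescope_sumr (fun j => F (xs j) * theta (xs j)))//.
by rewrite x0 x1 th0 th1 !mulr0 subrr.
Qed.

End Partition.

Section Sobolev1.
Context {R : realType}.
Local Notation mu := (@lebesgue_measure R).
Local Notation I01 := (`]0, 1[%classic : set R).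
Implicit Types (f g F G k v : R -> R) (x y M : R).

Lemma ae_eq_sym01 f g : ae_eq mu I01 f g -> ae_eq mu I01 g f.
Proof. by apply: ae_imp => x /[apply] ->. Qed.

Lemma weak_deriv_ae f F g : rintegrable 0 1 F -> measurable_fun I01 f ->
  ae_eq mu I01 f F -> weak_deriv I01 f g <-> weak_deriv I01 F g.
Proof.
move=> Fi mf fF.
have fi : rintegrable 0 1 f by apply: ae_eq_rintegrable mf _ Fi; exact: ae_eq_sym01.
have mF := rintegrable_meas Fi.
have H theta : test_function I01 theta ->
    rint 0 1 (fun x => f x * derive1 theta x) = rint 0 1 (fun x => F x * derive1 theta x).
  move=> /test_function_01[_ _ cth _ _].
  have mth := continuous_measurable_itv 0 1 cth.
  apply: ae_eq_rint; [exact: measurable_funM|exact: measurable_funM|].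
  by apply: ae_imp fF => x /[apply] ->.
split=> -[_ gi wfg]; split => //; try exact: open_integrable_locally.
- by move=> theta tth; rewrite -(wfg _ tth); apply/esym/H.
- by move=> theta tth; rewrite -(wfg _ tth); exact: H.
Qed.

Lemma within_continuous_lpt F x : {within `[0, 1], continuous F} -> 0 < x < 1 -> lpt F x.
Proof.
move=> cF /andP[x0 x1].
apply: (@lpt_continuous _ _ _ (1 - x)); first by rewrite subr_gt0.
  by apply: rintegrable_sub (rintegrable_cont cF) _ _; lra.
have [+ _ _] := (continuous_within_itvP _ (@ltr01 R)).1 cF.
by move=> /(_ x); rewrite in_itv/= x0 x1 => /(_ isT) h; apply: cvg_at_right_filter.
Qed.

Lemma weak_deriv_rint_cont F g x y : {within `[0, 1], continuous F} ->
  weak_deriv I01 F g -> 0 < x -> x <= y -> y < 1 -> F y - F x = rint x y g.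
Proof.
move=> cF wF x0; rewrite le_eqVlt => /predU1P[<-|xy y1]; first by rewrite rint_nil// subrr.
apply: (@weak_deriv_rint _ I01 F g x y ((1 - y) / 2)) => //.
- by rewrite divr_gt0// subr_gt0.
- by move=> s /=; rewrite !in_itv/= => /andP[us sv]; apply/andP; split; lra.
- by apply: within_continuous_lpt => //; rewrite x0 (lt_trans xy).
- by apply: within_continuous_lpt => //; rewrite y1 (lt_trans x0).
Qed.

(** Weak derivatives are only locally integrable, so they are compared on [e, 1 - e] with e = 1 / (n
    + 2), and the countably many null sets are united. *)
Lemma weak_deriv_unique F g1 g2 : {within `[0, 1], continuous F} ->
  weak_deriv I01 F g1 -> weak_deriv I01 F g2 -> ae_eq mu I01 g1 g2.
Proof.
move=> cF w1 w2.
have D0 n : 0 < n.+2%:R^-1 :> R by rewrite invr_gt0.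
have H n : {ae mu, forall x, n.+2%:R^-1 < x < 1 - n.+2%:R^-1 -> g1 x = g2 x}.
  set e := n.+2%:R^-1 : R.
  have sub : `[e, 1 - e] `<=` I01.
    move=> s /=; rewrite !in_itv/= => /andP[? ?]; have := D0 n; rewrite -/e => ?; apply/andP; split; lra.
  have [[_ l1 _] [_ l2 _]] := (w1, w2).
  have gi := rintegrableB (locally_rintegrable l1 sub) (locally_rintegrable l2 sub).
  have := rint0_ae gi; rewrite -/e => H.
  have {}H : {ae mu, forall x : R, `]e, (1 - e)[%classic x -> g1 x - g2 x = 0}.
    apply: H => x y ex xy ye.
    have e0 := D0 n; rewrite -/e in e0.
    rewrite rintB; [|apply: rintegrable_sub (locally_rintegrable l1 sub) _ _; lra
                    |apply: rintegrable_sub (locally_rintegrable l2 sub) _ _; lra].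
    have [? ?] : 0 < x /\ y < 1 by split; lra.
    rewrite -(weak_deriv_rint_cont cF w1)//; last exact: ltW.
    by rewrite -(weak_deriv_rint_cont cF w2) ?subrr//; exact: ltW.
  apply: ae_imp H => x H xe; apply/eqP; rewrite -subr_eq0; apply/eqP/H.
  by rewrite /= in_itv.
have := ae_foralln H.
apply: ae_imp => x Hx /=; rewrite in_itv/= => /andP[x0 x1].
have m0 : 0 < Num.min x (1 - x) by rewrite lt_min x0 subr_gt0.
pose n := Num.truncn (Num.min x (1 - x))^-1.
apply: (Hx n).
have : n.+2%:R^-1 < Num.min x (1 - x).
  rewrite -[ltRHS]invrK ltf_pV2 ?posrE ?invr_gt0//.
  by apply: (lt_trans (truncnS_gt _)); rewrite ltr_nat.
rewrite lt_min; move: (n.+2%:R^-1) => e /andP[? ?]; apply/andP; split; lra.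
Qed.

(** [wD] is a choice among weak derivatives, so an explicit derivative [k] is identified with it
    almost everywhere only; the bound on [k] makes [wD f] square integrable. *)
Lemma sobolev1_of f F k M : measurable_fun I01 f -> ae_eq mu I01 f F ->
  {within `[0, 1], continuous F} -> measurable_fun I01 k ->
  (forall x, 0 < x < 1 -> `|k x| <= M) -> weak_deriv I01 F k ->
  [/\ sobolev 1 f, ae_eq mu I01 (wD f) k & forall x, 0 <= x <= 1 -> cont_rep f x = F x].
Proof.
move=> mf fF cF mk kM wF.
have Fi := rintegrable_cont cF.
have wf : weak_deriv I01 f k by apply/(weak_deriv_ae k Fi mf fF).
have wDf : weak_deriv I01 f (wD f) by apply: getPex; exists k.
have wDF : weak_deriv I01 F (wD f) by apply/(weak_deriv_ae _ Fi mf fF).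
have wk := weak_deriv_unique cF wDF wF.
have [_ [mw _ _] _] := wDf.
split; last exact: cont_rep_eq.
- split=> //; apply/L2P; split => //.
  + apply: (@ae_eq_rintegrable _ _ _ (fun x => F x ^+ 2)).
    * exact: measurable_funX.
    * by apply: ae_imp fF => x /[apply] ->.
    * by apply: rintegrable_cont; exact: within_continuous_sqr.
  + apply: (@ae_eq_rintegrable _ _ _ (fun x => k x ^+ 2)).
    * exact: measurable_funX.
    * by apply: ae_imp wk => x /[apply] ->.
    * apply: (@rintegrable_bounded _ _ _ _ (M ^+ 2)); first exact: measurable_funX.
      by move=> x x01; rewrite normrX ler_pXn2r ?nnegrE ?kM// (le_trans (normr_ge0 _) (kM x x01)).
- exact: wk.
Qed.

End Sobolev1.

Lemma cvg_sumr {R : realType} (I T : Type) (r : seq I) (F : set_system T) {FF : Filter F}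
    (f : I -> T -> R) (l : I -> R) :
  (forall i, f i t @[t --> F] --> l i) ->
  \sum_(i <- r) f i t @[t --> F] --> \sum_(i <- r) l i.
Proof.
move=> fl; elim: r => [|i r IH].
  by rewrite big_nil; under eq_fun do rewrite big_nil; exact: cvg_cst.
by rewrite big_cons; under eq_fun do rewrite big_cons; apply: cvgD.
Qed.

Lemma innerE {R : realType} (f g : R -> R) : inner f g = rint 0 1 (fun x => f x * g x).
Proof. by []. Qed.

(** * Piecewise linear functions *)

Section PiecewiseLinear.
Context {R : realType}.
Local Notation mu := (@lebesgue_measure R).
Local Notation I01 := (`]0, 1[%classic : set R).
Context (N : nat) (xs : nat -> R) (part : is_partition N xs).
Implicit Types (f g F k v : R -> R) (x y : R) (c : nat -> R).

Definition cell (j : nat) : R := xs j.+1 - xs j.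

Lemma cell_gt0 j : (j < N)%N -> 0 < cell j.
Proof. by have [_ _ lt] := part => /lt; rewrite subr_gt0. Qed.

Definition slope c (j : nat) : R := (c j.+1 - c j) / cell j.

Lemma slopeM c j : (j < N)%N -> slope c j * cell j = c j.+1 - c j.
Proof. by move=> jN; rewrite /slope divfK// gt_eqF// cell_gt0. Qed.

(** The working form of [fe_space]: affine on closed cells and expressed by nodal values, whereas
    [fe_space] speaks of polynomials on open cells. *)
Definition pl v : Prop := {within `[0, 1], continuous v} /\
  forall j, (j < N)%N -> forall x, xs j <= x <= xs j.+1 ->
    v x = v (xs j) + slope (v \o xs) j * (x - xs j).

Lemma cell_within j v : (j < N)%N -> {within `[0, 1], continuous v} ->
  {within `[xs j, xs j.+1], continuous v}.
Proof.
move=> jN; apply: continuous_subspaceW => s /=; rewrite !in_itv/= => /andP[? ?].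
have /andP[? ?] := partition_itv part (ltnW jN).
by have /andP[? ?] := partition_itv part jN; apply/andP; split; lra.
Qed.

Lemma fe_space_pl v : fe_space N xs v -> pl v.
Proof.
move=> [cv pv]; split => // j jN.
have [_ _ lt] := part; have [p [sp vp]] := pv j jN.
have pE x : p.[x] = p`_0 + p`_1 * x.
  by rewrite (horner_coef_wide x sp) big_ord_recl big_ord1/= expr0 expr1 mulr1.
have vE : forall x, xs j <= x <= xs j.+1 -> v x = p`_0 + p`_1 * x.
  apply: continuous_ae_eq.
  - exact: lt.
  - exact: cell_within.
  - apply: continuous_subspaceT => x; apply: cvgD; first exact: cvg_cst.
    by apply: cvgM; [exact: cvg_cst|exact: cvg_id].
  - by apply: aeW => x /=; rewrite in_itv/= => xj; rewrite vp.
move=> x xj; have ltj := lt j jN.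
have -> : v (xs j) = p`_0 + p`_1 * xs j by rewrite vE// lexx ltW.
rewrite /slope/= /cell (vE x)//.
have -> : v (xs j) = p`_0 + p`_1 * xs j by rewrite vE// lexx ltW.
have -> : v (xs j.+1) = p`_0 + p`_1 * xs j.+1 by rewrite vE// lexx ltW.
by field; rewrite gt_eqF// subr_gt0.
Qed.

Lemma pl_fe_space v : pl v -> fe_space N xs v.
Proof.
move=> [cv pv]; split => // j jN.
exists ((v (xs j) - slope (v \o xs) j * xs j)%:P + slope (v \o xs) j *: 'X); split.
  rewrite (leq_trans (size_polyD _ _))// geq_max (leq_trans (size_polyC_leq1 _))//=.
  by rewrite (leq_trans (size_scale_leq _ _))// size_polyX.
move=> x /andP[x1 x2]; rewrite (pv j jN) ?ltW// !hornerE.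
by ring.
Qed.

(** The length of the part of cell j to the left of x. Summing slopes times these lengths makes
    [interp] continuous on the whole line without any case distinction. *)
Definition clamp (j : nat) x : R := Num.min (Num.max (x - xs j) 0) (cell j).

Definition interp c x : R := c 0%N + \sum_(j < N) slope c j * clamp j x.

Lemma continuous_clamp j : continuous (clamp j).
Proof.
move=> x; rewrite /clamp; apply: (@continuous_min _ _ (fun x => Num.max (x - xs j) 0) (cst (cell j))); last exact: cvg_cst.
apply: (@continuous_max _ _ (fun x => x - xs j) (cst 0)); last exact: cvg_cst.
by apply: cvgB; [exact: cvg_id|exact: cvg_cst].
Qed.

Lemma continuous_interp c : continuous (interp c).
Proof.
move=> x; apply: cvgD; first exact: cvg_cst.
apply: cvg_sumr => j; apply: cvgM; first exact: cvg_cst.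
exact: continuous_clamp.
Qed.

(** Cells to the left of cell j contribute their whole length, and their terms telescope to
    [c j - c 0]; those to the right contribute 0. *)
Lemma interp_cell c j x : (j < N)%N -> xs j <= x <= xs j.+1 ->
  interp c x = c j + slope c j * (x - xs j).
Proof.
move=> jN /andP[x1 x2]; rewrite /interp.
rewrite -(big_mkord xpredT (fun i => slope c i * clamp i x)).
rewrite (big_cat_nat (n := j)) ?(ltnW jN)//= [\sum_(j <= i < N) _]big_ltn//.
rewrite (eq_big_nat _ _ (F2 := fun i => c i.+1 - c i)); last first.
  move=> i /andP[_ ij]; have iN := ltn_trans ij jN.
  have ? : cell i <= x - xs i.
    by have := partition_le part ij (ltnW jN); rewrite /cell; lra.
  have := cell_gt0 iN => ?.
  by rewrite /clamp max_l ?min_r ?slopeM//; lra.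
rewrite telescope_sumr//.
have -> : clamp j x = x - xs j.
  by rewrite /clamp max_l ?min_l// /cell; lra.
rewrite [X in _ + (_ + (_ + X))]big_nat_cond big1; first by rewrite addr0; ring.
move=> i; rewrite andbT => /andP[ji iN].
have := cell_gt0 iN; have := partition_le part ji (ltnW iN) => ? ?.
have h : x - xs i <= 0 by lra.
by rewrite /clamp (max_r h) min_l ?mulr0// ltW.
Qed.

Lemma interp_node c j : (j <= N)%N -> interp c (xs j) = c j.
Proof.
have [_ _ lt] := part; rewrite leq_eqVlt => /predU1P[->|jN]; last first.
  by rewrite (@interp_cell _ j) ?lexx ?ltW ?lt// subrr mulr0 addr0.
have N0 : (0 < N)%N.
  by have [x0 x1 _] := part; case: (N) x1 => // /eqP; rewrite x0 eq_sym oner_eq0.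
rewrite (@interp_cell _ N.-1) ?prednK// ?lexx ?andbT; last first.
  by rewrite (partition_le part)// leq_pred.
have := @slopeM c N.-1; rewrite /cell prednK// => /(_ (leqnn _)) ->; ring.
Qed.

Lemma eq_slope c c' j : (j < N)%N -> (forall i, (i <= N)%N -> c i = c' i) ->
  slope c j = slope c' j.
Proof. by move=> jN cc'; rewrite /slope !cc'// ltnW. Qed.

Lemma pl_interp c : pl (interp c).
Proof.
split; first by apply: continuous_subspaceT; exact: continuous_interp.
move=> j jN x xj; rewrite (interp_cell _ jN xj) interp_node ?(ltnW jN)//.
by rewrite (@eq_slope (interp c \o xs) c)// => i iN /=; rewrite interp_node.
Qed.

Definition plD c x : R := \sum_(j < N) slope c j * \1_(`]xs j, xs j.+1[%classic : set R) x.

Lemma plD_cell c j x : (j < N)%N -> xs j < x < xs j.+1 -> plD c x = slope c j.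
Proof.
move=> jN xj; rewrite /plD (bigD1 (Ordinal jN))//= indicE mem_set ?mulr1; last first.
  by rewrite /= in_itv.
rewrite big1 ?addr0// => i; rewrite -val_eqE/= => ij.
rewrite indicE memNset ?mulr0//= in_itv/= => xi.
move: xj xi => /andP[? ?] /andP[? ?]; case: (ltngtP i j) ij => // ij _.
- by have := partition_le part ij (ltnW jN); lra.
- by have := partition_le part ij (ltnW (ltn_ord i)); lra.
Qed.

Lemma measurable_plD c : measurable_fun I01 (plD c).
Proof.
apply: measurable_sum => j; apply: measurable_funM; first exact: measurable_cst.
exact: measurable_indic.
Qed.

Lemma plD_bound c : exists M, forall x, `|plD c x| <= M.
Proof.
exists (\sum_(j < N) `|slope c j|) => x; rewrite (le_trans (ler_norm_sum _ _ _))//.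
apply: ler_sum => j _; rewrite normrM ler_piMr// indicE.
by case: (_ \in _); rewrite ?normr1 ?normr0.
Qed.

Lemma pl_weak_deriv v : pl v -> weak_deriv I01 v (plD (v \o xs)).
Proof.
move=> [cv pv]; have [M MP] := plD_bound (v \o xs).
apply: (piecewise_C1_weak_deriv part cv (measurable_plD _) (fun x _ => MP x)).
move=> j jN; exists (fun=> slope (v \o xs) j); split.
- by apply: continuous_subspaceT => x; exact: cvg_cst.
- move=> x xj.
  have : is_derive x 1 (fun x => v (xs j) + slope (v \o xs) j *: (x - xs j)) (slope (v \o xs) j).
    by apply: is_derive_eq; rewrite /GRing.scale/=; ring.
  apply: near_eq_is_derive; near=> y; rewrite [RHS](pv j jN)//.
  have : y \in `]xs j, xs j.+1[.
    by near: y; apply: near_in_itvoo; rewrite in_itv.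
  by rewrite in_itv/= => /andP[? ?]; rewrite !ltW.
- by move=> x xj; exact: plD_cell.
Unshelve. all: by end_near. Qed.

Lemma pl_sobolev v : pl v -> [/\ sobolev 1 v, ae_eq mu I01 (wD v) (plD (v \o xs)) &
  forall x, 0 <= x <= 1 -> cont_rep v x = v x].
Proof.
move=> plv; have [cv _] := plv; have [M MP] := plD_bound (v \o xs).
apply: (@sobolev1_of _ v v _ M) => //.
- exact: within_continuous_meas.
- exact: aeW.
- exact: measurable_plD.
- exact: pl_weak_deriv.
Qed.

(** [wD v] is a step function almost everywhere, so f enters through its cell integrals alone. *)
Lemma inner_wD_pl f v : rintegrable 0 1 f -> pl v ->
  inner f (wD v) = \sum_(j < N) slope (v \o xs) j * rint (xs j) (xs j.+1) f.
Proof.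
move=> fi plv; have [[_ [_ [mw _ _] _] _] wv _] := pl_sobolev plv.
have [M MP] := plD_bound (v \o xs).
have mp := measurable_plD (v \o xs).
have mf := rintegrable_meas fi.
rewrite innerE.
rewrite (@ae_eq_rint _ _ _ _ (fun x => f x * plD (v \o xs) x)); first last.
- by apply: ae_imp wv => x /[apply] ->.
- exact: measurable_funM.
- exact: measurable_funM.
rewrite (rint_cells part); last exact: rintegrableM_bounded fi mp (fun x _ => MP x).
apply: eq_bigr => j _; have jN := ltn_ord j.
rewrite -rintZ; last first.
  have /andP[? _] := partition_itv part (ltnW jN).
  by have /andP[_ ?] := partition_itv part jN; apply: rintegrable_sub fi _ _.
by apply: eq_rint => x xj; rewrite (plD_cell _ jN)// mulrC.
Qed.

End PiecewiseLinear.

(** * Trapezoidal test functions *)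

Section Trapezoid.
Context {R : realType}.
Local Notation mu := (@lebesgue_measure R).
Implicit Types (f g F v : R -> R) (x y e s k c a b : R).

(* A trapezoid as a piecewise linear function on a partition of its own, rising on
   [x, x + e] and falling on [y, y + e]; nth pads the nodes with 1, the values with 0. *)
Definition trap_node x y e (j : nat) : R := nth 1 [:: 0; x; x + e; y; y + e] j.
Definition trap_val (j : nat) : R := nth 0 [:: 0; 0; 1; 1] j.
Definition trap x y e : R -> R := interp 5 (trap_node x y e) trap_val.

Section Props.
Context (x y e : R) (x0 : 0 < x) (e0 : 0 < e) (xy : x + e < y) (y1 : y + e < 1).
Local Notation phi := (trap x y e).

Let geom : [/\ 0 < x, 0 < e, x + e < y & y + e < 1]. Proof. by []. Qed.

Lemma trap_partition : is_partition 5 (trap_node x y e).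
Proof. by split => // -[|[|[|[|[|]]]]]//= _; rewrite /trap_node/= ?ltrDl. Qed.

Lemma trap_pl : pl 5 (trap_node x y e) phi.
Proof. exact: pl_interp trap_partition _. Qed.

Lemma trap01 : phi 0 = 0 /\ phi 1 = 0.
Proof.
split.
  exact: (interp_node trap_partition trap_val (leq0n 5)).
exact: (interp_node trap_partition trap_val (leqnn 5)).
Qed.

Lemma trap_cell j s : (j < 5)%N -> trap_node x y e j <= s <= trap_node x y e j.+1 ->
  phi s = trap_val j + slope (trap_node x y e) trap_val j * (s - trap_node x y e j).
Proof. by move=> j5 sj; rewrite /trap; exact: (interp_cell trap_partition). Qed.

Lemma trap_outside s : 0 <= s <= 1 -> s <= x \/ y + e <= s -> phi s = 0.
Proof.
move=> /andP[s0 s1] [sx|sy].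
  by rewrite (@trap_cell 0)/= ?s0// /slope/= /trap_val/= subrr !mul0r addr0.
by rewrite (@trap_cell 4)/= ?sy// /slope/= /trap_val/= subrr !mul0r addr0.
Qed.

Lemma trap_plateau s : x + e <= s <= y -> phi s = 1.
Proof. by move=> xsy; rewrite (@trap_cell 2)/= ?xsy// /slope/= /trap_val/= subrr !mul0r addr0. Qed.

Lemma trap_itv s : 0 <= s <= 1 -> 0 <= phi s <= 1.
Proof.
move=> s01; case: (leP s x) => sx; first by rewrite trap_outside ?lexx ?ler01//; left.
case: (leP (y + e) s) => sy; first by rewrite trap_outside ?lexx ?ler01//; right.
case: (leP s (x + e)) => sxe.
  have -> : phi s = (s - x) / e.
    rewrite (@trap_cell 1)/= /trap_node/= ?(ltW sx)// /slope /cell/= /trap_val/=.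
    have -> : x + e - x = e by ring.
    by field; rewrite gt_eqF.
  by apply/andP; split; [rewrite divr_ge0 ?subr_ge0 ?ltW|rewrite ler_pdivrMr// mul1r; lra].
case: (leP s y) => sy'.
  by rewrite trap_plateau ?lexx ?ler01// (ltW sxe).
have -> : phi s = 1 - (s - y) / e.
  rewrite (@trap_cell 3)/= /trap_node/= ?(ltW sy) ?(ltW sy')// /slope /cell/= /trap_val/=.
  have -> : y + e - y = e by ring.
  by field; rewrite gt_eqF.
have h1 : 0 <= (s - y) / e by rewrite divr_ge0 ?subr_ge0 ?ltW.
have h2 : (s - y) / e <= 1 by rewrite ler_pdivrMr// mul1r; lra.
by apply/andP; split; lra.
Qed.

Lemma trap_integrable : rintegrable 0 1 phi.
Proof. by apply: rintegrable_cont; case: trap_pl. Qed.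

(** The trapezoid is nonnegative and vanishes off (x, y + e): the inner product is its mass times a
    weighted mean of f. *)
Lemma trap_inner_near f c k : rintegrable 0 1 f ->
  (forall s, x < s < y + e -> `|f s - c| <= k) ->
  `|inner f phi - c * rint 0 1 phi| <= k * rint 0 1 phi.
Proof.
move=> fi fk; have mphi := rintegrable_meas trap_integrable.
have bphi s : 0 < s < 1 -> `|phi s| <= 1.
  by move=> /andP[? ?]; have /andP[? ?] := @trap_itv s ltac:(by rewrite !ltW); rewrite ger0_norm.
have fphi := rintegrableM_bounded fi mphi bphi.
rewrite innerE -rintZ; last exact: trap_integrable.
rewrite -(rintZ k trap_integrable) -rintB//; last first.
  by apply: rintegrableZ; exact: trap_integrable.
have di : rintegrable 0 1 (fun s => f s * phi s - c * phi s).
  by apply: rintegrableB => //; apply: rintegrableZ; exact: trap_integrable.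
apply: (le_trans (ler_norm_rint di)); apply: le_rint.
- exact: rintegrable_norm.
- by apply: rintegrableZ; exact: trap_integrable.
- move=> s /andP[s0 s1]; have s01 : 0 <= s <= 1 by rewrite !ltW.
  rewrite -mulrBl normrM.
  have /andP[p0 p1] := trap_itv s01; rewrite (ger0_norm p0).
  case: (leP s x) => sx; first by rewrite (trap_outside s01) ?mulr0//; left.
  case: (leP (y + e) s) => sy; first by rewrite (trap_outside s01) ?mulr0//; right.
  by rewrite ler_wpM2r// fk// sx.
Qed.

Lemma trap_inner_le f k : rintegrable 0 1 f -> (forall s, 0 < s < 1 -> `|f s| <= k) ->
  `|inner f phi| <= k * rint 0 1 phi.
Proof.
have [? ? ? ?] := geom.
move=> fi fk; have := @trap_inner_near f 0 k fi; rewrite mul0r subr0; apply.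
by move=> s /andP[? ?]; rewrite subr0 fk//; apply/andP; split; lra.
Qed.

(** Comparison with the indicator functions of the plateau [x + e, y] and of the support
    [x, y + e]. *)
Lemma rint_trap : y - x - e <= rint 0 1 phi <= y - x + e.
Proof.
have [? ? ? ?] := geom; have pi := trap_integrable.
have ps a b : 0 <= a -> b <= 1 -> rintegrable a b phi by move=> ? ?; exact: rintegrable_sub pi _ _.
have p0 a b : 0 <= a -> b <= 1 -> 0 <= rint a b phi.
  move=> a0 b1; apply: rint_ge0 => s /andP[? ?].
  by have /andP[] := @trap_itv s ltac:(apply/andP; split; lra).
have z a b : a <= b -> 0 <= a -> b <= 1 -> (b <= x \/ y + e <= a) -> rint a b phi = 0.
  move=> ab a0 b1 abx; rewrite (@eq_rint _ _ _ _ (fun=> 0)) ?rint_cst ?mul0r//.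
  move=> s /andP[? ?]; apply: trap_outside; first by apply/andP; split; lra.
  by case: abx => ?; [left|right]; lra.
have sp a c b : 0 <= a -> a <= c -> c <= b -> b <= 1 ->
    rint a b phi = rint a c phi + rint c b phi.
  by move=> ? ? ? ?; apply: rint_split => //; exact: ps.
have -> : rint 0 1 phi = rint x (y + e) phi.
  have E1 : rint 0 1 phi = rint 0 x phi + rint x 1 phi by apply: sp; lra.
  have E2 : rint x 1 phi = rint x (y + e) phi + rint (y + e) 1 phi by apply: sp; lra.
  have z1 : rint 0 x phi = 0 by apply: z; [lra|lra|lra|left].
  have z2 : rint (y + e) 1 phi = 0 by apply: z; [lra|lra|lra|right].
  by rewrite E1 E2 z1 z2 add0r addr0.
apply/andP; split.
  have E1 : rint x (y + e) phi = rint x (x + e) phi + rint (x + e) (y + e) phi by apply: sp; lra.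
  have E2 : rint (x + e) (y + e) phi = rint (x + e) y phi + rint y (y + e) phi by apply: sp; lra.
  have h1 : 0 <= rint x (x + e) phi by apply: p0; lra.
  have h2 : 0 <= rint y (y + e) phi by apply: p0; lra.
  have h3 : rint (x + e) y phi = 1 * (y - (x + e)).
    rewrite -rint_cst; last by lra.
    by apply: eq_rint => s /andP[? ?]; rewrite trap_plateau// !ltW.
  by rewrite E1 E2 h3; lra.
rewrite (_ : y - x + e = 1 * (y + e - x)); last by ring.
rewrite -rint_cst; last by lra.
apply: le_rint; [by apply: ps; lra|exact: rintegrable_cst|].
by move=> s /andP[? ?]; have /andP[] := @trap_itv s ltac:(apply/andP; split; lra).
Qed.

Lemma inner_wD_trap f : rintegrable 0 1 f ->
  inner f (wD phi) = (rint x (x + e) f - rint y (y + e) f) / e.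
Proof.
move=> fi; rewrite (inner_wD_pl trap_partition fi trap_pl).
rewrite !big_ord_recl big_ord0/=.
have E j : (j < 5)%N -> slope (trap_node x y e) (phi \o trap_node x y e) j =
    slope (trap_node x y e) trap_val j.
  move=> j5; apply: (eq_slope _ j5) => i i5; exact: (interp_node trap_partition trap_val i5).
rewrite !E// /slope /cell/= /trap_node /trap_val/=.
have -> : x + e - x = e by ring.
have -> : y + e - y = e by ring.
by rewrite !subrr !mul0r; field; rewrite gt_eqF.
Qed.

End Props.
End Trapezoid.

(** * C^1 functions and integration by parts against piecewise linear functions *)

Section C1Pairs.
Context {R : realType}.
Local Notation mu := (@lebesgue_measure R).
Local Notation I01 := (`]0, 1[%classic : set R).
Implicit Types (f g F U P D v phi : R -> R) (x y e s t r k a b : R).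

(** Only increments inside the open interval are prescribed, so the fundamental theorem is applied
    from the base point [s0] between a and x. *)
Lemma antideriv_is_derive a b U P x : a < x < b -> rintegrable a b P ->
  (forall s t, a < s -> s <= t -> t < b -> U t - U s = rint s t P) ->
  {for x, continuous P} -> is_derive x 1 U (P x).
Proof.
move=> /andP[ax xb] Pi UE cP.
pose s0 := (a + x) / 2; pose b0 := (x + b) / 2.
have /and4P[h1 h2 h3 h4] : [&& a < s0, s0 < x, x < b0 & b0 < b].
  by rewrite /s0 /b0; apply/and4P; split; lra.
have Pi' : mu.-integrable [set` Interval (BRight s0) (BRight b0)] (EFin \o P).
  apply: integrableS Pi => //; apply: subset_itv; rewrite bnd_simp//; exact: ltW.
have s0x : (BRight s0 < BRight x)%O by rewrite bnd_simp.
have [dF FE] := continuous_FTC1 h3 Pi' s0x cP.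
have d1 : is_derive x 1 (fun t => U s0 + \int[mu]_(t0 in [set` Interval (BRight s0) (BRight t)]) P t0) (P x).
  have d2 : is_derive x 1 (fun t => \int[mu]_(t0 in [set` Interval (BRight s0) (BRight t)]) P t0) (P x).
    by apply: DeriveDef; [exact: dF|rewrite -FE derive1E].
  exact: (is_derive_eq (is_deriveD (is_derive_cst (U s0) x 1) d2) (add0r _)).
apply: near_eq_is_derive d1; near=> t.
have : t \in `]s0, b0[ by near: t; apply: near_in_itvoo; rewrite in_itv/= h2.
rewrite in_itv/= => /andP[st tb].
have {1}-> : U t = U s0 + rint s0 t P by rewrite -UE ?subrKC//; lra.
rewrite /rint Rintegral_itv_bndo_bndc//.
by apply: rintegrable_sub Pi _ _; lra.
Unshelve. all: by end_near. Qed.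

(** U is C^1 on the closed interval with derivative P; the integral form avoids one-sided
    derivatives at 0 and 1. *)
Definition C1_pair U P : Prop := {within `[0, 1], continuous P} /\
  forall x y, 0 <= x -> x <= y -> y <= 1 -> U y - U x = rint x y P.

Lemma C1_pair_continuous U P : C1_pair U P -> {within `[0, 1], continuous U}.
Proof. by move=> [cP UE]; apply: rint_antideriv_continuous UE; exact: rintegrable_cont. Qed.

Lemma within01_continuous P x : {within `[0, 1], continuous P} -> 0 < x < 1 ->
  {for x, continuous P}.
Proof.
move=> /(continuous_within_itvP _ (@ltr01 R))[+ _ _] x01.
by apply; rewrite in_itv.
Qed.

Lemma C1_pair_derive U P x : C1_pair U P -> 0 < x < 1 -> is_derive x 1 U (P x).
Proof.
move=> [cP UE] x01; apply: (@antideriv_is_derive 0 1) => //.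
- exact: rintegrable_cont.
- by move=> s t s0 st t1; apply: UE => //; exact: ltW.
- exact: within01_continuous.
Qed.

Lemma within_sub a b c d f : a <= c -> d <= b -> {within `[a, b], continuous f} ->
  {within `[c, d], continuous f}.
Proof.
move=> ac db; apply: continuous_subspaceW => s /=; rewrite !in_itv/= => /andP[? ?].
by apply/andP; split; lra.
Qed.

(** Puts the convection term w w_x in the form (w^2 / 2)_x, ready for integration by parts. *)
Lemma C1_pair_sqr U P : C1_pair U P -> C1_pair (fun x => U x ^+ 2 / 2) (fun x => U x * P x).
Proof.
move=> UP; have [cP UE] := UP; have cU := C1_pair_continuous UP.
have cUP : {within `[0, 1], continuous (fun x => U x * P x)}.
  by move=> x; apply: cvgM; [exact: cU|exact: cP].
split=> // x y x0 xy y1; apply/esym/(rint_FTC (F := fun x => U x ^+ 2 / 2)) => //.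
- exact: within_sub cUP.
- move=> s /andP[xs sy]; have s01 : 0 < s < 1 by apply/andP; split; lra.
  have dU := C1_pair_derive UP s01.
  have -> : (fun x => U x ^+ 2 / 2) = (fun x => 2^-1 *: (U x * U x)).
    by apply/funext => u; rewrite /GRing.scale/= mulrC expr2.
  by apply: is_derive_eq; rewrite /GRing.scale/=; field.
- apply: (@within_sub 0 1) => // s; apply: cvgM; last exact: cvg_cst.
  exact: within_continuous_sqr.
Qed.

Lemma C1_pair_pl_ibp N xs U P phi : is_partition N xs -> pl N xs phi -> C1_pair U P ->
  inner P phi = U 1 * phi 1 - U 0 * phi 0
    - \sum_(j < N) slope xs (phi \o xs) j * rint (xs j) (xs j.+1) U.
Proof.
move=> part plphi UP; have [cP UE] := UP; have cU := C1_pair_continuous UP.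
have [cphi phiE] := plphi; have [x0 x1 lt] := part.
have cPphi : {within `[0, 1], continuous (fun x => P x * phi x)}.
  by move=> x; apply: cvgM; [exact: cP|exact: cphi].
rewrite innerE (rint_cells part); last exact: rintegrable_cont.
apply/eqP; rewrite -subr_eq opprK; apply/eqP; rewrite -big_split/=.
rewrite (eq_bigr (fun j : 'I_N => U (xs j.+1) * phi (xs j.+1) - U (xs j) * phi (xs j))).
  rewrite -(big_mkord xpredT (fun j => U (xs j.+1) * phi (xs j.+1) - U (xs j) * phi (xs j))).
  by rewrite (telescope_sumr (fun j => U (xs j) * phi (xs j)))// x0 x1.
move=> j _; have jN := ltn_ord j.
have /andP[j0 _] := partition_itv part (ltnW jN); have /andP[_ j1] := partition_itv part jN.
have cUj := cell_within part jN cU; have cPj := cell_within part jN cPphi.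
rewrite -rintZ; last exact: rintegrable_cont.
rewrite -rintD; [|exact: rintegrable_cont|by apply: rintegrableZ; exact: rintegrable_cont].
apply: (rint_FTC (F := fun x => U x * phi x)).
- exact/ltW/lt.
- move=> x; apply: cvgD; first exact: cPj.
  by apply: cvgM; [exact: cvg_cst|exact: cUj].
- move=> x xj; have x01 : 0 < x < 1 by move/andP: xj => [? ?]; apply/andP; split; lra.
  have dU := C1_pair_derive UP x01.
  have dphi : is_derive x 1 phi (slope xs (phi \o xs) j).
    have d1 : is_derive x 1 (fun x => phi (xs j) + slope xs (phi \o xs) j *: (x - xs j)) (slope xs (phi \o xs) j).
      by apply: is_derive_eq; rewrite /GRing.scale/=; ring.
    apply: near_eq_is_derive d1; near=> y; rewrite [RHS](phiE j jN)//.
    have : y \in `]xs j, xs j.+1[ by near: y; apply: near_in_itvoo; rewrite in_itv.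
    by rewrite in_itv/= => /andP[? ?]; rewrite !ltW.
  by apply: is_derive_eq; rewrite /GRing.scale/=; ring.
- move=> x; apply: cvgM; first exact: cUj.
  exact: (cell_within part jN cphi).
Unshelve. all: by end_near. Qed.

(** Interpolation between L^2 and a Hoelder bound of exponent 1/2: D(x)^2 <= 2 D(s)^2 + 2 k r is
    averaged over s in a window of length r that touches x. It turns smallness in L^2 into smallness
    at every point. *)
Lemma sqr_le_interpolation D k x r : {within `[0, 1], continuous D} ->
  (forall x y, 0 <= x <= 1 -> 0 <= y <= 1 -> (D x - D y) ^+ 2 <= k * `|x - y|) ->
  0 <= x <= 1 -> 0 < r <= 2^-1 ->
  D x ^+ 2 <= 2 / r * rint 0 1 (fun s => D s ^+ 2) + 2 * k * r.
Proof.
move=> cD Dk x01 /andP[r0 r1].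
have k0 : 0 <= k.
  have h01 : 0 <= (0:R) <= 1 by rewrite lexx ler01.
  have h11 : 0 <= (1:R) <= 1 by rewrite lexx ler01.
  have := Dk 0 1 h01 h11; rewrite sub0r normrN normr1 mulr1; apply: le_trans.
  exact: sqr_ge0.
have cD2 := within_continuous_sqr cD; have D2i := rintegrable_cont cD2.
(* The window lies to the right of x when x is in the left half of [0,1] and to the left otherwise,
   so that r <= 1/2 keeps it inside. *)
have [a [a0 ar1 ax]] : exists a, [/\ 0 <= a, a + r <= 1 & forall s, a < s < a + r -> `|x - s| <= r].
  move/andP: x01 => [x0 x1]; case: (leP x 2^-1) => x2.
    exists x; split => //; first by lra.
    by move=> s /andP[? ?]; rewrite ler_norml; apply/andP; split; lra.
  exists (x - r); split; [lra|lra|].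
  by move=> s /andP[? ?]; rewrite ler_norml; apply/andP; split; lra.
have ar : a <= a + r by lra.
have sub : rint a (a + r) (fun s => D s ^+ 2) <= rint 0 1 (fun s => D s ^+ 2).
  rewrite (@rint_split _ 0 a 1)//; last by lra.
  rewrite (@rint_split _ a (a + r) 1)//; last by apply: rintegrable_sub D2i _ _.
  have : 0 <= rint 0 a (fun s => D s ^+ 2) by apply: rint_ge0 => s _; exact: sqr_ge0.
  have : 0 <= rint (a + r) 1 (fun s => D s ^+ 2) by apply: rint_ge0 => s _; exact: sqr_ge0.
  by lra.
have : D x ^+ 2 * (a + r - a) <= 2 * rint a (a + r) (fun s => D s ^+ 2) + (2 * k * r) * (a + r - a).
  have D2a : rintegrable a (a + r) (fun s => D s ^+ 2) by apply: rintegrable_sub D2i _ _.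
  rewrite -!rint_cst// -rintZ// -rintD; [|exact: rintegrableZ|exact: rintegrable_cst].
  apply: le_rint; first exact: rintegrable_cst.
    by apply: rintegrableD; [exact: rintegrableZ|exact: rintegrable_cst].
  move=> s sa; have s01 : 0 <= s <= 1 by move/andP: sa => [? ?]; apply/andP; split; lra.
  have h1 := Dk x s x01 s01; have h2 : k * `|x - s| <= k * r by rewrite ler_wpM2l// ax.
  have := sqr_ge0 (D s - (D x - D s)); nra.
rewrite (_ : a + r - a = r); last by ring.
move=> h; rewrite -(ler_pM2r r0) mulrDl (_ : 2 / r * _ * r = 2 * rint 0 1 (fun s => D s ^+ 2)).
  by lra.
by field; rewrite gt_eqF.
Qed.

End C1Pairs.

(** * Functions of time and the memory integral *)

Section TimeCalculus.
Context {R : realType}.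
Local Notation mu := (@lebesgue_measure R).
Implicit Types (f g D zeta : R -> R) (s t e d k x : R).

Definition cont_ge0 f : Prop := {within `[0, +oo[, continuous f}.

Lemma cont_ge0P f : cont_ge0 f <->
  forall t, 0 <= t -> forall e, 0 < e -> exists2 d, 0 < d &
    forall s, 0 <= s -> `|s - t| < d -> `|f s - f t| <= e.
Proof.
split=> [/subspace_continuousP cF x x0 e e0|cF].
  have xI : `[0, +oo[%classic x by rewrite /= in_itv/= x0.
  have /cvgrPdist_le/(_ _ e0) := cF x xI.
  rewrite near_withinE => -[d /= d0 dP]; exists d => // y y0 yx.
  by rewrite distrC; apply: dP => //=; rewrite ?in_itv/= ?y0// distrC.
apply/subspace_continuousP => x /=; rewrite in_itv/= andbT => x0.
apply/cvgrPdist_le => e e0; have [d d0 dP] := cF x x0 e e0.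
rewrite near_withinE; exists d => //= y /= yx; rewrite in_itv/= andbT => y0.
by rewrite distrC; apply: dP => //; rewrite distrC.
Qed.

Lemma cont_ge0_at f t : cont_ge0 f -> 0 < t -> {for t, continuous f}.
Proof.
move=> /cont_ge0P cf t0; apply/cvgrPdist_le => e e0.
have [d d0 dP] := cf t (ltW t0) e e0.
exists (Num.min d t); rewrite /= ?lt_min ?d0// => s /=; rewrite lt_min => /andP[sd st].
rewrite distrC; apply: dP; last by rewrite distrC.
by move: st; rewrite ltr_norml => /andP[? ?]; lra.
Qed.

Lemma cont_ge0_sub f a b : cont_ge0 f -> 0 <= a -> {within `[a, b], continuous f}.
Proof.
move=> cf a0; apply: continuous_subspaceW cf => s /=; rewrite !in_itv/= => /andP[? ?].
by rewrite andbT; lra.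
Qed.

Lemma cont_ge0_of_derive f (f' : R -> R) : (forall t, 0 < t -> is_derive t 1 f (f' t)) ->
  (forall e, 0 < e -> exists2 d, 0 < d & forall s, 0 <= s < d -> `|f s - f 0| <= e) ->
  cont_ge0 f.
Proof.
move=> df f0; apply/cont_ge0P => t; rewrite le_eqVlt => /predU1P[<-|t0] e e0.
  have [d d0 dP] := f0 e e0; exists d => // s s0; rewrite subr0 ger0_norm// => sd.
  by apply: dP; rewrite s0.
have [dt _] := df t t0.
have : {for t, continuous f} by apply: differentiable_continuous; exact/derivable1_diffP.
move=> /cvgrPdist_le/(_ e e0)[d /= d0 dP]; exists d => // s s0 st.
by rewrite distrC; apply: dP; rewrite /= distrC.
Qed.

Lemma derive_le0_nincr f (f' : R -> R) : cont_ge0 f ->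
  (forall t, 0 < t -> is_derive t 1 f (f' t)) -> (forall t, 0 < t -> f' t <= 0) ->
  forall s t, 0 <= s -> s <= t -> f t <= f s.
Proof.
move=> cf df f'0 s t s0 st.
apply: (@ler0_derive1_nincr _ f 0 t) => //.
- by move=> x; rewrite in_itv/= => /andP[x0 _]; have [] := df x x0.
- by move=> x; rewrite in_itv/= => /andP[x0 _]; rewrite derive1E; have [_ ->] := df x x0; exact: f'0.
- exact: cont_ge0_sub.
Qed.

Lemma is_derive_expRM k t : is_derive t 1 (fun s => expR (k * s)) (k * expR (k * t)).
Proof.
have d1 : is_derive t 1 (fun s => k *: s) k.
  by apply: is_derive_eq; rewrite /GRing.scale/= mulr1.
have := @is_derive1_comp _ (@expR R) (fun s => k *: s) t (expR (k * t)) k (is_derive_expR _) d1.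
by move/is_derive_eq; apply; rewrite mulrC.
Qed.

Lemma continuous_expRM k : continuous (fun s : R => expR (k * s)).
Proof.
by move=> s; apply: differentiable_continuous; apply/derivable1_diffP; have [] := is_derive_expRM k s.
Qed.

Lemma cont_ge0_expRM k : cont_ge0 (fun s => expR (k * s)).
Proof. by apply: continuous_subspaceT; exact: continuous_expRM. Qed.

(** The factor exp(- delta t) comes out of the integral and leaves a primitive of a continuous
    function. The memory thus obeys a scalar linear differential equation with zero initial value,
    which is the form used from here on. *)
Lemma memory_ode delta D zeta : 0 < delta -> cont_ge0 D ->
  (forall t, 0 <= t -> zeta t = \int[mu]_(s in `[0, t]) (expR (- delta * (t - s)) * D s)) ->
  [/\ zeta 0 = 0, cont_ge0 zeta &
    forall t, 0 < t -> is_derive t 1 zeta (D t - delta * zeta t)].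
Proof.
move=> delta0 cD zE.
pose g s := expR (delta * s) * D s.
have cg : cont_ge0 g.
  by move=> t; apply: cvgM; [exact: cont_ge0_expRM|exact: cD].
have gi b : rintegrable 0 b g by apply: rintegrable_cont; exact: cont_ge0_sub.
have z0 : zeta 0 = 0 by rewrite zE// set_itv1 Rintegral_set1.
have zY t : 0 <= t -> zeta t = expR (- delta * t) * rint 0 t g.
  rewrite le_eqVlt => /predU1P[<-|t0]; first by rewrite z0 rint_nil// mulr0.
  rewrite zE ?ltW// -rintZ// /rint.
  have E s : expR (- delta * (t - s)) * D s = expR (- delta * t) * g s.
    by rewrite /g mulrA -expRD; congr (expR _ * _); ring.
  under eq_Rintegral do rewrite E.
  have ci : mu.-integrable `[0, t] (EFin \o (fun s => expR (- delta * t) * g s)).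
    apply: continuous_compact_integrable; first exact: segment_compact.
    by move=> s; apply: cvgM; [exact: cvg_cst|apply: (cont_ge0_sub (a := 0))].
  rewrite -Rintegral_itv_obnd_cbnd; last first.
    apply: integrableS ci => // s /=; rewrite !in_itv/= => /andP[? ?].
    by apply/andP; split; lra.
  rewrite -Rintegral_itv_bndo_bndc//.
  apply: integrableS ci => //; exact: subset_itv_oo_cc.
have dz t : 0 < t -> is_derive t 1 zeta (D t - delta * zeta t).
  move=> t0; have dY : is_derive t 1 (fun t => rint 0 t g) (g t).
    apply: (@antideriv_is_derive _ 0 (t + 1)) => //.
    - by apply/andP; split => //; rewrite ltrDl.
    - move=> a b a0 ab _; rewrite (@rint_split _ 0 a b)//; [by ring|exact: ltW].
    - exact: cont_ge0_at.
  have dE := is_derive_expRM (- delta) t.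
  have d2 : is_derive t 1 (fun t => expR (- delta * t) * rint 0 t g) (D t - delta * zeta t).
    apply: (is_derive_eq (is_deriveM dE dY)).
    rewrite zY ?ltW// /g /GRing.scale/= mulrA -expRD (_ : - delta * t + delta * t = 0); last by ring.
    by rewrite expR0; ring.
  apply: near_eq_is_derive d2; near=> s; rewrite zY//.
  by apply/ltW; near: s; apply: lt_nbhsr.
split=> //; apply: (cont_ge0_of_derive dz) => e e0.
have [d d0 dP] := rint_small (gi 1) e0.
exists (Num.min d 1); first by rewrite lt_min d0 ltr01.
move=> s /andP[s0]; rewrite lt_min => /andP[sd s1].
rewrite z0 subr0 zY// normrM ger0_norm ?expR_ge0//.
have : `|rint 0 s g| <= e.
  apply: (le_trans (ler_norm_rint (gi s))); rewrite -{1}(add0r s); apply/ltW/dP => //; lra.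
apply: le_trans; rewrite ler_piMl//.
by rewrite -expR0 ler_expR mulNr oppr_le0 mulr_ge0// ltW.
Unshelve. all: by end_near. Qed.

(** Eliminating D gives zeta' <= b / nu - k zeta with k = rho / nu + delta, whose equilibrium is Z =
    b / (rho + nu delta); hence exp(k t) (zeta - Z) does not increase. *)
Lemma volterra_le nu rho delta b D zeta : 0 < nu -> 0 < rho -> 0 < delta ->
  cont_ge0 zeta -> zeta 0 = 0 ->
  (forall t, 0 < t -> is_derive t 1 zeta (D t - delta * zeta t)) ->
  (forall t, 0 < t -> nu * D t + rho * zeta t <= b) -> 0 <= b ->
  forall t, 0 <= t -> zeta t <= b / (rho + nu * delta).
Proof.
move=> nu0 rho0 delta0 cz z0 dz Dz b0 t t0.
set Z := b / _; pose k := rho / nu + delta.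
have k0 : 0 < rho + nu * delta by rewrite addr_gt0// mulr_gt0.
have kE : k = (rho + nu * delta) / nu by rewrite /k; field; rewrite gt_eqF.
pose f t := expR (k * t) * (zeta t - Z).
have df s : 0 < s -> is_derive s 1 f (expR (k * s) * (k * (zeta s - Z) + (D s - delta * zeta s))).
  move=> s0; have dE := is_derive_expRM k s; have ? := dz s s0.
  have d2 : is_derive s 1 (fun t => zeta t - Z) (D s - delta * zeta s).
    by apply: is_derive_eq; rewrite subr0.
  by apply: (is_derive_eq (is_deriveM dE d2)); rewrite /GRing.scale/=; ring.
have cf : cont_ge0 f.
  move=> s; apply: cvgM; first exact: cont_ge0_expRM.
  by apply: cvgB; [exact: cz|exact: cvg_cst].
have := derive_le0_nincr cf df _ (lexx 0) t0.
rewrite /f mulr0 expR0 mul1r z0 sub0r => H.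
have Z0 : 0 <= Z by rewrite divr_ge0// ltW.
have : expR (k * t) * (zeta t - Z) <= - Z.
  apply: H => s s0; rewrite mulr_ge0_le0 ?expR_ge0//.
  have h : nu^-1 * (nu * D s + rho * zeta s) <= nu^-1 * b.
    by rewrite ler_pM2l ?invr_gt0//; exact: Dz.
  have -> : k * (zeta s - Z) + (D s - delta * zeta s) = nu^-1 * (nu * D s + rho * zeta s) - k * Z.
    by rewrite /k; field; rewrite gt_eqF.
  have -> : k * Z = nu^-1 * b by rewrite kE /Z; field; rewrite !gt_eqF.
  by lra.
have e0 := expR_gt0 (k * t) => h.
by rewrite leNgt; apply/negP => zZ; have : 0 < expR (k * t) * (zeta t - Z); [rewrite mulr_gt0// subr_gt0|lra].
Qed.

(** [volterra_le] for the pair and for its opposite gives |rho zeta| <= b, and nu D is the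
    difference of nu D + rho zeta and rho zeta, both bounded by b. *)
Lemma volterra_bound nu rho delta b D zeta : 0 < nu -> 0 < rho -> 0 < delta ->
  cont_ge0 zeta -> zeta 0 = 0 ->
  (forall t, 0 < t -> is_derive t 1 zeta (D t - delta * zeta t)) ->
  (forall t, 0 < t -> `|nu * D t + rho * zeta t| <= b) -> 0 <= b ->
  forall t, 0 < t -> `|D t| <= 2 * b / nu.
Proof.
move=> nu0 rho0 delta0 cz z0 dz Dz b0 t t0.
have k0 : 0 < rho + nu * delta by rewrite addr_gt0// mulr_gt0.
have h1 : zeta t <= b / (rho + nu * delta).
  apply: (volterra_le nu0 rho0 delta0 cz z0 dz) => //; last exact: ltW.
  by move=> s s0; have := Dz s s0; rewrite ler_norml => /andP[].
have h2 : - zeta t <= b / (rho + nu * delta).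
  apply: (@volterra_le nu rho delta b (fun s => - D s) (fun s => - zeta s)) => //; last exact: ltW.
  - by move=> s; apply: cvgN; exact: cz.
  - by rewrite z0 oppr0.
  - by move=> s s0; have ? := dz s s0; apply: is_derive_eq; ring.
  - by move=> s s0; have := Dz s s0; rewrite ler_norml => /andP[? ?]; lra.
have h3 : rho * (b / (rho + nu * delta)) <= b.
  rewrite mulrA ler_pdivrMr// mulrC ler_wpM2l// lerDl mulr_ge0// ltW//.
have h4 : rho * zeta t <= b by apply: le_trans h3; rewrite ler_wpM2l// ltW.
have h5 : rho * (- zeta t) <= b by apply: le_trans h3; rewrite ler_wpM2l// ltW.
rewrite ler_pdivlMr// -{1}(gtr0_norm nu0) -normrM mulrC.
by have := Dz t t0; rewrite !ler_norml => /andP[? ?]; apply/andP; split; lra.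
Qed.

End TimeCalculus.

(** * Regularity of the solution *)

Section Regularity.
Context {R : realType}.
Local Notation mu := (@lebesgue_measure R).
Local Notation I01 := (`]0, 1[%classic : set R).
Implicit Types (f g F U P D v phi : R -> R) (x y e s t r k a b : R).

(** What is retained of the weak solution and of the a priori estimate; [M] stands for K ||w0||_3^2.
    The bounds hold for t > 0 only, which is why several estimates below reach t = 0 by
    continuity. *)
Record regular (nu rho delta c0 c1 wd M : R) (w wt z : R -> R -> R) : Prop := Regular {
  reg_param : [/\ 0 < nu, 0 < rho, 0 < delta & 0 <= wd];
  reg_H1 : forall t, 0 <= t -> sobolev 1 (w t) /\
        L2norm (w s \- w t) @[s --> within `[0, +oo[ (nbhs t)] --> (0 : R);
  reg_wt : weak_time_deriv w wt;
  reg_mem : memory delta (fun s => wD (w s)) z;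
  reg_weak : forall t, 0 < t -> forall phi, sobolev 1 phi ->
        weak_form nu rho c0 c1 wd (w t) (wt t) (z t) phi = 0;
  reg_bound : forall t, 0 < t -> [/\ sobolev 2 (w t), sobolev 1 (wt t) &
    sobolev_norm 2 (w t) ^+ 2 + sobolev_norm 1 (wt t) ^+ 2 <= M] }.

Context (nu rho delta c0 c1 wd M : R) (w wt z : R -> R -> R).
Context (reg : regular nu rho delta c0 c1 wd M w wt z).
Local Notation u := (fun t => cont_rep (w t)).
Local Notation p := (fun t => cont_rep (wD (w t))).
Local Notation q := (fun t => cont_rep (wt t)).
Local Notation B := (1 + M).

Lemma sobolev_norm_sqr m f :
  sobolev_norm m f ^+ 2 = \sum_(k < m.+1) L2norm (iter k wD f) ^+ 2.
Proof. by rewrite sqr_sqrtr// sumr_ge0// => i _; exact: sqr_ge0. Qed.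

Lemma sobolev_norm1_sqr f : sobolev_norm 1 f ^+ 2 = L2norm f ^+ 2 + L2norm (wD f) ^+ 2.
Proof. by rewrite sobolev_norm_sqr !big_ord_recr big_ord0/= add0r. Qed.

Lemma sobolev_norm2_sqr f : sobolev_norm 2 f ^+ 2 =
  L2norm f ^+ 2 + L2norm (wD f) ^+ 2 + L2norm (wD (wD f)) ^+ 2.
Proof. by rewrite sobolev_norm_sqr !big_ord_recr big_ord0/= add0r. Qed.

Lemma reg_norms t : 0 < t -> [/\ L2norm (w t) ^+ 2 + L2norm (wD (w t)) ^+ 2 <= M,
   L2norm (wD (w t)) ^+ 2 + L2norm (wD (wD (w t))) ^+ 2 <= M,
   L2norm (wt t) ^+ 2 + L2norm (wD (wt t)) ^+ 2 <= M & 0 <= M].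
Proof.
move=> t0; have [_ _] := reg_bound reg t0.
rewrite sobolev_norm1_sqr sobolev_norm2_sqr.
have lin (a b c d e : R) : 0 <= a -> 0 <= b -> 0 <= c -> 0 <= d -> 0 <= e ->
    a + b + c + (d + e) <= M -> [/\ a + b <= M, b + c <= M, d + e <= M & 0 <= M].
  by move=> *; split; lra.
by apply: lin; exact: sqr_ge0.
Qed.

Lemma reg_M : 0 <= M.
Proof. by have [] := reg_norms ltr01. Qed.

(** The square is at most 2 M <= (1 + M)^2; the bound 1 + M avoids square roots and serves for w,
    w_x and w_t alike. *)
Lemma sup_le_of_sobolev1 f x : sobolev 1 f -> L2norm f ^+ 2 + L2norm (wD f) ^+ 2 <= M ->
  0 <= x <= 1 -> `|cont_rep f x| <= B.
Proof.
move=> f1 fM x01; have := sobolev1_sup f1 x01 => h; have M0 := reg_M.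
rewrite -(@ler_pXn2r _ 2) ?nnegrE// ?addr_ge0// real_normK ?num_real//.
rewrite (le_trans h)//; nra.
Qed.

Lemma reg_sobolev t : 0 < t ->
  [/\ sobolev 1 (w t), sobolev 1 (wD (w t)) & sobolev 1 (wt t)].
Proof. move=> t0; have [[w0 w1 w2] wt1 _] := reg_bound reg t0; have [g0 _ _] := w2; exact: And3 (And3 w0 w1 g0) w2 wt1. Qed.

Lemma u_bound t x : 0 < t -> 0 <= x <= 1 -> `|u t x| <= B.
Proof. by move=> t0; have [? _ _] := reg_sobolev t0; have [? _ _ _] := reg_norms t0; exact: sup_le_of_sobolev1. Qed.
Lemma p_bound t x : 0 < t -> 0 <= x <= 1 -> `|p t x| <= B.
Proof. by move=> t0; have [_ ? _] := reg_sobolev t0; have [_ ? _ _] := reg_norms t0; exact: sup_le_of_sobolev1. Qed.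
Lemma q_bound t x : 0 < t -> 0 <= x <= 1 -> `|q t x| <= B.
Proof. by move=> t0; have [_ _ ?] := reg_sobolev t0; have [_ _ ? _] := reg_norms t0; exact: sup_le_of_sobolev1. Qed.

Lemma q_holder t x y : 0 < t -> 0 <= x <= 1 -> 0 <= y <= 1 ->
  (q t y - q t x) ^+ 2 <= `|y - x| * M.
Proof.
move=> t0 x01 y01; have [_ _ h1] := reg_sobolev t0; have [_ _ h2 _] := reg_norms t0.
apply: (le_trans (sobolev1_holder h1 x01 y01)); rewrite ler_wpM2l//.
by have := sqr_ge0 (L2norm (wt t)); lra.
Qed.

Lemma C1_pair_of_sobolev2 f : sobolev 1 f -> sobolev 1 (wD f) ->
  C1_pair (cont_rep f) (cont_rep (wD f)).
Proof.
move=> f1 f2; have [cf ff fE] := sobolev1_rep f1; have [cg gg gE] := sobolev1_rep f2.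
split=> // x y x0 xy y1; rewrite fE//.
have [/L2P[mg _] _ _] := f2.
have sub : `]x, y[ `<=` I01 by apply: subset_itvW.
apply: ae_eq_rint.
- by apply: measurable_funS mg.
- by apply: measurable_funS (within_continuous_meas cg).
- by apply: ae_imp gg => s h sxy; apply: h; exact: sub.
Qed.

Lemma u_C1 t : 0 < t -> C1_pair (u t) (p t).
Proof. by move=> t0; have [? ? _] := reg_sobolev t0; exact: C1_pair_of_sobolev2. Qed.

Lemma q_within t : 0 < t -> {within `[0, 1], continuous (q t)}.
Proof. by move=> t0; have [_ _ /sobolev1_rep[]] := reg_sobolev t0. Qed.

Lemma u_within t : 0 <= t -> {within `[0, 1], continuous (u t)}.
Proof. by move=> t0; have [/sobolev1_rep[]] := reg_H1 reg t0. Qed.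

(** The L^2 continuity of w in time and the Hoelder bound in x that comes from the H^1 bound are
    combined by [sqr_le_interpolation], which makes the continuity uniform in x. *)
Lemma u_unif t e : 0 <= t -> 0 < e -> exists2 d, 0 < d &
  forall s, 0 <= s -> `|s - t| < d -> forall x, 0 <= x <= 1 -> `|u s x - u t x| <= e.
Proof.
move=> t0 e0; have [wt1 cw] := reg_H1 reg t0.
(* The time s may be 0, where [M] gives no bound; hence the norm of w_x(0) in the constant. *)
pose k := 2 * (M + L2norm (wD (w t)) ^+ 2 + L2norm (wD (w 0)) ^+ 2).
have M0 := reg_M.
have k0 : 0 <= k by rewrite mulr_ge0// addr_ge0 ?sqr_ge0// addr_ge0 ?sqr_ge0.
(* The window length r makes the Hoelder part at most e^2 / 2; [eta] below does the same for the L^2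
   part. *)
pose r := Num.min 2^-1 (e ^+ 2 / (4 * k + 1)).
have k1 : 0 < 4 * k + 1 by rewrite ltr_wpDl// mulr_ge0.
have e20 : 0 < e ^+ 2 by rewrite exprn_gt0.
have r0 : 0 < r by rewrite lt_min divr_gt0// invr_gt0 ltr0n.
have rk : 2 * k * r <= e ^+ 2 / 2.
  have : r <= e ^+ 2 / (4 * k + 1) by rewrite ge_min lexx orbT.
  by rewrite ler_pdivlMr// => h; have r0' := ltW r0; lra.
pose eta := Num.min 1 (r * e ^+ 2 / 4).
have eta0 : 0 < eta by rewrite lt_min ltr01 divr_gt0// mulr_gt0.
have /cvgrPdist_lt/(_ _ eta0) := cw; rewrite near_withinE => -[d /= d0 dP].
exists d => // s s0 sd x x01.
have {dP} := dP s; rewrite /= [`|t - s|]distrC => /(_ sd); rewrite in_itv/= s0 => /(_ isT).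
rewrite sub0r normrN ger0_norm ?L2norm_ge0// => nlt.
have [ws1 _] := reg_H1 reg s0.
have [cus ws _] := sobolev1_rep ws1; have [cut wt' _] := sobolev1_rep wt1.
pose D y := u s y - u t y.
have cD : {within `[0, 1], continuous D}.
  by move=> y; apply: cvgB; [exact: cus|exact: cut].
have Dk y y' : 0 <= y <= 1 -> 0 <= y' <= 1 -> (D y - D y') ^+ 2 <= k * `|y - y'|.
  move=> y01 y'01; have h1 := sobolev1_holder ws1 y'01 y01; have h2 := sobolev1_holder wt1 y'01 y01.
  have ms : L2norm (wD (w s)) ^+ 2 <= M + L2norm (wD (w 0)) ^+ 2.
    move: s0; rewrite le_eqVlt => /predU1P[<-|s0]; first by rewrite lerDr.
    have [h _ _ _] := reg_norms s0; have := sqr_ge0 (L2norm (w s)).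
    by have := sqr_ge0 (L2norm (wD (w 0))); lra.
  have n0 := normr_ge0 (y - y').
  have h3 : `|y - y'| * L2norm (wD (w s)) ^+ 2 <= `|y - y'| * (M + L2norm (wD (w 0)) ^+ 2).
    by rewrite ler_wpM2l.
  rewrite /D /k; have := sqr_ge0 ((u s y - u s y') + (u t y - u t y')).
  move: h1 h2 h3; set a := u s y; set b := u s y'; set c := u t y; set d' := u t y'.
  by move=> h1 h2 h3 h4; lra.
have D2 : rint 0 1 (fun y => D y ^+ 2) <= eta.
  have -> : rint 0 1 (fun y => D y ^+ 2) = L2norm (w s \- w t) ^+ 2.
    have [/L2P[mws _] _ _] := ws1; have [/L2P[mwt _] _ _] := wt1.
    rewrite L2norm_sqr; apply: ae_eq_rint.
    - by apply: within_continuous_meas; exact: within_continuous_sqr.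
    - by apply: measurable_funX; exact: measurable_funB.
    - by apply: ae_imp (ae_and ws wt') => y [h1 h2] y01; rewrite /D/= -h1// -h2.
  have l0 := L2norm_ge0 (w s \- w t).
  have : eta <= 1 by rewrite ge_min lexx.
  nra.
have r12 : 0 < r <= 2^-1 by rewrite r0 ge_min lexx.
have h := sqr_le_interpolation cD Dk x01 r12.
rewrite -(@ler_pXn2r _ 2) ?nnegrE ?(ltW e0)// real_normK ?num_real// -/(D x) (le_trans h)//.
have : 2 / r * rint 0 1 (fun s => D s ^+ 2) <= e ^+ 2 / 2.
  have h4 : rint 0 1 (fun y => D y ^+ 2) <= r * e ^+ 2 / 4 by rewrite (le_trans D2)// ge_min lexx orbT.
  have r20 : 0 <= 2 / r by rewrite divr_ge0// ltW.
  apply: (le_trans (ler_wpM2l r20 h4)).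
  by rewrite le_eqVlt; apply/orP; left; apply/eqP; field; rewrite gt_eqF.
by lra.
Qed.

Lemma u_cont x : 0 <= x <= 1 -> cont_ge0 (fun t => u t x).
Proof.
move=> x01; apply/cont_ge0P => t t0 e e0; have [d d0 dP] := u_unif t0 e0.
by exists d => // s s0 sd; exact: dP.
Qed.

(** The bound at t is the limit of the bounds at later times t + d / 2, which are positive even if t
    is 0. *)
Lemma u_bound0 t x : 0 <= t -> 0 <= x <= 1 -> `|u t x| <= B.
Proof.
move=> t0 x01; apply/ler_addgt0Pr => e e0.
have [d d0 dP] := u_unif t0 e0.
have h0 : 0 < t + d / 2 by rewrite ltr_wpDl// divr_gt0.
have h1 : `|t + d / 2 - t| < d by rewrite addrAC subrr add0r gtr0_norm ?divr_gt0//; lra.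
have := dP _ (ltW h0) h1 x x01; have := u_bound h0 x01.
by rewrite !ler_norml => /andP[? ?] /andP[? ?]; apply/andP; split; lra.
Qed.

Lemma rint_u_cont a b : 0 <= a -> a <= b -> b <= 1 -> cont_ge0 (fun t => rint a b (u t)).
Proof.
move=> a0 ab b1; apply/cont_ge0P => t t0 e e0; have [d d0 dP] := u_unif t0 e0.
exists d => // s s0 sd.
have ui r : 0 <= r -> rintegrable a b (u r).
  by move=> r0; apply: rintegrable_sub (rintegrable_cont (u_within r0)) _ _.
rewrite -rintB; [|exact: ui s0|exact: ui t0].
apply: (@le_trans _ _ (e * (b - a))).
  apply: norm_rint_le => //; first by apply: rintegrableB; exact: ui.
  by move=> x /andP[? ?]; apply: dP => //; apply/andP; split; lra.
by rewrite ler_piMr ?(ltW e0)//; lra.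
Qed.

Lemma rint_u_sqr_cont a b : 0 <= a -> a <= b -> b <= 1 ->
  cont_ge0 (fun t => rint a b (fun x => u t x ^+ 2 / 2)).
Proof.
move=> a0 ab b1; apply/cont_ge0P => t t0 e e0.
have M0 := reg_M; have B0 : 0 < B by rewrite ltr_wpDr.
have [d d0 dP] := u_unif t0 (divr_gt0 e0 B0).
exists d => // s s0 sd.
have ui r : 0 <= r -> rintegrable a b (fun x => u r x ^+ 2 / 2).
  move=> r0; apply: rintegrable_sub (_ : rintegrable 0 1 _) _ _ => //.
  apply: rintegrable_cont => x; apply: cvgM; last exact: cvg_cst.
  by apply: within_continuous_sqr; exact: u_within.
rewrite -rintB; [|exact: ui s0|exact: ui t0].
apply: (@le_trans _ _ (e * (b - a))).
  apply: norm_rint_le => //; first by apply: rintegrableB; exact: ui.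
  move=> x /andP[? ?]; have x01 : 0 <= x <= 1 by apply/andP; split; lra.
  have h := dP s s0 sd x x01; have h1 := u_bound0 s0 x01; have h2 := u_bound0 t0 x01.
  have -> : u s x ^+ 2 / 2 - u t x ^+ 2 / 2 = (u s x - u t x) * ((u s x + u t x) / 2) by field.
  have B1 : B != 0 by rewrite gt_eqF.
  rewrite normrM -[X in _ <= X](divfK B1).
  apply: ler_pM => //.
  by move: h1 h2; rewrite !ler_norml => /andP[? ?] /andP[? ?]; apply/andP; split; lra.
by rewrite ler_piMr ?(ltW e0)//; lra.
Qed.

End Regularity.

(** * The weak form tested with trapezoids *)

Section RegularityTest.
Context {R : realType}.
Local Notation mu := (@lebesgue_measure R).
Local Notation I01 := (`]0, 1[%classic : set R).
Implicit Types (f g F U P D v phi : R -> R) (x y e s t r k a b : R).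

Lemma cont_ge0_eq f g : (forall t, 0 <= t -> f t = g t) -> cont_ge0 f -> cont_ge0 g.
Proof.
move=> fg /cont_ge0P cf; apply/cont_ge0P => t t0 e e0; have [d d0 dP] := cf t t0 e e0.
by exists d => // s s0 sd; rewrite -!fg//; exact: dP.
Qed.

Lemma continuous_near f g t : (\forall s \near t, f s = g s) ->
  {for t, continuous g} -> {for t, continuous f}.
Proof.
move=> fg cg; rewrite /prop_for /continuous_at (nbhs_singleton fg).
apply: cvg_trans cg; apply: near_eq_cvg; exact: filterS fg.
Qed.

Lemma cont_ge0Z k f : cont_ge0 f -> cont_ge0 (fun t => k * f t).
Proof. by move=> cf t; apply: cvgM; [exact: cvg_cst|exact: cf]. Qed.
Lemma cont_ge0D f g : cont_ge0 f -> cont_ge0 g -> cont_ge0 (fun t => f t + g t).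
Proof. by move=> cf cg t; apply: cvgD; [exact: cf|exact: cg]. Qed.
Lemma cont_ge0B f g : cont_ge0 f -> cont_ge0 g -> cont_ge0 (fun t => f t - g t).
Proof. by move=> cf cg t; apply: cvgB; [exact: cf|exact: cg]. Qed.
Lemma cont_ge0M f g : cont_ge0 f -> cont_ge0 g -> cont_ge0 (fun t => f t * g t).
Proof. by move=> cf cg t; apply: cvgM; [exact: cf|exact: cg]. Qed.
Lemma cont_ge0_cst k : cont_ge0 (fun=> k).
Proof. by move=> t; exact: cvg_cst. Qed.

Context (nu rho delta c0 c1 wd M : R) (w wt z : R -> R -> R).
Context (reg : regular nu rho delta c0 c1 wd M w wt z).
Local Notation u := (fun t => cont_rep (w t)).
Local Notation p := (fun t => cont_rep (wD (w t))).
Local Notation q := (fun t => cont_rep (wt t)).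
Local Notation B := (1 + M).

Section Test.
Context (x y e : R) (x0 : 0 < x) (e0 : 0 < e) (xy : x + e < y) (y1 : y + e < 1).
Local Notation phi := (trap x y e).
Let geom : [/\ 0 < x, 0 < e, x + e < y & y + e < 1]. Proof. by []. Qed.
Let partt := trap_partition x0 e0 xy y1.
Let plphi := trap_pl x0 e0 xy y1.

Lemma trap_sobolev : [/\ sobolev 1 phi, cont_rep phi 0 = 0 & cont_rep phi 1 = 0].
Proof.
have [h1 _ h2] := pl_sobolev partt plphi; have [p0 p1] := trap01 x0 e0 xy y1.
by split; rewrite ?h2 ?lexx ?ler01.
Qed.

Definition flux t : R := inner (wD (w t)) (wD phi).
Definition memflux t : R := inner (z t) (wD phi).

Lemma fluxE t : 0 <= t ->
  flux t = ((u t (x + e) - u t x) - (u t (y + e) - u t y)) / e.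
Proof.
move=> t0; have [? ? ? ?] := geom; have [w1 _] := reg_H1 reg t0.
have [_ _ uE] := sobolev1_rep w1; have [_ _ gL] := w1.
rewrite /flux (inner_wD_trap x0 e0 xy y1); last exact: L2_rintegrable.
by rewrite !uE//; lra.
Qed.

Lemma flux_cont : cont_ge0 flux.
Proof.
have [? ? ? ?] := geom.
apply: (@cont_ge0_eq (fun t => e^-1 * ((u t (x + e) - u t x) - (u t (y + e) - u t y)))).
  by move=> t t0; rewrite fluxE// mulrC.
have c s : 0 <= s <= 1 -> cont_ge0 (fun t => u t s) by move=> s01; exact: (u_cont reg).
by apply: cont_ge0Z; do 2 ?apply: cont_ge0B; apply: c; apply/andP; split; lra.
Qed.

Lemma memflux_ode : [/\ memflux 0 = 0, cont_ge0 memflux &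
  forall t, 0 < t -> is_derive t 1 memflux (flux t - delta * memflux t)].
Proof.
have [_ _ delta0 _] := reg_param reg.
apply: memory_ode => //; first exact: flux_cont.
move=> t t0; have [_ H] := reg_mem reg t0.
have [[_ _ L2phi] _ _] := trap_sobolev.
by rewrite /memflux; have [_ ->] := H _ L2phi.
Qed.

Lemma inner_wD_rep f v : sobolev 1 (wD f) -> measurable_fun I01 v ->
  inner (wD f) v = inner (cont_rep (wD f)) v.
Proof.
move=> f1 mv; have [cg gg _] := sobolev1_rep f1; have [/L2P[mg _] _ _] := f1.
apply: ae_eq_rint.
- exact: measurable_funM.
- by apply: measurable_funM => //; exact: within_continuous_meas.
- by apply: ae_imp gg => s /[apply] ->.
Qed.

Lemma inner_w_wD_rep f v : sobolev 1 f -> sobolev 1 (wD f) -> measurable_fun I01 v ->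
  inner (fun s => f s * wD f s) v = inner (fun s => cont_rep f s * cont_rep (wD f) s) v.
Proof.
move=> f1 f2 mv; have [cf ff _] := sobolev1_rep f1; have [/L2P[mf _] _ _] := f1.
have [cg gg _] := sobolev1_rep f2; have [/L2P[mg _] _ _] := f2.
apply: ae_eq_rint.
- by apply: measurable_funM => //; exact: measurable_funM.
- by apply: measurable_funM => //; apply: measurable_funM; exact: within_continuous_meas.
- by apply: ae_imp (ae_and ff gg) => s [h1 h2] s01; rewrite h1// h2.
Qed.

Lemma trap_weak t : 0 < t ->
  inner (wt t) phi = - (nu * flux t + rho * memflux t + wd * inner (p t) phi
    + inner (fun s => u t s * p t s) phi).
Proof.
move=> t0; have [ph1 ph0 ph1'] := trap_sobolev; have [wt1 wt2 _] := reg_sobolev reg t0.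
have mphi := rintegrable_meas (trap_integrable x0 e0 xy y1).
have := reg_weak reg t0 ph1; rewrite /weak_form ph0 ph1' !mulr0 !addr0.
rewrite -/(flux t) -/(memflux t) inner_wD_rep// inner_w_wD_rep// => h.
by apply/eqP; rewrite -subr_eq0 opprK -h; apply/eqP; ring.
Qed.

(** All other terms of the weak form are bounded functions integrated against the trapezoid, hence
    proportional to its mass, which is at most y - x + e. This factor becomes the Lipschitz bound on
    w_x. *)
Lemma flux_mem_bound t : 0 < t ->
  `|nu * flux t + rho * memflux t| <= (B + wd * B + B * B) * (y - x + e).
Proof.
move=> t0; have M0 := reg_M reg; have [? ? ? ?] := geom; have [_ _ _ wd0] := reg_param reg.
set m := rint 0 1 phi.
have /andP[_ m1] := rint_trap x0 e0 xy y1; rewrite -/m in m1.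
have [wt1 wt2 wt3] := reg_sobolev reg t0.
have [wtL _ _] := wt3; have uC := u_C1 reg t0; have [cp _] := uC; have cu := C1_pair_continuous uC.
have qE : inner (wt t) phi = inner (q t) phi.
  have [cq qq _] := sobolev1_rep wt3; have [mq _] := (L2P _).1 wtL.
  have mphi := rintegrable_meas (trap_integrable x0 e0 xy y1).
  apply: ae_eq_rint; [exact: measurable_funM| |].
    by apply: measurable_funM => //; exact: within_continuous_meas.
  by apply: ae_imp qq => s /[apply] ->.
have qi : rintegrable 0 1 (q t) by apply: rintegrable_cont; exact: (q_within reg).
have h1 : `|inner (wt t) phi| <= B * m.
  rewrite qE; apply: (trap_inner_le x0 e0 xy y1) => // s /andP[? ?].
  by apply: (q_bound reg) => //; rewrite !ltW.
have h2 : `|inner (p t) phi| <= B * m.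
  apply: (trap_inner_le x0 e0 xy y1); first exact: rintegrable_cont.
  by move=> s /andP[? ?]; apply: (p_bound reg) => //; rewrite !ltW.
have h3 : `|inner (fun s => u t s * p t s) phi| <= (B * B) * m.
  apply: (trap_inner_le x0 e0 xy y1).
    by apply: rintegrable_cont => s; apply: cvgM; [exact: cu|exact: cp].
  move=> s /andP[? ?]; rewrite normrM ler_pM//.
    by apply: (u_bound reg) => //; rewrite !ltW.
  by apply: (p_bound reg) => //; rewrite !ltW.
have wt' := trap_weak t0.
have -> : nu * flux t + rho * memflux t = - inner (wt t) phi - wd * inner (p t) phi - inner (fun s => u t s * p t s) phi.
  by rewrite wt'; ring.
apply: (@le_trans _ _ ((B + wd * B + B * B) * m)).
  have h2' : `|wd * inner (p t) phi| <= wd * (B * m) by rewrite normrM ger0_norm// ler_wpM2l.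
  rewrite mulrDl mulrDl -mulrA.
  apply: (le_trans (ler_normB _ _)); apply: lerD => //.
  by apply: (le_trans (ler_normB _ _)); apply: lerD => //; rewrite normrN.
have B0 : 0 <= B by rewrite addr_ge0.
by rewrite ler_wpM2l// !addr_ge0// ?mulr_ge0//.
Qed.

Lemma flux_bound t : 0 < t ->
  `|flux t| <= 2 * ((B + wd * B + B * B) * (y - x + e)) / nu.
Proof.
move=> t0; have [nu0 rho0 delta0 wd0] := reg_param reg; have [z0 cz dz] := memflux_ode.
have M0 := reg_M reg; have [? ? ? ?] := geom.
apply: (volterra_bound nu0 rho0 delta0 cz z0 dz) => //.
  by move=> s s0; exact: flux_mem_bound.
have B0 : 0 <= B by rewrite addr_ge0.
by apply: mulr_ge0; [rewrite !addr_ge0 ?mulr_ge0|lra].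
Qed.

(** The terms with w_x are integrated by parts against the trapezoid, which vanishes at 0 and 1;
    what remains are integrals of w and w^2 / 2, continuous in time by [u_unif], and the flux
    terms. *)
Lemma inner_wt_cont t : 0 < t -> {for t, continuous (fun t => inner (wt t) phi)}.
Proof.
have [? ? ? ?] := geom; have [p0 p1] := trap01 x0 e0 xy y1.
have [_ cz _] := memflux_ode.
pose g t := - (nu * flux t + rho * memflux t
    - wd * (e^-1 * (rint x (x + e) (u t) - rint y (y + e) (u t)))
    - e^-1 * (rint x (x + e) (fun s => u t s ^+ 2 / 2) - rint y (y + e) (fun s => u t s ^+ 2 / 2))).
have gE s : 0 < s -> inner (wt s) phi = g s.
  move=> s0; have uC := u_C1 reg s0; have uC2 := C1_pair_sqr uC.
  rewrite trap_weak// /g; congr (- _).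
  rewrite (C1_pair_pl_ibp partt plphi uC) (C1_pair_pl_ibp partt plphi uC2).
  rewrite -!(inner_wD_pl partt _ plphi); last 2 first.
  - by apply: rintegrable_cont; exact: C1_pair_continuous uC2.
  - by apply: rintegrable_cont; exact: C1_pair_continuous uC.
  rewrite !(inner_wD_trap x0 e0 xy y1); last 2 first.
  - by apply: rintegrable_cont; exact: C1_pair_continuous uC2.
  - by apply: rintegrable_cont; exact: C1_pair_continuous uC.
  by rewrite p0 p1; ring.
have cg : cont_ge0 g.
  apply: (@cont_ge0_eq (fun t => -1 * - g t)); first by move=> s _; rewrite mulN1r opprK.
  apply: cont_ge0Z; rewrite /g; apply: (@cont_ge0_eq (fun t => (nu * flux t + rho * memflux t
    - wd * (e^-1 * (rint x (x + e) (u t) - rint y (y + e) (u t)))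
    - e^-1 * (rint x (x + e) (fun s => u t s ^+ 2 / 2) - rint y (y + e) (fun s => u t s ^+ 2 / 2))))).
    by move=> s _; rewrite opprK.
  apply: cont_ge0B; [apply: cont_ge0B; [apply: cont_ge0D|]|].
  - by apply: cont_ge0Z; exact: flux_cont.
  - exact: cont_ge0Z.
  - by apply: cont_ge0Z; apply: cont_ge0Z; apply: cont_ge0B; apply: (rint_u_cont reg); lra.
  - by apply: cont_ge0Z; apply: cont_ge0B; apply: (rint_u_sqr_cont reg); lra.
move=> t0; have cgt := cont_ge0_at cg t0.
apply: continuous_near cgt; near=> s; rewrite gE//; near: s; exact: lt_nbhsr.
Unshelve. all: by end_near. Qed.

End Test.

End RegularityTest.

(** * Lipschitz bound on w_x and pointwise time derivative of w *)

Section TimeDerivative.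
Context {R : realType}.
Local Notation mu := (@lebesgue_measure R).
Local Notation I01 := (`]0, 1[%classic : set R).
Implicit Types (f g F U P D v phi : R -> R) (x y e s t r k a b : R).

(** The support has to lie inside (0,1) even if x0 is an end point: a window of length r is shifted
    to the right of x0 when x0 is in the left half and to the left otherwise. *)
Lemma trap_near x0 r : 0 <= x0 <= 1 -> 0 < r <= 1 / 4 -> exists x y e,
  [/\ 0 < x, 0 < e, x + e < y, y + e < 1 & forall s, x < s < y + e -> `|s - x0| <= 2 * r].
Proof.
move=> /andP[x00 x01] /andP[r0 r1].
have [a [a0 a1 ax]] : exists a, [/\ 0 < a, a + r < 1 & forall s, a < s < a + r -> `|s - x0| <= 2 * r].
  case: (leP x0 2^-1) => x2.
    exists (x0 + r / 4); split; [lra|lra|].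
    by move=> s /andP[? ?]; rewrite ler_norml; apply/andP; split; lra.
  exists (x0 - 5 * r / 4); split; [lra|lra|].
  by move=> s /andP[? ?]; rewrite ler_norml; apply/andP; split; lra.
exists a, (a + 3 * r / 4), (r / 4); split; [by []|lra|lra|lra|].
by move=> s /andP[? ?]; apply: ax; apply/andP; split; lra.
Qed.

Context (nu rho delta c0 c1 wd M : R) (w wt z : R -> R -> R).
Context (reg : regular nu rho delta c0 c1 wd M w wt z).
Local Notation u := (fun t => cont_rep (w t)).
Local Notation p := (fun t => cont_rep (wD (w t))).
Local Notation q := (fun t => cont_rep (wt t)).
Local Notation B := (1 + M).
Local Notation L := (2 * (B + wd * B + B * B) / nu).

Lemma L_ge0 : 0 <= L.
Proof.
have M0 := reg_M reg; have [nu0 _ _ wd0] := reg_param reg.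
have B0 : 0 <= B by rewrite addr_ge0.
by rewrite divr_ge0 ?(ltW nu0)// mulr_ge0// !addr_ge0// mulr_ge0.
Qed.

Lemma rint_near_cst f a r c k : 0 < r -> rintegrable a (a + r) f ->
  (forall s, a < s < a + r -> `|f s - c| <= k) -> `|rint a (a + r) f - c * r| <= k * r.
Proof.
move=> r0 fi fk; have -> : c * r = rint a (a + r) (fun=> c).
  by rewrite rint_cst; [congr (_ * _); ring|rewrite lerDl ltW].
rewrite -rintB//; last exact: rintegrable_cst.
rewrite [X in _ * X](_ : r = a + r - a); last by ring.
apply: norm_rint_le => //; first by rewrite lerDl ltW.
by apply: rintegrableB => //; exact: rintegrable_cst.
Qed.

(** As e tends to 0 the mean values in [flux] tend to p(x) and p(y), and [flux_bound] becomes the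
    Lipschitz bound; L is the factor of y - x + e in it. *)
Lemma p_lip t x y : 0 < t -> 0 < x -> x < y -> y < 1 -> `|p t x - p t y| <= L * (y - x).
Proof.
move=> t0 x0 xy y1; have L0 := L_ge0.
have [nu0 _ _ wd0] := reg_param reg.
apply/ler_addgt0Pr => eps eps0.
(* L eta pays for the e in y - x + e, and one eta for each of the two mean values. *)
pose eta := eps / (L + 2).
have eta0 : 0 < eta by rewrite divr_gt0// ltr_wpDl.
have etaE : eta * (L + 2) = eps by rewrite /eta divfK// gt_eqF// ltr_wpDl.
have uC := u_C1 reg t0; have [cp uE] := uC; have cpP := (within_continuousP _ _ _).1 cp.
have x01 : 0 <= x <= 1 by apply/andP; split; lra.
have y01 : 0 <= y <= 1 by apply/andP; split; lra.
have [d1 d10 D1] := cpP x x01 _ eta0; have [d2 d20 D2] := cpP y y01 _ eta0.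
pose e := Num.min (Num.min d1 d2) (Num.min eta (Num.min ((y - x) / 2) ((1 - y) / 2))).
have [e0 ed1 ed2 [eeta exy ey1]] : [/\ 0 < e, e <= d1, e <= d2 &
    [/\ e <= eta, e <= (y - x) / 2 & e <= (1 - y) / 2]].
  rewrite /e !lt_min !ge_min !lexx ?orbT/= d10 d20 eta0 !divr_gt0 ?subr_gt0//.
have xey : x + e < y by lra.
have yey : y + e < 1 by lra.
have pi a : 0 <= a -> a + e <= 1 -> rintegrable a (a + e) (p t).
  by move=> a0 a1; apply: rintegrable_sub (rintegrable_cont cp) _ _.
have h1 : `|rint x (x + e) (p t) - p t x * e| <= eta * e.
  apply: rint_near_cst => //; first by apply: pi; lra.
  move=> s /andP[? ?]; rewrite distrC; apply: D1; first by apply/andP; split; lra.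
  by rewrite gtr0_norm ?subr_gt0//; lra.
have h2 : `|rint y (y + e) (p t) - p t y * e| <= eta * e.
  apply: rint_near_cst => //; first by apply: pi; lra.
  move=> s /andP[? ?]; rewrite distrC; apply: D2; first by apply/andP; split; lra.
  by rewrite gtr0_norm ?subr_gt0//; lra.
have := flux_bound reg x0 e0 xey yey t0.
rewrite (fluxE reg x0 e0 xey yey (ltW t0)) !uE; try lra.
set I1 := rint _ _ _ in h1 *; set I2 := rint _ _ _ in h2 *.
rewrite normrM [X in _ * X]gtr0_norm ?invr_gt0// ler_pdivrMr//.
have -> : 2 * ((B + wd * B + B * B) * (y - x + e)) / nu * e = (L * (y - x) + L * e) * e by ring.
move=> h3; rewrite -(ler_pM2r e0) -[X in _ * X <= _](gtr0_norm e0) -normrM.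
have h4 : L * e <= L * eta by rewrite ler_wpM2l.
have h5 : (L * (y - x) + L * e) * e <= (L * (y - x) + L * eta) * e by rewrite ler_wpM2r ?(ltW e0)// lerD2l.
have -> : (L * (y - x) + eps) * e = (L * (y - x) + L * eta) * e + 2 * (eta * e) by rewrite -etaE; ring.
rewrite mulrBl; move: h1 h2 h3; rewrite !ler_norml => /andP[? ?] /andP[? ?] /andP[? ?].
by apply/andP; split; lra.
Qed.

Lemma p_lip' t x y : 0 < t -> 0 < x < 1 -> 0 < y < 1 -> `|p t x - p t y| <= L * `|y - x|.
Proof.
move=> t0 /andP[x0 x1] /andP[y0 y1]; case: (ltgtP x y) => [xy|yx|->].
- by rewrite (gtr0_norm (_ : 0 < y - x)) ?subr_gt0//; exact: p_lip.
- by rewrite distrC [`|y - x|]distrC (gtr0_norm (_ : 0 < x - y)) ?subr_gt0//; exact: p_lip.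
- by rewrite !subrr normr0 mulr0.
Qed.

Lemma u_lip t x y : 0 < t -> 0 <= x <= 1 -> 0 <= y <= 1 -> `|u t x - u t y| <= B * `|x - y|.
Proof.
move=> t0; have [cp uE] := u_C1 reg t0.
have H a b : 0 <= a -> a <= b -> b <= 1 -> `|u t b - u t a| <= B * `|b - a|.
  move=> a0 ab b1; rewrite uE// (ger0_norm (_ : 0 <= b - a)) ?subr_ge0//.
  apply: norm_rint_le => //; first by apply: rintegrable_sub (rintegrable_cont cp) _ _.
  by move=> s /andP[? ?]; apply: (p_bound reg) => //; apply/andP; split; lra.
move=> /andP[x0 x1] /andP[y0 y1]; case: (leP x y) => xy; last by apply: H => //; exact: ltW.
by rewrite distrC [`|x - y|]distrC; exact: H.
Qed.

Lemma inner_wt_rep t v : 0 < t -> measurable_fun I01 v -> inner (wt t) v = inner (q t) v.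
Proof.
move=> t0 mv; have [_ _ wt3] := reg_sobolev reg t0; have [wtL _ _] := wt3.
have [cq qq _] := sobolev1_rep wt3; have [mq _] := (L2P _).1 wtL.
apply: ae_eq_rint; [exact: measurable_funM| |].
  by apply: measurable_funM => //; exact: within_continuous_meas.
by apply: ae_imp qq => s /[apply] ->.
Qed.

Lemma inner_w_rep t v : 0 <= t -> measurable_fun I01 v -> inner (w t) v = inner (u t) v.
Proof.
move=> t0 mv; have [w1 _] := reg_H1 reg t0; have [wL _ _] := w1.
have [cw ww _] := sobolev1_rep w1; have [mw _] := (L2P _).1 wL.
apply: ae_eq_rint; [exact: measurable_funM| |].
  by apply: measurable_funM => //; exact: within_continuous_meas.
by apply: ae_imp ww => s /[apply] ->.
Qed.

(** One trapezoid near x0 serves all times, because the moduli of continuity of w_t and w in x are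
    uniform in time. Divided by its mass [m], inner products become point values up to eta. *)
Lemma test_approx x0 eta : 0 <= x0 <= 1 -> 0 < eta -> exists x y e,
  [/\ 0 < x, 0 < e, x + e < y & y + e < 1] /\
  let m := rint 0 1 (trap x y e) in
  [/\ 0 < m, forall t, 0 < t -> `|inner (wt t) (trap x y e) - q t x0 * m| <= eta * m &
   forall t, 0 < t -> `|inner (w t) (trap x y e) - u t x0 * m| <= eta * m].
Proof.
move=> x01 eta0; have M0 := reg_M reg.
(* The three conditions are 1 / 4 for [trap_near], 2 r M <= eta^2 for the Hoelder bound of w_t, and
   2 r B <= eta for the Lipschitz bound of w. *)
pose r := Num.min (1 / 4) (Num.min (eta ^+ 2 / (2 * M + 1)) (eta / (2 * B))).
have eta2 : 0 < eta ^+ 2 by rewrite exprn_gt0.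
have M1 : 0 < 2 * M + 1 by rewrite ltr_wpDl// mulr_ge0.
have B0 : 0 < 2 * B by rewrite mulr_gt0// ltr_pwDl.
have [r0 r4 [rM rB]] : [/\ 0 < r, r <= 1 / 4 & r <= eta ^+ 2 / (2 * M + 1) /\ r <= eta / (2 * B)].
  by rewrite /r !lt_min !ge_min !lexx ?orbT/= !divr_gt0.
have r14 : 0 < r <= 1 / 4 by rewrite r0.
have [x [y [e [xp ep xey yey near0]]]] := trap_near x01 r14.
exists x, y, e; split => //=.
have /andP[m1 _] := rint_trap xp ep xey yey.
have mphi := rintegrable_meas (trap_integrable xp ep xey yey).
split; first by lra.
- move=> t t0; rewrite inner_wt_rep//.
  apply: (trap_inner_near xp ep xey yey); first by apply: rintegrable_cont; exact: (q_within reg).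
  move=> s sxy; have s01 : 0 <= s <= 1 by move/andP: sxy => [? ?]; apply/andP; split; lra.
  have h := q_holder reg t0 x01 s01; have h1 := near0 s sxy.
  rewrite -(@ler_pXn2r _ 2) ?nnegrE ?(ltW eta0)// real_normK ?num_real//.
  apply: (le_trans h); move: rM; rewrite ler_pdivlMr// => rM.
  have : `|s - x0| * M <= 2 * r * M by rewrite ler_wpM2r.
  by lra.
- move=> t t0; rewrite inner_w_rep ?(ltW t0)//.
  apply: (trap_inner_near xp ep xey yey); first by apply: rintegrable_cont; apply: (u_within reg); exact: ltW.
  move=> s sxy; have s01 : 0 <= s <= 1 by move/andP: sxy => [? ?]; apply/andP; split; lra.
  have h := u_lip t0 s01 x01; have h1 := near0 s sxy.
  apply: (le_trans h); move: rB; rewrite ler_pdivlMr// => rB.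
  have : B * `|s - x0| <= B * (2 * r) by rewrite ler_wpM2l// addr_ge0.
  by lra.
Qed.

(** Point values of w_t are limits, uniform in time, of the continuous functions of [inner_wt_cont]
    divided by the mass of the trapezoid. *)
Lemma q_cont t x : 0 < t -> 0 <= x <= 1 -> {for t, continuous (fun s => q s x)}.
Proof.
move=> t0 x01; apply/cvgrPdist_le => eps eps0.
have eta0 : 0 < eps / 3 by rewrite divr_gt0.
have [a [b [e [[a0 e0 aeb be1] [m0 Hq _]]]]] := test_approx x01 eta0.
set m := rint _ _ _ in m0 Hq.
have em0 : 0 < eps / 3 * m by rewrite mulr_gt0.
have cw := inner_wt_cont reg a0 e0 aeb be1 t0.
have /cvgrPdist_le/(_ _ em0) := cw.
move=> cw'; near=> s.
have s0 : 0 < s by near: s; exact: lt_nbhsr.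
have : `|inner (wt t) (trap a b e) - inner (wt s) (trap a b e)| <= eps / 3 * m by near: s.
have := Hq t t0; have := Hq s s0.
move=> h1 h2 h3; rewrite -(ler_pM2r m0) -[X in _ * X <= _](gtr0_norm m0) -normrM.
move: h1 h2 h3; rewrite mulrBl !ler_norml => /andP[? ?] /andP[? ?] /andP[? ?].
by apply/andP; split; lra.
Unshelve. all: by end_near. Qed.

Lemma q_rintegrable s t x : 0 < s -> 0 <= x <= 1 -> rintegrable s t (fun r => q r x).
Proof.
move=> s0 x01; case: (ltP s t) => st; last exact: rintegrable_nil.
apply: rintegrable_cont; apply/(continuous_within_itvP _ st); split.
- by move=> r; rewrite in_itv/= => /andP[? ?]; apply: q_cont => //; exact: lt_trans s0 _.
- by apply: cvg_at_right_filter; exact: q_cont.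
- by apply: cvg_at_left_filter; apply: q_cont => //; exact: lt_trans s0 _.
Qed.

(** The weak time derivative tested with a trapezoid near x is integrated by [weak_deriv_rint] on
    (0,oo); division by the mass of the trapezoid and [test_approx] turn this into a relation
    between point values. *)
Lemma u_rint s t x : 0 < s -> s <= t -> 0 <= x <= 1 ->
  u t x - u s x = rint s t (fun r => q r x).
Proof.
move=> s0; rewrite le_eqVlt => /predU1P[->|st] x01; first by rewrite subrr rint_nil.
have t0 : 0 < t by exact: lt_trans st.
apply/eqP; rewrite -subr_eq0 -normr_eq0 eq_le normr_ge0 andbT.
apply/ler_addgt0Pr => eps eps0; rewrite add0r.
(* One eta for each of the two end points in time and eta (t - s) for the integral. *)
pose eta := eps / (2 + (t - s)).
have ts0 : 0 < 2 + (t - s) by rewrite ltr_wpDr// subr_ge0 ltW.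
have eta0 : 0 < eta by rewrite divr_gt0.
have etaE : eta * (2 + (t - s)) = eps by rewrite /eta divfK// gt_eqF.
have [a [b [e [[a0 e0 aeb be1] [m0 Hq Hu]]]]] := test_approx x01 eta0.
set m := rint _ _ _ in m0 Hq Hu; set phi := trap a b e in Hq Hu.
have phi1 := trap_sobolev a0 e0 aeb be1; have [[phiL _ _] _ _] := phi1.
have mphi : measurable_fun I01 phi := rintegrable_meas (trap_integrable a0 e0 aeb be1).
have wd1 := reg_wt reg phiL.
have cf1 : cont_ge0 (fun r => inner (w r) phi).
  apply/cont_ge0P => r r0 k k0.
  have km0 : 0 < k / m by rewrite divr_gt0.
  have [d d0 dP] := u_unif reg r0 km0; exists d => // r' r'0 rr'.
  have ui r1 : 0 <= r1 -> rintegrable 0 1 (u r1) by move=> r10; apply: rintegrable_cont; exact: (u_within reg).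
  have [cphi _] := trap_pl a0 e0 aeb be1.
  have gi r1 : 0 <= r1 -> rintegrable 0 1 (fun y => u r1 y * phi y).
    move=> r10; apply: rintegrable_cont => y; apply: cvgM; last exact: cphi.
    exact: (u_within reg r10).
  rewrite !inner_w_rep// !innerE -rintB; [|exact: gi r'0|exact: gi r0].
  rewrite (@eq_rint _ _ _ _ (fun y => (u r' y - u r y) * phi y)); last by move=> y _; rewrite mulrBl.
  have := @trap_inner_near _ a b e a0 e0 aeb be1 (fun y => u r' y - u r y) 0 (k / m).
  rewrite mul0r subr0 innerE -/m divfK ?gt_eqF//; apply.
    by apply: rintegrableB; exact: ui.
  by move=> y /andP[? ?]; rewrite subr0; apply: dP => //; apply/andP; split; lra.
have lp r : 0 < r -> lpt (fun r => inner (w r) phi) r.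
  move=> r0; apply: (@lpt_continuous _ _ _ 1) => //.
    by apply: rintegrable_cont; apply: cont_ge0_sub cf1 _; exact: ltW.
  by apply: cvg_at_right_filter; exact: cont_ge0_at.
have E : inner (w t) phi - inner (w s) phi = rint s t (fun r => inner (wt r) phi).
  apply: (@weak_deriv_rint _ `]0, +oo[ _ _ _ _ 1 wd1) => //; try exact: lp.
  by move=> r /=; rewrite !in_itv/= andbT => /andP[? ?]; exact: lt_le_trans s0 _.
have fi : rintegrable s t (fun r => inner (wt r) phi).
  have [_ l2 _] := wd1; apply: (locally_rintegrable l2) => r /=.
  by rewrite !in_itv/= andbT => /andP[? ?]; exact: lt_le_trans s0 _.
have qi := q_rintegrable t s0 x01.
have h3 : `|rint s t (fun r => inner (wt r) phi) - rint s t (fun r => q r x) * m| <= eta * m * (t - s).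
  rewrite mulrC -rintZ// -rintB//; last exact: rintegrableZ.
  apply: norm_rint_le; first exact: ltW.
    by apply: rintegrableB => //; exact: rintegrableZ.
  by move=> r /andP[sr _]; rewrite mulrC; apply: Hq; exact: lt_trans sr.
have h1 := Hu t t0; have h2 := Hu s s0.
rewrite -(ler_pM2r m0) -[X in _ * X <= _](gtr0_norm m0) -normrM -etaE.
move: h1 h2 h3; rewrite -E.
rewrite !ler_norml => /andP[? ?] /andP[? ?] /andP[? ?].
by apply/andP; split; lra.
Qed.

Lemma u_derive t x : 0 < t -> 0 <= x <= 1 -> is_derive t 1 (fun s => u s x) (q t x).
Proof.
move=> t0 x01; apply: (@antideriv_is_derive _ (t / 2) (t + 1) _ (fun s => q s x)).
- by apply/andP; split; lra.
- by apply: q_rintegrable => //; rewrite divr_gt0.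
- by move=> s r ts sr _; apply: u_rint => //; lra.
- exact: q_cont.
Qed.

End TimeDerivative.

(** * Energy inequalities for nodal vectors *)

Section Discrete.
Context {R : realType}.
Context (N : nat) (xs : nat -> R) (part : is_partition N xs).
Implicit Types (c d e f th s X : nat -> R) (k a b al be F : R).
Local Notation cell := (cell xs).

(** The mean over cell j of the product of the two linear interpolants, hence an exact integration
    rule. *)
Definition quad c d (j : nat) : R :=
  (2 * c j * d j + c j * d j.+1 + c j.+1 * d j + 2 * c j.+1 * d j.+1) / 6.
Definition incr c (j : nat) : R := c j.+1 - c j.
(** For interpolants of nodal vectors and step functions s, t, the first five forms are (c, d),
    (c_x, d_x), (s, d_x), (s, t) and (c_x d, e). In [load] and [lnorm], X holds the cell integrals
    of a function f: [load] is (f, d_x) and [lnorm] is the squared L^2 norm of the step function of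
    cell means of f. *)
Definition mass c d : R := \sum_(j < N) cell j * quad c d j.
Definition stiff c d : R := \sum_(j < N) incr c j * incr d j / cell j.
Definition sgrad s d : R := \sum_(j < N) s j * incr d j.
Definition snorm s (t : nat -> R) : R := \sum_(j < N) cell j * s j * t j.
Definition conv c d e : R := \sum_(j < N) incr c j * quad d e j.
Definition load X d : R := \sum_(j < N) X j * incr d j / cell j.
Definition lnorm X : R := \sum_(j < N) X j ^+ 2 / cell j.

Lemma cell0 (j : 'I_N) : 0 < cell j. Proof. exact: (cell_gt0 part (ltn_ord j)). Qed.

Lemma sum_cell : \sum_(j < N) cell j = 1.
Proof.
have [x0 x1 _] := part.
by rewrite -(big_mkord xpredT cell) telescope_sumr// x0 x1 subr0.
Qed.

Lemma sum_incr c : \sum_(j < N) incr c j = c N - c 0%N.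
Proof. by rewrite -(big_mkord xpredT (incr c)) telescope_sumr. Qed.

Lemma amgm a b k : 0 <= a -> 0 <= b -> k ^+ 2 <= 4 * a * b -> `|k| <= a + b.
Proof.
move=> a0 b0 kab; rewrite -(@ler_pXn2r _ 2) ?nnegrE ?addr_ge0// real_normK ?num_real//.
by apply: (le_trans kab); have := sqr_ge0 (a - b); lra.
Qed.

Lemma quad_ge0 c j : 0 <= quad c c j.
Proof. by rewrite /quad; have := sqr_ge0 (c j + c j.+1); have := sqr_ge0 (c j); have := sqr_ge0 (c j.+1); lra. Qed.

Lemma quad_CS c d j : quad c d j ^+ 2 <= quad c c j * quad d d j.
Proof.
rewrite /quad -subr_ge0; set a := c j; set b := c j.+1; set a' := d j; set b' := d j.+1.
have -> : (2 * a * a + a * b + b * a + 2 * b * b) / 6 * ((2 * a' * a' + a' * b' + b' * a' + 2 * b' * b') / 6) -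
  ((2 * a * a' + a * b' + b * a' + 2 * b * b') / 6) ^+ 2 = (a * b' - b * a') ^+ 2 / 12 by field.
by rewrite divr_ge0// sqr_ge0.
Qed.

Lemma quad_le c j F : c j ^+ 2 <= F -> c j.+1 ^+ 2 <= F -> quad c c j <= F.
Proof. by rewrite /quad => ? ?; have := sqr_ge0 (c j - c j.+1); lra. Qed.

Lemma mass_ge0 c : 0 <= mass c c.
Proof. by apply: sumr_ge0 => j _; rewrite mulr_ge0 ?quad_ge0// ltW ?cell0. Qed.
Lemma stiff_ge0 c : 0 <= stiff c c.
Proof. by apply: sumr_ge0 => j _; rewrite divr_ge0 ?(ltW (cell0 j))// -expr2 sqr_ge0. Qed.
Lemma snorm_ge0 s : 0 <= snorm s s.
Proof. by apply: sumr_ge0 => j _; rewrite -mulrA mulr_ge0 ?(ltW (cell0 j))// -expr2 sqr_ge0. Qed.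
Lemma lnorm_ge0 X : 0 <= lnorm X.
Proof. by apply: sumr_ge0 => j _; rewrite divr_ge0 ?(ltW (cell0 j))// sqr_ge0. Qed.

Lemma norm_sum_le (x y z : 'I_N -> R) : (forall j, `|x j| <= y j + z j) ->
  `|\sum_j x j| <= \sum_j y j + \sum_j z j.
Proof. by move=> H; rewrite -big_split/=; apply: (le_trans (ler_norm_sum _ _ _)); exact: ler_sum. Qed.

(** Young's inequality on each cell, with d bounded at the nodes; in the variant [conv_slope_le] it
    is the slope of c that is bounded. *)
Lemma conv_le c d e F al be : 0 <= al -> 0 <= be -> F <= 4 * al * be ->
  (forall j, (j <= N)%N -> d j ^+ 2 <= F) ->
  `|conv c d e| <= al * mass e e + be * stiff c c.
Proof.
move=> al0 be0 Fab dF; rewrite /mass /stiff !mulr_sumr; apply: norm_sum_le => j.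
have h0 := cell0 j; have qe := quad_ge0 e j.
have qd := quad_le (dF j (ltnW (ltn_ord j))) (dF j.+1 (ltn_ord j)).
apply: amgm.
- by apply: mulr_ge0 => //; apply: mulr_ge0 => //; exact: ltW.
- by apply: mulr_ge0 => //; rewrite divr_ge0 ?(ltW h0)// -expr2 sqr_ge0.
- have -> : 4 * (al * (cell j * quad e e j)) * (be * (incr c j * incr c j / cell j)) =
     incr c j ^+ 2 * ((4 * al * be) * quad e e j) by field; rewrite gt_eqF.
  rewrite exprMn ler_wpM2l ?sqr_ge0//; apply: (le_trans (quad_CS d e j)).
  by rewrite ler_wpM2r// (le_trans qd).
Qed.

Lemma conv_slope_le c d e F al be : 0 <= al -> 0 <= be -> F ^+ 2 <= 4 * al * be ->
  (forall j, (j < N)%N -> `|incr c j| <= F * cell j) ->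
  `|conv c d e| <= al * mass e e + be * mass d d.
Proof.
move=> al0 be0 Fab cF; rewrite /mass !mulr_sumr; apply: norm_sum_le => j.
have h0 := cell0 j; have qe := quad_ge0 e j; have qd := quad_ge0 d j.
apply: amgm.
- by apply: mulr_ge0 => //; apply: mulr_ge0 => //; exact: ltW.
- by apply: mulr_ge0 => //; apply: mulr_ge0 => //; exact: ltW.
- have -> : 4 * (al * (cell j * quad e e j)) * (be * (cell j * quad d d j)) =
     (4 * al * be * cell j ^+ 2) * (quad d d j * quad e e j) by ring.
  rewrite exprMn; apply: ler_pM; rewrite ?sqr_ge0//; last exact: quad_CS.
  apply: (@le_trans _ _ ((F * cell j) ^+ 2)).
    rewrite -(real_normK (num_real (incr c j))) ler_pXn2r ?nnegrE ?cF//.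
    by apply: le_trans (cF j (ltn_ord j)).
  by rewrite exprMn ler_wpM2r// sqr_ge0.
Qed.

Lemma load_le X d al be : 0 <= al -> 0 <= be -> 1 <= 4 * al * be ->
  `|load X d| <= al * stiff d d + be * lnorm X.
Proof.
move=> al0 be0 ab; rewrite /stiff /lnorm !mulr_sumr; apply: norm_sum_le => j.
have h0 := cell0 j; have d2 : 0 <= incr d j * incr d j / cell j.
  by rewrite divr_ge0 ?(ltW h0)// -expr2 sqr_ge0.
have x2 : 0 <= X j ^+ 2 / cell j by rewrite divr_ge0 ?(ltW h0)// sqr_ge0.
apply: amgm; [exact: mulr_ge0|exact: mulr_ge0|].
have -> : (X j * incr d j / cell j) ^+ 2 = 1 * ((incr d j * incr d j / cell j) * (X j ^+ 2 / cell j)).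
  by field; rewrite gt_eqF.
have -> : 4 * (al * (incr d j * incr d j / cell j)) * (be * (X j ^+ 2 / cell j)) =
  (4 * al * be) * ((incr d j * incr d j / cell j) * (X j ^+ 2 / cell j)) by ring.
by rewrite ler_wpM2r// mulr_ge0.
Qed.

Lemma sgrad_le s d al be : 0 <= al -> 0 <= be -> 1 <= 4 * al * be ->
  `|sgrad s d| <= al * stiff d d + be * snorm s s.
Proof.
move=> al0 be0 ab; rewrite /stiff /snorm !mulr_sumr; apply: norm_sum_le => j.
have h0 := cell0 j; have d2 : 0 <= incr d j * incr d j / cell j.
  by rewrite divr_ge0 ?(ltW h0)// -expr2 sqr_ge0.
have s2 : 0 <= cell j * s j * s j by rewrite -mulrA; apply: mulr_ge0; [exact: ltW|rewrite -expr2 sqr_ge0].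
apply: amgm; [exact: mulr_ge0|exact: mulr_ge0|].
have -> : (s j * incr d j) ^+ 2 = 1 * ((incr d j * incr d j / cell j) * (cell j * s j * s j)).
  by field; rewrite gt_eqF.
have -> : 4 * (al * (incr d j * incr d j / cell j)) * (be * (cell j * s j * s j)) =
  (4 * al * be) * ((incr d j * incr d j / cell j) * (cell j * s j * s j)) by ring.
by rewrite ler_wpM2r// mulr_ge0.
Qed.

(** Discrete form of |c(x) - c(0)|^2 <= x ||c_x||^2, by induction on the node; the cross term with
    the new increment is split by [amgm]. *)
Lemma node_incr_le c j : (j <= N)%N -> (c j - c 0%N) ^+ 2 <= stiff c c.
Proof.
have [x0 x1 lt] := part => jN.
have H n : (n <= N)%N -> (c n - c 0%N) ^+ 2 <= xs n * \sum_(i < n) incr c i * incr c i / cell i.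
  elim: n => [|n IH] nN; first by rewrite subrr expr0n big_ord0 mulr0.
  rewrite big_ord_recr/=; have {}IH := IH (ltnW nN).
  have h0 : 0 < cell n := cell_gt0 part nN.
  have -> : xs n.+1 = xs n + cell n by exact: (esym (subrKC _ _)).
  have -> : c n.+1 - c 0%N = (c n - c 0%N) + incr c n by rewrite /incr; ring.
  have /andP[xn0 _] := partition_itv part (ltnW nN).
  set S := \sum_(i < n) _ in IH *; set A := c n - c 0%N in IH *; set a := incr c n.
  have S0 : 0 <= S.
    apply: sumr_ge0 => i _; rewrite divr_ge0 -?expr2 ?sqr_ge0// ltW//.
    by apply: (cell_gt0 part); exact: ltn_trans (ltn_ord i) nN.
  have P0 : 0 <= xs n * (a * a / cell n) by apply: mulr_ge0 => //; rewrite divr_ge0 ?(ltW h0)// -expr2 sqr_ge0.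
  have Q0 : 0 <= cell n * S by rewrite mulr_ge0// ltW.
  have h : (2 * A * a) ^+ 2 <= 4 * (xs n * (a * a / cell n)) * (cell n * S).
    have -> : 4 * (xs n * (a * a / cell n)) * (cell n * S) = 4 * a ^+ 2 * (xs n * S).
      by field; rewrite gt_eqF.
    have -> : (2 * A * a) ^+ 2 = 4 * a ^+ 2 * A ^+ 2 by ring.
    by rewrite ler_wpM2l// mulr_ge0// sqr_ge0.
  have := amgm P0 Q0 h; rewrite ler_norml => /andP[_ h2].
  have -> : (xs n + cell n) * (S + a * a / cell n) = xs n * S + xs n * (a * a / cell n) + cell n * S + a ^+ 2.
    by field; rewrite gt_eqF.
  by lra.
have Sj : \sum_(i < j) incr c i * incr c i / cell i <= stiff c c.
  rewrite /stiff -(big_mkord xpredT (fun i => incr c i * incr c i / cell i)).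
  rewrite -[X in _ <= X](big_mkord xpredT (fun i => incr c i * incr c i / cell i)).
  rewrite [X in _ <= X](big_cat_nat (n := j))//= lerDl.
  rewrite big_nat_cond; apply: sumr_ge0 => i; rewrite andbT => /andP[_ iN].
  by rewrite divr_ge0 -?expr2 ?sqr_ge0// ltW// (cell_gt0 part).
have /andP[xj0 xj1] := partition_itv part jN.
apply: (le_trans (H j jN)); apply: le_trans Sj; rewrite ler_piMl//.
apply: sumr_ge0 => i _; rewrite divr_ge0 -?expr2 ?sqr_ge0// ltW//.
by apply: (cell_gt0 part); exact: leq_trans (ltn_ord i) jN.
Qed.

Lemma node_le c j : (j <= N)%N -> c j ^+ 2 <= 2 * c 0%N ^+ 2 + 2 * stiff c c.
Proof. by move=> /(node_incr_le c) ?; have := sqr_ge0 (c j - c 0%N - c 0%N); lra. Qed.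

Lemma mass_le c F : (forall j, (j <= N)%N -> c j ^+ 2 <= F) -> mass c c <= F.
Proof.
move=> cF; rewrite -[F]mul1r -sum_cell mulr_suml; apply: ler_sum => j _.
rewrite ler_wpM2l ?(ltW (cell0 j))//; apply: quad_le; apply: cF.
  exact/ltnW/ltn_ord.
exact: ltn_ord.
Qed.

(** Every node value differs from that at node 0 by at most the square root of [stiff c c], so each
    cell mean of c^2 is at least c(0)^2 / 12 - stiff / 6; the cells have total length 1. *)
Lemma trace_le c : c 0%N ^+ 2 <= 12 * mass c c + 2 * stiff c c.
Proof.
have : (c 0%N ^+ 2 / 2 - stiff c c) / 6 <= mass c c.
  set K := (_ / 6); rewrite -[K]mul1r -sum_cell mulr_suml; apply: ler_sum => j _.
  rewrite ler_wpM2l ?(ltW (cell0 j))// /K.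
  have := node_incr_le c (ltnW (ltn_ord j)); rewrite /quad.
  have := sqr_ge0 (c j + c j.+1); have := sqr_ge0 (c j.+1).
  by have := sqr_ge0 (c 0%N - 2 * c j); lra.
by lra.
Qed.

(** [quad] has no quadrature error, so this identity and the two that follow are exact integrals of
    derivatives, and the sums telescope. *)
Lemma conv_cube c : conv c c c = (c N ^+ 3 - c 0%N ^+ 3) / 3.
Proof.
rewrite -(sum_incr (fun j => c j ^+ 3)) mulr_suml; apply: eq_bigr => j _.
by rewrite /quad /incr; field.
Qed.

Lemma conv_one c : conv c (fun=> 1) c = (c N ^+ 2 - c 0%N ^+ 2) / 2.
Proof.
rewrite -(sum_incr (fun j => c j ^+ 2)) mulr_suml; apply: eq_bigr => j _.
by rewrite /quad /incr; field.
Qed.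

Lemma conv_leibniz c d : conv c d d + 2 * conv d c d = c N * d N ^+ 2 - c 0%N * d 0%N ^+ 2.
Proof.
rewrite -(sum_incr (fun j => c j * d j ^+ 2)) /conv mulr_sumr -big_split/=.
by apply: eq_bigr => j _; rewrite /quad /incr; field.
Qed.

Lemma conv_diff c d e : conv c c e - conv (fun j => c j - d j) (fun j => c j - d j) e =
  conv c d e + conv d c e - conv d d e.
Proof.
rewrite /conv -!sumrB -big_split/= -sumrB; apply: eq_bigr => j _.
by rewrite /quad /incr; field.
Qed.

Lemma convZ k c e : k * conv c (fun=> 1) e = conv c (fun=> k) e.
Proof. by rewrite /conv mulr_sumr; apply: eq_bigr => j _; rewrite /quad; field. Qed.

End Discrete.

(** * The cubic boundary feedback *)

Section BoundaryTerm.
Context {R : realType}.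
Implicit Types (c wd W x : R).

Definition bcub c wd x : R := (c + wd) * x + 2 / (9 * c) * x ^+ 3.

(* The cubic feedback dominates the boundary terms that the convection terms
   leave after integration by parts: W is a trace of V and x one of theta. *)
Lemma bcub_right c wd W x : 0 < c -> 0 <= wd ->
  c / 2 * x ^+ 2 <= (bcub c wd W - bcub c wd (W - x)) * x + wd / 2 * x ^+ 2 + W * x ^+ 2 - x ^+ 3 / 3.
Proof.
move=> c0 wd0; rewrite -subr_ge0 /bcub.
(* Completing the square in W leaves, apart from the term in wd, a quadratic in x; for the feedback
   coefficient 2 / (9 c) and the rest c / 2 kept on the left it is itself a perfect square. *)
have -> : ((c + wd) * W + 2 / (9 * c) * W ^+ 3 - ((c + wd) * (W - x) + 2 / (9 * c) * (W - x) ^+ 3)) * x +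
   wd / 2 * x ^+ 2 + W * x ^+ 2 - x ^+ 3 / 3 - c / 2 * x ^+ 2 =
   x ^+ 2 * (2 / (3 * c) * (W - x / 2 + 3 * c / 4) ^+ 2 + 1 / (18 * c) * (x + 3 * c / 2) ^+ 2
     + 3 * wd / 2) by field; rewrite gt_eqF.
apply: mulr_ge0; first exact: sqr_ge0.
have p1 : 0 <= 2 / (3 * c) by rewrite divr_ge0// mulr_ge0// ltW.
have p2 : 0 <= 1 / (18 * c) by rewrite divr_ge0// mulr_ge0// ltW.
have := mulr_ge0 p1 (sqr_ge0 (W - x / 2 + 3 * c / 4)).
by have := mulr_ge0 p2 (sqr_ge0 (x + 3 * c / 2)); lra.
Qed.

Lemma bcub_left c wd W x : 0 < c -> 0 <= wd ->
  c / 2 * x ^+ 2 <= (bcub c wd W - bcub c wd (W - x)) * x - wd / 2 * x ^+ 2 - W * x ^+ 2 + x ^+ 3 / 3.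
Proof.
move=> c0 wd0; rewrite -subr_ge0 /bcub.
have -> : ((c + wd) * W + 2 / (9 * c) * W ^+ 3 - ((c + wd) * (W - x) + 2 / (9 * c) * (W - x) ^+ 3)) * x -
   wd / 2 * x ^+ 2 - W * x ^+ 2 + x ^+ 3 / 3 - c / 2 * x ^+ 2 =
   x ^+ 2 * (2 / (3 * c) * (W - x / 2 - 3 * c / 4) ^+ 2 + 1 / (18 * c) * (x - 3 * c / 2) ^+ 2
     + wd / 2) by field; rewrite gt_eqF.
apply: mulr_ge0; first exact: sqr_ge0.
have p1 : 0 <= 2 / (3 * c) by rewrite divr_ge0// mulr_ge0// ltW.
have p2 : 0 <= 1 / (18 * c) by rewrite divr_ge0// mulr_ge0// ltW.
have := mulr_ge0 p1 (sqr_ge0 (W - x / 2 - 3 * c / 4)).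
by have := mulr_ge0 p2 (sqr_ge0 (x - 3 * c / 2)); lra.
Qed.

(* Qf is the primitive in x of bcub W - bcub (W - x), and dQf its time derivative
   when W and x move with velocities W' and x'. *)
Definition Qf c wd W x : R :=
  (c + wd) / 2 * x ^+ 2 + 2 / (9 * c) * (3 / 2 * W ^+ 2 * x ^+ 2 - W * x ^+ 3 + x ^+ 4 / 4).
Definition dQf c wd W W' x x' : R :=
  (bcub c wd W - bcub c wd (W - x)) * x' + 2 / (9 * c) * (3 * W * W' * x ^+ 2 - W' * x ^+ 3).

Lemma Qf_ge c wd W x : 0 < c -> 0 <= wd -> c / 2 * x ^+ 2 <= Qf c wd W x.
Proof.
move=> c0 wd0; rewrite -subr_ge0 /Qf.
have -> : (c + wd) / 2 * x ^+ 2 + 2 / (9 * c) * (3 / 2 * W ^+ 2 * x ^+ 2 - W * x ^+ 3 + x ^+ 4 / 4) - c / 2 * x ^+ 2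
  = x ^+ 2 * (wd / 2 + 2 / (9 * c) * (3 / 2 * (W - x / 3) ^+ 2 + x ^+ 2 / 12)) by field; rewrite gt_eqF.
apply: mulr_ge0; first exact: sqr_ge0.
rewrite addr_ge0 ?divr_ge0// mulr_ge0//; first by rewrite divr_ge0// mulr_ge0// ltW.
by have := sqr_ge0 (W - x / 3); have := sqr_ge0 x; lra.
Qed.

Lemma cube_le x k : 0 <= k -> k * `|x ^+ 3| <= k * (x ^+ 2 + x ^+ 4).
Proof.
move=> k0; rewrite ler_wpM2l// normrX exprS real_normK ?num_real//.
have -> : x ^+ 4 = x ^+ 2 * x ^+ 2 by ring.
have := sqr_ge0 (`|x| - 1); have := sqr_ge0 x; have := normr_ge0 x.
rewrite sqrrB real_normK ?num_real//; set a := x ^+ 2; set b := `|x|; nra.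
Qed.

Lemma Qf_le c wd W x M : 0 < c -> 0 <= wd -> `|W| <= M ->
  Qf c wd W x <= (c + wd + 2 / (9 * c) * (2 * M ^+ 2 + M)) * x ^+ 2
    + 2 / (9 * c) * (M + 1) * x ^+ 4.
Proof.
move=> c0 wd0 WM; have k0 : 0 <= 2 / (9 * c) by rewrite divr_ge0// mulr_ge0// ltW.
have M0 : 0 <= M := le_trans (normr_ge0 _) WM.
have x2 := sqr_ge0 x; have x4 : 0 <= x ^+ 4 by rewrite (_ : 4%N = (2 * 2)%N)// exprM sqr_ge0.
have W2 : W ^+ 2 <= M ^+ 2 by rewrite -(real_normK (num_real W)) ler_pXn2r// nnegrE.
have h1 : - (W * x ^+ 3) <= M * (x ^+ 2 + x ^+ 4).
  apply: (@le_trans _ _ (M * `|x ^+ 3|)); last exact: cube_le.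
  apply: (le_trans (ler_norm _)); rewrite normrN normrM ler_wpM2r//.
have h2 : W ^+ 2 * x ^+ 2 <= M ^+ 2 * x ^+ 2 by rewrite ler_wpM2r.
have MM := sqr_ge0 M.
have h3 : 0 <= M ^+ 2 * x ^+ 2 by rewrite mulr_ge0.
have h4 : 3 / 2 * W ^+ 2 * x ^+ 2 - W * x ^+ 3 + x ^+ 4 / 4 <= (2 * M ^+ 2 + M) * x ^+ 2 + (M + 1) * x ^+ 4.
  by lra.
have := ler_wpM2l k0 h4; rewrite /Qf.
have : 0 <= (c + wd) * x ^+ 2 by rewrite mulr_ge0// addr_ge0// ltW.
by lra.
Qed.

(** The product with x' is left as it stands, since it cancels against the boundary term of the
    error equation tested with theta_t. *)
Lemma dQf_le c wd W W' x x' M : 0 < c -> `|W| <= M -> `|W'| <= M ->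
  dQf c wd W W' x x' <= (bcub c wd W - bcub c wd (W - x)) * x'
     + 2 / (9 * c) * ((3 * M ^+ 2 + M) * x ^+ 2 + M * x ^+ 4).
Proof.
move=> c0 WM W'M; have k0 : 0 <= 2 / (9 * c) by rewrite divr_ge0// mulr_ge0// ltW.
have M0 : 0 <= M := le_trans (normr_ge0 _) WM.
rewrite /dQf lerD2l ler_wpM2l//.
have x2 := sqr_ge0 x.
have h1 : - (W' * x ^+ 3) <= M * (x ^+ 2 + x ^+ 4).
  apply: (@le_trans _ _ (M * `|x ^+ 3|)); last exact: cube_le.
  by apply: (le_trans (ler_norm _)); rewrite normrN normrM ler_wpM2r.
have h2 : W * W' <= M ^+ 2.
  by apply: (le_trans (ler_norm _)); rewrite normrM expr2 ler_pM.
have h3 : W * W' * x ^+ 2 <= M ^+ 2 * x ^+ 2 by rewrite ler_wpM2r.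
by lra.
Qed.

End BoundaryTerm.

(** * Energy estimates for theta *)

Section Energy.
Context {R : realType}.
Context (N : nat) (xs : nat -> R) (part : is_partition N xs).
Context (nu rho delta c0 c1 wd M : R).
Context (par : [/\ 0 < nu, 0 < rho, 0 < delta, 0 < c0 & 0 < c1]) (wd0 : 0 <= wd) (M0 : 0 <= M).
Implicit Types (V th td s sd X Xd phi : nat -> R).
Local Notation mass := (mass N xs).
Local Notation stiff := (stiff N xs).
Local Notation sgrad := (sgrad N).
Local Notation snorm := (snorm N xs).
Local Notation conv := (conv N).
Local Notation load := (load N xs).
Local Notation lnorm := (lnorm N xs).

(* The equation for theta = V - w_h tested with phi; s holds the memory integrals of
   the slopes of theta and r stands for - (eta_t, phi). With V = 0 and th = - w_h it
   is the scheme itself. *)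
Definition error_eq V th td s X (r : R) phi : Prop :=
  mass td phi + nu * stiff th phi + rho * sgrad s phi + wd * conv th (fun=> 1) phi
  + (conv V V phi - conv (fun j => V j - th j) (fun j => V j - th j) phi)
  + ((bcub c0 wd (V 0%N) - bcub c0 wd (V 0%N - th 0%N)) * phi 0%N
     + (bcub c1 wd (V N) - bcub c1 wd (V N - th N)) * phi N) = r + load X phi.

Definition bsq th : R := stiff th th + th 0%N ^+ 2 + th N ^+ 2.

Lemma bsq_ge0 th : 0 <= bsq th.
Proof. by rewrite /bsq !addr_ge0 ?sqr_ge0// (stiff_ge0 part). Qed.

Lemma node_le_bsq th j : (j <= N)%N -> th j ^+ 2 <= 2 * bsq th.
Proof. by move=> /(node_le part th) h; rewrite /bsq; have := sqr_ge0 (th N); lra. Qed.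

Lemma mass_le_bsq th : mass th th <= 2 * bsq th.
Proof. by apply: (mass_le part) => j jN; exact: node_le_bsq. Qed.

(** The convection difference is V_x theta + V theta_x - theta theta_x; [conv_leibniz] trades V_x
    theta^2 for boundary values and a multiple of V theta theta_x. No slope of V is left, and the
    boundary values are those that [bcub_left] and [bcub_right] dominate. *)
Lemma energy1 V th td s X r : error_eq V th td s X r th ->
  mass td th + rho * sgrad s th + nu * stiff th th + c0 / 2 * th 0%N ^+ 2 + c1 / 2 * th N ^+ 2
  <= `|conv th V th| + r + load X th.
Proof.
have [nu0 rho0 delta0 c00 c10] := par; have wd0' := wd0.
rewrite /error_eq conv_diff conv_cube conv_one => h.
have hl := conv_leibniz N V th.
have b0 := bcub_left (V 0%N) (th 0%N) c00 wd0'.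
have bN := bcub_right (V N) (th N) c10 wd0'.
have := ler_norm (conv th V th).
by lra.
Qed.

(** As s_t = theta_x - delta s, the left-hand side is the time derivative of ||theta||^2 + rho
    ||s||^2: the memory term becomes part of the energy and dissipates. *)
Lemma energy1_diff V th td s X (r e : R) : error_eq V th td s X r th -> 0 <= e ->
  (r : R) ^+ 2 <= (e : R) * mass th th ->
  2 * mass td th + rho * (2 * sgrad s th - 2 * delta * snorm s s) <=
  - (Num.min (nu / 2) (Num.min (c0 / 2) (Num.min c1 (2 * rho * delta)))) * (bsq th + snorm s s)
  + 16 / nu * bsq V * bsq th + e / (2 * (Num.min c0 nu / 8)) + 2 / nu * lnorm X.
Proof.
move=> eq e0 re; have [nu0 rho0 delta0 c00 c10] := par.
have h1 := energy1 eq.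
(* Chosen so that kap ||theta||^2, which is at most 2 kap (theta(0)^2 + ||theta_x||^2), uses up only
   part of the dissipation. *)
set kap := Num.min c0 nu / 8.
have kap0 : 0 < kap by rewrite divr_gt0// lt_min c00.
have [kc kn] : kap <= c0 / 8 /\ kap <= nu / 8.
  by rewrite /kap; split; rewrite ler_pM2r// ge_min lexx ?orbT.
set k1 := Num.min (nu / 2) _.
have [k1a k1b k1c k1d] : [/\ k1 <= nu / 2, k1 <= c0 / 2, k1 <= c1 & k1 <= 2 * rho * delta].
  by rewrite /k1 !ge_min !lexx ?orbT.
have m0 := mass_ge0 part th.
have hr : r <= kap * mass th th + e / (4 * kap).
  apply: (le_trans (ler_norm _)); apply: amgm.
  - by apply: mulr_ge0 => //; exact: ltW.
  - by rewrite divr_ge0// mulr_ge0// ltW.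
  - have -> // : 4 * (kap * mass th th) * (e / (4 * kap)) = e * mass th th.
    by field; rewrite gt_eqF.
have bV := bsq_ge0 V; have bt := bsq_ge0 th.
have hc : `|conv th V th| <= (2 / nu * bsq V) * mass th th + nu / 4 * stiff th th.
  apply: (@conv_le _ N xs part _ _ _ (2 * bsq V)).
  - by apply: mulr_ge0 => //; rewrite divr_ge0// ltW.
  - by rewrite divr_ge0// ltW.
  - by have -> : 4 * (2 / nu * bsq V) * (nu / 4) = 2 * bsq V by field; rewrite gt_eqF.
  - by move=> j jN; exact: node_le_bsq.
have hl : load X th <= nu / 4 * stiff th th + nu^-1 * lnorm X.
  apply: (le_trans (ler_norm _)); apply: (load_le part).
  - by rewrite divr_ge0// ltW.
  - by rewrite invr_ge0 ltW.
  - by have -> : 4 * (nu / 4) / nu = 1 by field; rewrite gt_eqF.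
have hm := mass_le_bsq th.
have hm2 : kap * mass th th <= 2 * kap * th 0%N ^+ 2 + 2 * kap * stiff th th.
  have : mass th th <= 2 * th 0%N ^+ 2 + 2 * stiff th th.
    by apply: (mass_le part) => j jN; exact: node_le.
  by move=> /(ler_wpM2l (ltW kap0)); lra.
have s0 := snorm_ge0 part s; have st0 := stiff_ge0 part th.
have t02 := sqr_ge0 (th 0%N); have tN2 := sqr_ge0 (th N).
have g1 : 2 * kap * th 0%N ^+ 2 <= c0 / 4 * th 0%N ^+ 2 by rewrite ler_wpM2r//; lra.
have g2 : 2 * kap * stiff th th <= nu / 4 * stiff th th by rewrite ler_wpM2r//; lra.
have g3 : (2 / nu * bsq V) * mass th th <= (2 / nu * bsq V) * (2 * bsq th).
  by rewrite ler_wpM2l//; apply: mulr_ge0 => //; rewrite divr_ge0// ltW.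
have g4 : k1 * stiff th th <= nu / 2 * stiff th th by rewrite ler_wpM2r.
have g5 : k1 * th 0%N ^+ 2 <= c0 / 2 * th 0%N ^+ 2 by rewrite ler_wpM2r.
have g6 : k1 * th N ^+ 2 <= c1 * th N ^+ 2 by rewrite ler_wpM2r.
have g7 : k1 * snorm s s <= 2 * rho * delta * snorm s s by rewrite ler_wpM2r.
have g8 : 0 <= 2 / nu * bsq V * bsq th.
  by apply: mulr_ge0 => //; apply: mulr_ge0 => //; rewrite divr_ge0// ltW.
have eE : e / (2 * kap) = 2 * (e / (4 * kap)) by field; rewrite gt_eqF.
have kE : k1 * (bsq th + snorm s s) =
  k1 * stiff th th + k1 * th 0%N ^+ 2 + k1 * th N ^+ 2 + k1 * snorm s s by rewrite /bsq; ring.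
rewrite eE mulNr kE; move: h1 hr hc hl hm2 g1 g2 g3 g4 g5 g6 g7 g8; clear -par wd0 M0 part; lra.
Qed.

Local Notation k0 := (2 / (9 * c0)).
Local Notation k1 := (2 / (9 * c1)).

(* The time derivative of grad_energy is what the error equation tested with
   theta_t controls. *)
Definition grad_energy V th s X : R :=
  nu / 2 * stiff th th + rho * sgrad s th
  + (Qf c0 wd (V 0%N) (th 0%N) + Qf c1 wd (V N) (th N)) - load X th.

Definition dgrad_energy V (V0' VN' : R) th td s X Xd : R :=
  nu * stiff th td + rho * ((stiff th th - delta * sgrad s th) + sgrad s td)
  + (dQf c0 wd (V 0%N) V0' (th 0%N) (td 0%N) + dQf c1 wd (V N) VN' (th N) (td N))
  - (load Xd th + load X td).

Definition growth1 : R := 2 * wd ^+ 2 + 6 * M ^+ 2 + 1 + rho + 2 * rho * delta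
  + (k0 + k1) * (3 * M ^+ 2 + M).
Definition growth2 : R := 4 + (k0 + k1) * M.

Lemma k01_ge0 : 0 <= k0 /\ 0 <= k1.
Proof. by have [_ _ _ ? ?] := par; split; rewrite divr_ge0// mulr_ge0// ltW. Qed.

Lemma sqr4_le x (b : R) : x ^+ 2 <= b -> x ^+ 4 <= b ^+ 2 :> R.
Proof.
move=> xb; rewrite (_ : 4%N = (2 * 2)%N)// exprM ler_pXn2r// nnegrE ?sqr_ge0//.
exact: le_trans (sqr_ge0 x) xb.
Qed.

(** Five products with theta_t are split by Young's inequality, each at the price of 1/8 of
    ||theta_t||^2. The products of s and of the residual with theta_tx cannot be treated so, as
    theta_tx is not controlled; they belong to the time derivative of [grad_energy], which leaves
    [load Xd th] instead. The square of [bsq th] comes from theta theta_x theta_t and from the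
    fourth powers in the boundary terms. *)
Lemma energy2 V V0' VN' th td s X Xd (r e : R) : error_eq V th td s X r td -> 0 <= e ->
  r ^+ 2 <= e * mass td td -> (forall j, (j <= N)%N -> `|V j| <= M) ->
  (forall j, (j < N)%N -> `|incr V j| <= M * cell xs j) -> `|V0'| <= M -> `|VN'| <= M ->
  dgrad_energy V V0' VN' th td s X Xd <= growth1 * (bsq th + snorm s s) + growth2 * bsq th ^+ 2
    + 2 * e + lnorm Xd / 4.
Proof.
move=> eq e0 re VM VsM V0M VNM; have [nu0 rho0 delta0 c00 c10] := par.
have MM : 0 <= M := M0; have wdd : 0 <= wd := wd0.
have V2 j : (j <= N)%N -> V j ^+ 2 <= M ^+ 2.
  by move=> jN; rewrite -(real_normK (num_real (V j))) ler_pXn2r ?nnegrE// VM.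
have q0 := @dQf_le _ c0 wd (V 0%N) V0' (th 0%N) (td 0%N) M c00 (VM 0%N (leq0n N)) V0M.
have qN := @dQf_le _ c1 wd (V N) VN' (th N) (td N) M c10 (VM N (leqnn N)) VNM.
have m0 := mass_ge0 part td; have mt := mass_ge0 part th.
have bt := bsq_ge0 th.
have w1 : `|wd * conv th (fun=> 1) td| <= 1 / 8 * mass td td + 2 * wd ^+ 2 * stiff th th.
  rewrite convZ; apply: (@conv_le _ N xs part _ _ _ (wd ^+ 2)) => //; try by [].
  - by rewrite mulr_ge0// sqr_ge0.
  - by rewrite le_eqVlt; apply/orP; left; apply/eqP; field.
have w2 : `|conv V th td| <= 1 / 8 * mass td td + 2 * M ^+ 2 * mass th th.
  apply: (@conv_slope_le _ N xs part _ _ _ M) => //.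
  - by rewrite mulr_ge0// sqr_ge0.
  - by rewrite le_eqVlt; apply/orP; left; apply/eqP; field.
have w3 : `|conv th V td| <= 1 / 8 * mass td td + 2 * M ^+ 2 * stiff th th.
  apply: (@conv_le _ N xs part _ _ _ (M ^+ 2)) => //.
  - by rewrite mulr_ge0// sqr_ge0.
  - by rewrite le_eqVlt; apply/orP; left; apply/eqP; field.
have w4 : `|conv th th td| <= 1 / 8 * mass td td + 4 * bsq th * stiff th th.
  apply: (@conv_le _ N xs part _ _ _ (2 * bsq th)) => //.
  - by rewrite mulr_ge0.
  - by rewrite le_eqVlt; apply/orP; left; apply/eqP; field.
  - by move=> j jN; exact: node_le_bsq.
have w5 : `|r| <= 1 / 8 * mass td td + 2 * e.
  apply: amgm; [by rewrite mulr_ge0|by rewrite mulr_ge0|].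
  by rewrite (_ : 4 * (1 / 8 * mass td td) * (2 * e) = e * mass td td)//; field.
have w6 : `|load Xd th| <= 1 * stiff th th + 1 / 4 * lnorm Xd.
  by apply: (load_le part) => //; rewrite le_eqVlt; apply/orP; left; apply/eqP; field.
have w7 : `|sgrad s th| <= 1 * stiff th th + 1 / 4 * snorm s s.
  by apply: (sgrad_le part) => //; rewrite le_eqVlt; apply/orP; left; apply/eqP; field.
have st0 := stiff_ge0 part th; have s0 := snorm_ge0 part s.
have [k0p k1p] := k01_ge0.
have t0 := sqr_ge0 (th 0%N); have tN := sqr_ge0 (th N).
have sb : stiff th th <= bsq th by rewrite /bsq; lra.
have tb0 : th 0%N ^+ 2 <= bsq th by rewrite /bsq; lra.
have tbN : th N ^+ 2 <= bsq th by rewrite /bsq; lra.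
have t40 := sqr4_le tb0; have t4N := sqr4_le tbN.
have K3 : 0 <= 3 * M ^+ 2 + M by rewrite addr_ge0// mulr_ge0// sqr_ge0.
have b0 : k0 * ((3 * M ^+ 2 + M) * th 0%N ^+ 2 + M * th 0%N ^+ 4) <=
    k0 * ((3 * M ^+ 2 + M) * bsq th + M * bsq th ^+ 2).
  by rewrite ler_wpM2l// lerD// ler_wpM2l.
have bN : k1 * ((3 * M ^+ 2 + M) * th N ^+ 2 + M * th N ^+ 4) <=
    k1 * ((3 * M ^+ 2 + M) * bsq th + M * bsq th ^+ 2).
  by rewrite ler_wpM2l// lerD// ler_wpM2l.
have x1 : (2 * wd ^+ 2 + 2 * M ^+ 2 + 1 + rho + rho * delta) * stiff th th <=
    (2 * wd ^+ 2 + 2 * M ^+ 2 + 1 + rho + rho * delta) * bsq th.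
  rewrite ler_wpM2l// !addr_ge0 ?mulr_ge0 ?sqr_ge0//; exact: ltW.
have x2 : 2 * M ^+ 2 * mass th th <= 2 * M ^+ 2 * (2 * bsq th).
  by rewrite ler_wpM2l ?mass_le_bsq// mulr_ge0// sqr_ge0.
have x3 : 4 * bsq th * stiff th th <= 4 * bsq th * bsq th by rewrite ler_wpM2l// mulr_ge0.
have rd0 : 0 <= rho * delta by rewrite mulr_ge0// ltW.
have x4 : - (rho * delta * sgrad s th) <= rho * delta * (1 * stiff th th + 1 / 4 * snorm s s).
  rewrite -mulrN ler_wpM2l//; apply: le_trans w7; by rewrite -normrN ler_norm.
have x5 : 0 <= rho * delta * snorm s s by rewrite mulr_ge0.
have x6 : 0 <= rho * delta * bsq th by rewrite mulr_ge0.
have C1p : 0 <= growth1 * snorm s s - rho * delta * snorm s s.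
  rewrite -mulrBl mulr_ge0//.
  have e1 := mulr_ge0 k0p K3; have e2 := mulr_ge0 k1p K3; have e3 := sqr_ge0 wd.
  have e4 := sqr_ge0 M; have e5 := ltW rho0.
  by rewrite /growth1; move: e1 e2 e3 e4 e5 rd0; clear -par wd0 M0 part; lra.
have growth1E : growth1 * (bsq th + snorm s s) = (2 * wd ^+ 2 + 2 * M ^+ 2 + 1 + rho + rho * delta) * bsq th
   + 2 * M ^+ 2 * (2 * bsq th) + rho * delta * bsq th + k0 * ((3 * M ^+ 2 + M) * bsq th)
   + k1 * ((3 * M ^+ 2 + M) * bsq th) + growth1 * snorm s s by rewrite /growth1; ring.
have growth2E : growth2 * bsq th ^+ 2 = 4 * bsq th * bsq th + k0 * (M * bsq th ^+ 2) + k1 * (M * bsq th ^+ 2).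
  by rewrite /growth2; ring.
move: eq; rewrite /error_eq conv_diff => eq.
rewrite growth1E growth2E /dgrad_energy.
move: w1 w2 w3 w4 w5 w6; rewrite !ler_norml => /andP[w1 _] /andP[w2 _] /andP[w3 _] /andP[_ w4] /andP[_ w5] /andP[w6 _].
move: m0 eq q0 qN w1 w2 w3 w4 w5 w6 b0 bN x1 x2 x3 x4 x5 x6 C1p.
clear -par wd0 M0 part; lra.
Qed.

Definition total_energy (A : R) V th s X : R := A * (mass th th + rho * snorm s s) + grad_energy V th s X.

Lemma rho_sgrad_le s th : `|rho * sgrad s th| <= nu / 8 * stiff th th + 2 * rho ^+ 2 / nu * snorm s s.
Proof.
have [nu0 rho0 delta0 c00 c10] := par.
have h : `|sgrad s th| <= nu / (8 * rho) * stiff th th + 2 * rho / nu * snorm s s.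
  apply: (sgrad_le part).
  - by rewrite divr_ge0 ?mulr_ge0// ltW.
  - by rewrite divr_ge0 ?mulr_ge0// ltW.
  - by rewrite le_eqVlt; apply/orP; left; apply/eqP; field; rewrite !gt_eqF.
rewrite normrM (gtr0_norm rho0); apply: (le_trans (ler_wpM2l (ltW rho0) h)).
by rewrite le_eqVlt; apply/orP; left; apply/eqP; field; rewrite !gt_eqF.
Qed.

Lemma load_nu_le X th : `|load X th| <= nu / 8 * stiff th th + 2 / nu * lnorm X.
Proof.
have [nu0 rho0 delta0 c00 c10] := par.
apply: (load_le part); [by rewrite divr_ge0// ltW|by rewrite divr_ge0// ltW|].
by rewrite le_eqVlt; apply/orP; left; apply/eqP; field; rewrite !gt_eqF.
Qed.

(** With A >= 2 rho / nu + 1 the part A rho ||s||^2 outweighs the indefinite term rho (s, theta_x)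
    and leaves rho ||s||^2; the load term is indefinite too and is compensated by [lnorm X]. *)
Lemma total_energy_ge A V th s X : 2 * rho / nu + 1 <= A ->
  Num.min (nu / 4) (Num.min rho (Num.min (c0 / 2) (c1 / 2))) * (bsq th + snorm s s)
  <= total_energy A V th s X + 2 / nu * lnorm X.
Proof.
move=> Age; have [nu0 rho0 delta0 c00 c10] := par.
have wdd : 0 <= wd := wd0.
set k2 := Num.min _ _.
have [ka kb kc kd] : [/\ k2 <= nu / 4, k2 <= rho, k2 <= c0 / 2 & k2 <= c1 / 2].
  by rewrite /k2 !ge_min !lexx ?orbT.
have h1 := rho_sgrad_le s th; have h2 := load_nu_le X th.
have m0 := mass_ge0 part th; have st0 := stiff_ge0 part th; have s0 := snorm_ge0 part s.
have t0 := sqr_ge0 (th 0%N); have tN := sqr_ge0 (th N).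
have q0 := Qf_ge (V 0%N) (th 0%N) c00 wdd; have qN := Qf_ge (V N) (th N) c10 wdd.
have g1 : k2 * stiff th th <= nu / 4 * stiff th th by rewrite ler_wpM2r.
have g2 : k2 * snorm s s <= rho * snorm s s by rewrite ler_wpM2r.
have g3 : k2 * th 0%N ^+ 2 <= c0 / 2 * th 0%N ^+ 2 by rewrite ler_wpM2r.
have g4 : k2 * th N ^+ 2 <= c1 / 2 * th N ^+ 2 by rewrite ler_wpM2r.
have A0 : 0 <= A.
  by apply: le_trans Age; rewrite addr_ge0// divr_ge0 ?mulr_ge0// ltW.
have g5 : 0 <= A * mass th th by rewrite mulr_ge0.
have g6 : (2 * rho / nu + 1) * (rho * snorm s s) <= A * (rho * snorm s s).
  by rewrite ler_wpM2r// mulr_ge0// ltW.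
have g7 : (2 * rho / nu + 1) * (rho * snorm s s) = 2 * rho ^+ 2 / nu * snorm s s + rho * snorm s s.
  by field; rewrite gt_eqF.
have kE : k2 * (bsq th + snorm s s) =
  k2 * stiff th th + k2 * th 0%N ^+ 2 + k2 * th N ^+ 2 + k2 * snorm s s by rewrite /bsq; ring.
rewrite kE /total_energy /grad_energy mulrDr; move: h1 h2; rewrite !ler_norml => /andP[h1 _] /andP[_ h2].
move: h1 h2 q0 qN g1 g2 g3 g4 g5 g6; rewrite g7.
clear -par wd0 M0 part; lra.
Qed.

Definition upper1 (A : R) : R := A * (2 + rho) + nu + 2 * rho ^+ 2 / nu
  + (c0 + c1 + 2 * wd + (k0 + k1) * (2 * M ^+ 2 + M)).
Definition upper2 : R := (k0 + k1) * (M + 1).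

Lemma total_energy_le A V th s X : 0 <= A -> (forall j, (j <= N)%N -> `|V j| <= M) ->
  total_energy A V th s X <= upper1 A * (bsq th + snorm s s) + upper2 * bsq th ^+ 2 + 2 / nu * lnorm X.
Proof.
move=> A0 VM; have [nu0 rho0 delta0 c00 c10] := par.
have wdd : 0 <= wd := wd0; have MM : 0 <= M := M0.
have h1 := rho_sgrad_le s th; have h2 := load_nu_le X th.
have m0 := mass_ge0 part th; have st0 := stiff_ge0 part th; have s0 := snorm_ge0 part s.
have t0 := sqr_ge0 (th 0%N); have tN := sqr_ge0 (th N); have bt := bsq_ge0 th.
have q0 := Qf_le (th 0%N) c00 wdd (VM 0%N (leq0n N)).
have qN := Qf_le (th N) c10 wdd (VM N (leqnn N)).
have [k0p k1p] := k01_ge0.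
have sb : stiff th th <= bsq th by rewrite /bsq; lra.
have tb0 : th 0%N ^+ 2 <= bsq th by rewrite /bsq; lra.
have tbN : th N ^+ 2 <= bsq th by rewrite /bsq; lra.
have t40 := sqr4_le tb0; have t4N := sqr4_le tbN.
have K3 : 0 <= 2 * M ^+ 2 + M by rewrite addr_ge0// mulr_ge0// sqr_ge0.
have e0 : (c0 + wd + k0 * (2 * M ^+ 2 + M)) * th 0%N ^+ 2 <= (c0 + wd + k0 * (2 * M ^+ 2 + M)) * bsq th.
  rewrite ler_wpM2l//; have := mulr_ge0 k0p K3; move: (ltW c00) wdd; clear -par wd0 M0 part; lra.
have eN : (c1 + wd + k1 * (2 * M ^+ 2 + M)) * th N ^+ 2 <= (c1 + wd + k1 * (2 * M ^+ 2 + M)) * bsq th.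
  rewrite ler_wpM2l//; have := mulr_ge0 k1p K3; move: (ltW c10) wdd; clear -par wd0 M0 part; lra.
have M1 : 0 <= M + 1 by rewrite addr_ge0.
have f0 : k0 * (M + 1) * th 0%N ^+ 4 <= k0 * (M + 1) * bsq th ^+ 2.
  by rewrite ler_wpM2l// mulr_ge0.
have fN : k1 * (M + 1) * th N ^+ 4 <= k1 * (M + 1) * bsq th ^+ 2.
  by rewrite ler_wpM2l// mulr_ge0.
have g1 : A * mass th th <= A * (2 * bsq th) by rewrite ler_wpM2l// mass_le_bsq.
have g2 : nu * stiff th th <= nu * bsq th by rewrite ler_wpM2l// ltW.
have r2 : 0 <= 2 * rho ^+ 2 / nu by rewrite divr_ge0 ?mulr_ge0 ?sqr_ge0// ltW.
have g3 : 0 <= A * rho * bsq th by rewrite mulr_ge0// mulr_ge0// ltW.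
have g4 : 0 <= A * 2 * snorm s s by rewrite mulr_ge0// mulr_ge0.
have g5 : 0 <= 2 * rho ^+ 2 / nu * bsq th by rewrite mulr_ge0.
have g6 : 0 <= nu * snorm s s by rewrite mulr_ge0// ltW.
have g7 : 0 <= nu * stiff th th by rewrite mulr_ge0// ltW.
have q : 0 <= c0 + c1 + 2 * wd + (k0 + k1) * (2 * M ^+ 2 + M).
  have := mulr_ge0 k0p K3; have := mulr_ge0 k1p K3; move: (ltW c00) (ltW c10) wdd; clear -par wd0 M0 part; lra.
have g8 := mulr_ge0 q s0.
have E : upper1 A * (bsq th + snorm s s) = A * (2 * bsq th) + A * rho * bsq th + A * 2 * snorm s s
  + A * (rho * snorm s s) + nu * bsq th + nu * snorm s s + 2 * rho ^+ 2 / nu * bsq th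
  + 2 * rho ^+ 2 / nu * snorm s s
  + (c0 + wd + k0 * (2 * M ^+ 2 + M)) * bsq th + (c1 + wd + k1 * (2 * M ^+ 2 + M)) * bsq th
  + (c0 + c1 + 2 * wd + (k0 + k1) * (2 * M ^+ 2 + M)) * snorm s s by rewrite /upper1; ring.
have E5 : upper2 * bsq th ^+ 2 = k0 * (M + 1) * bsq th ^+ 2 + k1 * (M + 1) * bsq th ^+ 2.
  by rewrite /upper2; ring.
rewrite E E5 /total_energy /grad_energy mulrDr; move: h1 h2; rewrite !ler_norml => /andP[_ h1] /andP[h2 _].
move: h1 h2 q0 qN e0 eN f0 fN g1 g2 g3 g4 g5 g6 g7 g8.
clear -par wd0 M0 part; lra.
Qed.

End Energy.

Section EnergyTotal.
Context {R : realType}.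

(** The constants are chosen before the mesh. H is [total_energy] plus 2 / nu times a bound [xh] of
    [lnorm X], which makes it nonnegative; it is comparable with |theta|^2 + ||s||^2 up to |theta|^4
    and [xh]. The second part combines A times [energy1_diff] with [energy2]. *)
Lemma energy_total (nu rho delta c0 c1 wd M : R) :
  [/\ 0 < nu, 0 < rho, 0 < delta, 0 < c0 & 0 < c1] -> 0 <= wd -> 0 <= M ->
  exists A al K1 K2 k2 K4 K5 : R,
    [/\ 0 < al, 0 <= K1, 0 <= K2, 0 < k2 & 0 <= K4 /\ 0 <= K5] /\
    forall N xs, is_partition N xs ->
    (forall V th s X (xh : R), (forall j, (j <= N)%N -> `|V j| <= M) -> lnorm N xs X <= xh ->
       k2 * (bsq N xs th + snorm N xs s s) <= total_energy N xs nu rho c0 c1 wd A V th s X + 2 / nu * xh /\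
       total_energy N xs nu rho c0 c1 wd A V th s X + 2 / nu * xh <=
         K4 * (bsq N xs th + snorm N xs s s) + K5 * bsq N xs th ^+ 2 + 4 / nu * xh) /\
    (forall V (V0' VN' : R) th td s X Xd (r1 r2 e xh : R),
      error_eq N xs nu rho c0 c1 wd V th td s X r1 th ->
      error_eq N xs nu rho c0 c1 wd V th td s X r2 td ->
      0 <= e -> r1 ^+ 2 <= e * mass N xs th th -> r2 ^+ 2 <= e * mass N xs td td ->
      (forall j, (j <= N)%N -> `|V j| <= M) ->
      (forall j, (j < N)%N -> `|incr V j| <= M * cell xs j) -> `|V0'| <= M -> `|VN'| <= M ->
      lnorm N xs X <= xh ->
      let H := total_energy N xs nu rho c0 c1 wd A V th s X + 2 / nu * xh in
      A * (2 * mass N xs td th + rho * (2 * sgrad N s th - 2 * delta * snorm N xs s s))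
        + dgrad_energy N xs nu rho delta c0 c1 wd V V0' VN' th td s X Xd
      <= - al * H + K1 * (bsq N xs V + bsq N xs (fun j => V j - th j)) * H
         + K2 * (e + xh + lnorm N xs Xd)).
Proof.
move=> par wd0 M0; have [nu0 rho0 delta0 c00 c10] := par.
set kap := Num.min c0 nu / 8.
have kap0 : 0 < kap by rewrite divr_gt0// lt_min c00.
set k1 := Num.min (nu / 2) (Num.min (c0 / 2) (Num.min c1 (2 * rho * delta))).
have k10 : 0 < k1 by rewrite !lt_min !divr_gt0// c10 !mulr_gt0.
set k2 := Num.min (nu / 4) (Num.min rho (Num.min (c0 / 2) (c1 / 2))).
have k20 : 0 < k2 by rewrite !lt_min !divr_gt0// rho0.
have [q0 q1] := k01_ge0 par.
have C1p : 0 <= growth1 rho delta c0 c1 wd M.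
  have h : 0 <= 3 * M ^+ 2 + M by rewrite addr_ge0// mulr_ge0// sqr_ge0.
  have h1 := mulr_ge0 (addr_ge0 q0 q1) h.
  rewrite /growth1; have := sqr_ge0 wd; have := sqr_ge0 M; have := mulr_gt0 rho0 delta0.
  by move=> ? ? ?; lra.
have C2p : 0 <= growth2 c0 c1 M.
  by rewrite /growth2 addr_ge0// mulr_ge0// addr_ge0.
have C5p : 0 <= upper2 c0 c1 M by rewrite /upper2 !mulr_ge0 ?addr_ge0.
(* A times the dissipation rate k1 of [energy1_diff] has to exceed the growth in [energy2] by 1;
   this spare unit yields the decay - al H. The other two summands are for [total_energy_ge]. *)
pose A := (growth1 rho delta c0 c1 wd M + 1) / k1 + 2 * rho / nu + 1.
have rn0 : 0 <= 2 * rho / nu by rewrite divr_ge0 ?mulr_ge0// ltW.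
have A1 : 2 * rho / nu + 1 <= A.
  have h : 0 <= (growth1 rho delta c0 c1 wd M + 1) / k1.
    by apply: divr_ge0; [exact: addr_ge0|exact: ltW].
  by rewrite /A; lra.
have A0 : 0 <= A by apply: le_trans A1; exact: addr_ge0.
have Ak : growth1 rho delta c0 c1 wd M + 1 <= A * k1.
  have E : (growth1 rho delta c0 c1 wd M + 1) / k1 * k1 = growth1 rho delta c0 c1 wd M + 1.
    by rewrite divfK// gt_eqF.
  rewrite /A mulrDl mulrDl E mul1r; have := mulr_ge0 rn0 (ltW k10); lra.
have C4p : 0 < upper1 nu rho c0 c1 wd M A.
  have h : 0 <= 2 * M ^+ 2 + M by rewrite addr_ge0// mulr_ge0// sqr_ge0.
  have h1 := mulr_ge0 (addr_ge0 q0 q1) h.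
  have h2 : 0 <= A * (2 + rho) by rewrite mulr_ge0// addr_ge0// ltW.
  have h3 : 0 <= 2 * rho ^+ 2 / nu by rewrite divr_ge0 ?mulr_ge0 ?sqr_ge0// ltW.
  by rewrite /upper1; move: h1 h2 h3 nu0 c00 c10 wd0; clear; lra.
set c4 := upper1 nu rho c0 c1 wd M A in C4p *; set c5 := upper2 c0 c1 M in C5p *.
set cc1 := growth1 rho delta c0 c1 wd M in C1p Ak *; set cc2 := growth2 c0 c1 M in C2p *.
pose K1 := (16 * A / nu + 2 * cc2 + 2 * c5 / c4) / k2.
pose K2 := A / (2 * kap) + 2 * A / nu + 4 / (nu * c4) + 3.
have c5c4 : 0 <= c5 / c4 by rewrite divr_ge0// ltW.
have An : 0 <= A / nu by rewrite divr_ge0// ltW.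
have K1p : 0 <= K1.
  by rewrite /K1 divr_ge0 ?(ltW k20)//; lra.
have Akap : 0 <= A / (2 * kap) by rewrite divr_ge0// mulr_ge0// ltW.
have n4 : 0 <= 4 / (nu * c4) by rewrite divr_ge0// mulr_ge0// ltW.
have K2p : 0 <= K2 by rewrite /K2; lra.
exists A, c4^-1, K1, K2, k2, c4, c5; split.
  by split => //; [rewrite invr_gt0|split => //; exact: ltW].
move=> N xs part; split.
  move=> V th s X xh VM lX.
  have h1 := total_energy_ge part par wd0 V th s X A1.
  have h2 := total_energy_le part par wd0 M0 th s X A0 VM.
  have h3 : 2 / nu * lnorm N xs X <= 2 / nu * xh by rewrite ler_wpM2l// divr_ge0// ltW.
  rewrite -/c4 -/c5 in h2; rewrite -/k2 in h1; split; first by lra.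
  have -> : 4 / nu * xh = 2 / nu * xh + 2 / nu * xh by ring.
  by lra.
move=> V V0' VN' th td s X Xd r1 r2 e xh eq1 eq2 e0 re1 re2 VM VsM V0M VNM lX.
have h1 := energy1_diff part par wd0 eq1 e0 re1; rewrite -/k1 -/kap in h1.
have h2 := energy2 part par wd0 M0 Xd eq2 e0 re2 VM VsM V0M VNM; rewrite -/cc1 -/cc2 in h2.
have h3 := total_energy_ge part par wd0 V th s X A1; rewrite -/k2 in h3.
have h4 := total_energy_le part par wd0 M0 th s X A0 VM; rewrite -/c4 -/c5 in h4.
have n0 : 0 <= 2 / nu by rewrite divr_ge0// ltW.
have h5 : 2 / nu * lnorm N xs X <= 2 / nu * xh by rewrite ler_wpM2l.
have lX0 := lnorm_ge0 part X; have lXd0 := lnorm_ge0 part Xd.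
set Y := fun j => V j - th j.
set H := total_energy _ _ _ _ _ _ _ _ _ _ _ _ + _.
have b0 := bsq_ge0 part th; have s0 := snorm_ge0 part s.
have bV := bsq_ge0 part V; have bY := bsq_ge0 part Y.
(* theta = V - w_h: in |theta|^4 one factor |theta|^2 is bounded by quantities that are integrable
   in time, so that no quadratic term in H survives. *)
have bVY : bsq N xs th <= 2 * bsq N xs V + 2 * bsq N xs Y.
  have st : stiff N xs th th <= 2 * stiff N xs V V + 2 * stiff N xs Y Y.
    rewrite /stiff !mulr_sumr -big_split/=; apply: ler_sum => j _.
    have cj := cell0 part j.
    have -> : 2 * (incr V j * incr V j / cell xs j) + 2 * (incr Y j * incr Y j / cell xs j) =
      (2 * (incr V j * incr V j) + 2 * (incr Y j * incr Y j)) / cell xs j by ring.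
    rewrite ler_wpM2r ?invr_ge0 ?(ltW cj)//.
    have -> : incr th j = incr V j - incr Y j by rewrite /incr /Y; ring.
    by have := sqr_ge0 (incr V j + incr Y j); lra.
  have t0 : th 0%N ^+ 2 <= 2 * V 0%N ^+ 2 + 2 * Y 0%N ^+ 2.
    have -> : th 0%N = V 0%N - Y 0%N by rewrite /Y; ring.
    by have := sqr_ge0 (V 0%N + Y 0%N); lra.
  have tN : th N ^+ 2 <= 2 * V N ^+ 2 + 2 * Y N ^+ 2.
    have -> : th N = V N - Y N by rewrite /Y; ring.
    by have := sqr_ge0 (V N + Y N); lra.
  by rewrite /bsq; lra.
set b := bsq N xs th in b0 bVY h1 h2 h3 h4 *.
set v := bsq N xs V in bV bVY h1 *; set y := bsq N xs Y in bY bVY *.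
set sn := snorm N xs s s in s0 h1 h2 h3 h4 *.
set dE := 2 * mass N xs td th + _ in h1 *.
set dG := dgrad_energy _ _ _ _ _ _ _ _ _ _ _ _ _ _ _ _ in h2 *.
have xh0 : 0 <= xh by apply: le_trans lX.
have HD : k2 * (b + sn) <= H by rewrite /H; lra.
have HU : H <= c4 * (b + sn) + c5 * b ^+ 2 + 4 / nu * xh.
  have -> : 4 / nu * xh = 2 / nu * xh + 2 / nu * xh by ring.
  by rewrite /H; lra.
have D0 : 0 <= b + sn by rewrite addr_ge0.
have H0 : 0 <= H by apply: le_trans HD; rewrite mulr_ge0// ltW.
have DH : b + sn <= H / k2 by rewrite ler_pdivlMr// mulrC.
have g1 : A * dE <= - (A * k1) * (b + sn) + 16 * A / nu * (v * b) + A / (2 * kap) * e + 2 * A / nu * xh.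
  apply: (le_trans (ler_wpM2l A0 h1)).
  have -> : A * (- k1 * (b + sn) + 16 / nu * v * b + e / (2 * kap) + 2 / nu * lnorm N xs X) =
    - (A * k1) * (b + sn) + 16 * A / nu * (v * b) + A / (2 * kap) * e + A * (2 / nu * lnorm N xs X).
    by field; rewrite !gt_eqF.
  have -> : 2 * A / nu * xh = A * (2 / nu * xh) by ring.
  by rewrite lerD2l ler_wpM2l.
have g2 : (cc1 + 1) * (b + sn) <= A * k1 * (b + sn) by rewrite ler_wpM2r.
(* The spare unit of dissipation is converted into - H / c4 by the upper bound for H; the fourth
   power that appears joins the others in [g5]. *)
have g3 : - (b + sn) <= - c4^-1 * H + c5 / c4 * b ^+ 2 + 4 / (nu * c4) * xh.
  have : c4^-1 * H <= c4^-1 * (c4 * (b + sn) + c5 * b ^+ 2 + 4 / nu * xh).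
    by rewrite ler_wpM2l// invr_ge0 ltW.
  have -> : c4^-1 * (c4 * (b + sn) + c5 * b ^+ 2 + 4 / nu * xh) =
    (b + sn) + c5 / c4 * b ^+ 2 + 4 / (nu * c4) * xh by field; rewrite !gt_eqF.
  by lra.
have vb : v * b <= v * (H / k2) by rewrite ler_wpM2l//; lra.
have bb : b ^+ 2 <= 2 * (v + y) * (H / k2).
  by rewrite expr2; apply: ler_pM => //; lra.
have yH : 0 <= y * (H / k2) by rewrite mulr_ge0// divr_ge0// ltW.
have g4 : 16 * A / nu * (v * b) <= 16 * A / nu * ((v + y) * (H / k2)).
  by rewrite ler_wpM2l; [|lra|lra].
have g5 : (cc2 + c5 / c4) * b ^+ 2 <= (cc2 + c5 / c4) * (2 * (v + y) * (H / k2)).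
  by rewrite ler_wpM2l// addr_ge0.
have KE : K1 * (v + y) * H = 16 * A / nu * ((v + y) * (H / k2)) + (cc2 + c5 / c4) * (2 * (v + y) * (H / k2)).
  by rewrite /K1; field; rewrite !gt_eqF.
have K2E : K2 * (e + xh + lnorm N xs Xd) = A / (2 * kap) * e + 2 * A / nu * xh + 4 / (nu * c4) * xh + 3 * e
   + 3 * xh + 3 * lnorm N xs Xd
   + ((2 * A / nu + 4 / (nu * c4)) * e + (A / (2 * kap)) * xh
      + (A / (2 * kap) + 2 * A / nu + 4 / (nu * c4)) * lnorm N xs Xd) by rewrite /K2; ring.
have rest : 0 <= (2 * A / nu + 4 / (nu * c4)) * e + (A / (2 * kap)) * xh
      + (A / (2 * kap) + 2 * A / nu + 4 / (nu * c4)) * lnorm N xs Xd.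
  have An2 : 0 <= 2 * A / nu by rewrite -mulrA mulr_ge0.
  have u1 := mulr_ge0 (addr_ge0 An2 n4) e0; have u2 := mulr_ge0 Akap xh0.
  have u3 := mulr_ge0 (addr_ge0 (addr_ge0 Akap An2) n4) lXd0.
  exact: addr_ge0 (addr_ge0 u1 u2) u3.
cbv zeta; rewrite KE K2E; move: g1 g2 g3 g4 g5 h2 rest e0 xh0 lXd0; clear; lra.
Qed.

End EnergyTotal.

(** * Gronwall inequality for the error energy *)

Section Derivatives.
Context {R : realType}.
Implicit Types (f g : R -> R) (t k : R).

Lemma derD f g t (df dg : R) : is_derive t 1 f df -> is_derive t 1 g dg ->
  is_derive t 1 (fun s => f s + g s) (df + dg).
Proof. by move=> hf hg; exact: (@is_deriveD _ _ _ f g). Qed.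

Lemma derB f g t (df dg : R) : is_derive t 1 f df -> is_derive t 1 g dg ->
  is_derive t 1 (fun s => f s - g s) (df - dg).
Proof. by move=> hf hg; exact: (@is_deriveB _ _ _ f g). Qed.

Lemma derM f g t (df dg : R) : is_derive t 1 f df -> is_derive t 1 g dg ->
  is_derive t 1 (fun s => f s * g s) (df * g t + f t * dg).
Proof.
move=> hf hg; have := @is_deriveM _ _ f g t 1 df dg hf hg.
by move/is_derive_eq; apply; rewrite /GRing.scale/= addrC mulrC.
Qed.

Lemma derC k t : is_derive t 1 (fun=> k) 0.
Proof. exact: is_derive_cst. Qed.

Lemma derZ k f t (df : R) : is_derive t 1 f df -> is_derive t 1 (fun s => k * f s) (k * df).
Proof. by move=> hf; have := derM (derC k t) hf; rewrite mul0r add0r. Qed.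

Lemma derN f t (df : R) : is_derive t 1 f df -> is_derive t 1 (fun s => - f s) (- df).
Proof. by move=> hf; exact: (@is_deriveN _ _ _ f). Qed.

Lemma der_expR f t (df : R) : is_derive t 1 f df ->
  is_derive t 1 (fun s => expR (f s)) (df * expR (f t)).
Proof.
move=> hf; have := @is_derive1_comp _ (@expR R) f t (expR (f t)) df (is_derive_expR _) hf.
by move/is_derive_eq; apply; rewrite mulrC.
Qed.

Lemma der_sum n (f : 'I_n -> R -> R) t (df : 'I_n -> R) :
  (forall i, is_derive t 1 (f i) (df i)) ->
  is_derive t 1 (fun s => \sum_i f i s) (\sum_i df i).
Proof.
move=> hf; rewrite (_ : (fun s => _) = \sum_i f i); last by apply/funext => s; rewrite fct_sumE.
exact: is_derive_sum.
Qed.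

Lemma derE f t (d e : R) : is_derive t 1 f d -> d = e -> is_derive t 1 f e.
Proof. by move=> + <-. Qed.

Lemma cont_ge0_sum n (f : 'I_n -> R -> R) : (forall i, cont_ge0 (f i)) ->
  cont_ge0 (fun s => \sum_i f i s).
Proof.
by move=> cf t; apply: cvg_sumr => i; exact: cf.
Qed.

Lemma cont_ge0_expR f : cont_ge0 f -> cont_ge0 (fun s => expR (f s)).
Proof.
move=> cf t; have ce : {for f t, continuous (@expR R)} by exact: continuous_expR.
apply: (@cvg_comp _ _ _ f (@expR R) _ (nbhs (f t))); [exact: cf|exact: ce].
Qed.

Lemma cont_ge0N f : cont_ge0 f -> cont_ge0 (fun t => - f t).
Proof. by move=> cf t; apply: cvgN; exact: cf. Qed.

(* H exp(- S) is estimated for S = K1 (Psi - P / kap); since P is nonnegative and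
   nonincreasing, S is bounded on both sides. *)
Lemma gronwall (H P Psi Phi H' P' Psi' Phi' : R -> R) (al K1 Ka kap Kb Psim Phim : R) :
  0 < al -> 0 <= K1 -> 0 <= Ka -> 0 < kap -> 0 <= Kb ->
  [/\ cont_ge0 H, cont_ge0 P, cont_ge0 Psi & cont_ge0 Phi] ->
  (forall t, 0 < t -> [/\ is_derive t 1 H (H' t), is_derive t 1 P (P' t),
     is_derive t 1 Psi (Psi' t) & is_derive t 1 Phi (Phi' t)]) ->
  (forall t, 0 <= t -> [/\ 0 <= H t, 0 <= P t, 0 <= Psi t <= Psim & 0 <= Phi t <= Phim]) ->
  (forall t, 0 < t -> [/\ P' t <= 0, 0 <= Phi' t &
     H' t <= - al * H t + K1 * (Psi' t - P' t / kap) * H t + Ka * Phi' t + Kb]) ->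
  forall t, 0 <= t ->
    H t <= expR (K1 * Psim + K1 * P 0 / kap) * (H 0 + Ka * Phim + Kb / al).
Proof.
move=> al0 K10 Ka0 kap0 Kb0 [cH cP cPsi cPhi] d b ineq t t0.
pose S s := K1 * (Psi s - kap^-1 * P s).
pose E1 := expR (K1 * P 0 / kap).
have cS : cont_ge0 S by apply: cont_ge0Z; apply: cont_ge0B => //; exact: cont_ge0Z.
have dS (s : R) : 0 < s -> is_derive s 1 S (K1 * (Psi' s - kap^-1 * P' s)).
  by move=> /d[_ ? ? _]; apply: derZ; apply: derB => //; exact: derZ.
have P_le (s : R) : 0 <= s -> P s <= P 0.
  move=> s0; apply: (derive_le0_nincr cP (f' := P')) => // r r0; first by have [] := d r r0.
  by have [] := ineq r r0.
have ik : 0 <= kap^-1 by rewrite invr_ge0 ltW.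
have S_ge (s : R) : 0 <= s -> - S s <= K1 * P 0 / kap.
  move=> s0; have [_ Ps /andP[Psis _] _] := b s s0.
  rewrite /S -mulrN -mulrA ler_wpM2l// (mulrC (P 0)).
  have := ler_wpM2l ik (P_le s s0); lra.
have S_le (s : R) : 0 <= s -> S s <= K1 * Psim.
  move=> s0; have [_ Ps /andP[_ Psis] _] := b s s0.
  by rewrite /S ler_wpM2l//; have := mulr_ge0 ik Ps; lra.
have E10 : 0 <= E1 by exact: expR_ge0.
pose J s := H s * expR (- S s).
(* E1 bounds exp(- S). Subtracting Ka Phi removes the integrable forcing and subtracting Kb / al the
   constant one; what is left decays at rate al, so F does not increase. *)
pose J2 s := J s - E1 * (Ka * Phi s + Kb / al).
pose F s := J2 s * expR (al * s).
have cJ : cont_ge0 J by apply: cont_ge0M => //; apply: cont_ge0_expR; exact: cont_ge0N.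
have cF : cont_ge0 F.
  apply: cont_ge0M; last exact: cont_ge0_expRM.
  apply: cont_ge0B => //; apply: cont_ge0Z; apply: cont_ge0D; last exact: cont_ge0_cst.
  exact: cont_ge0Z.
pose J2' s := (H' s * expR (- S s) + H s * (- (K1 * (Psi' s - kap^-1 * P' s)) * expR (- S s)))
   - E1 * (Ka * Phi' s + 0).
have dF (s : R) : 0 < s -> is_derive s 1 F (J2' s * expR (al * s) + J2 s * (al * expR (al * s))).
  move=> s0; have [dH _ _ dPhi] := d s s0; apply: (@derM J2 _ s); last exact: is_derive_expRM.
  exact: derB (derM dH (der_expR (derN (dS s s0)))) (derZ E1 (derD (derZ Ka dPhi) (derC (Kb / al) s))).
have F0 (s : R) : 0 < s -> J2' s * expR (al * s) + J2 s * (al * expR (al * s)) <= 0.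
  move=> s0; rewrite mulrA -mulrDl; apply: mulr_le0_ge0; last exact: expR_ge0.
  have [_ Phi0 h] := ineq s s0; have [H0 _ _ /andP[Phs _]] := b s (ltW s0).
  have e0 : 0 <= expR (- S s) by exact: expR_ge0.
  have h1 : expR (- S s) <= E1 by rewrite ler_expR S_ge// ltW.
  have h2 := ler_wpM2r e0 h.
  have h3 : (Ka * Phi' s + Kb) * expR (- S s) <= (Ka * Phi' s + Kb) * E1.
    by rewrite ler_wpM2l// addr_ge0// mulr_ge0.
  have h4 : 0 <= E1 * (al * (Ka * Phi s)).
    by apply: mulr_ge0 => //; apply: mulr_ge0; [exact: ltW|exact: mulr_ge0].
  have E : J2 s * al = al * (H s * expR (- S s)) - E1 * (al * (Ka * Phi s)) - E1 * Kb.
    by rewrite /J2 /J; field; rewrite gt_eqF.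
  rewrite E /J2'; move: h2 h3 h4; lra.
have Ft : F t <= F 0 by exact: (derive_le0_nincr cF dF F0).
have [H00 _ _ /andP[Ph00 _]] := b 0 (lexx _).
have J20 : F 0 <= E1 * H 0.
  rewrite /F mulr0 expR0 mulr1 /J2 /J.
  have : H 0 * expR (- S 0) <= H 0 * E1 by rewrite ler_wpM2l// ler_expR S_ge.
  have : 0 <= E1 * (Ka * Phi 0 + Kb / al).
    apply: mulr_ge0 => //; apply: addr_ge0; first exact: mulr_ge0.
    by rewrite divr_ge0// ltW.
  by lra.
(* F = J2 exp(al t) bounds J2 from above only where J2 is positive, by exp(al t) >= 1; elsewhere the
   claim is trivial. *)
have J2t : J2 t <= E1 * H 0.
  case: (leP (J2 t) 0) => J0; first by apply: (le_trans J0); exact: mulr_ge0.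
  apply: le_trans J20; apply: le_trans Ft; rewrite /F ler_peMr ?(ltW J0)//.
  by rewrite -expR0 ler_expR mulr_ge0// ltW.
have [_ _ _ /andP[_ Pht]] := b t t0.
have Jt : J t <= E1 * (H 0 + Ka * Phim + Kb / al).
  have : E1 * (Ka * Phi t) <= E1 * (Ka * Phim) by rewrite !ler_wpM2l.
  by move: J2t; rewrite /J2; lra.
have -> : H t = expR (S t) * J t.
  by rewrite /J mulrCA -expRD addrN expR0 mulr1.
rewrite expRD -mulrA; apply: ler_pM => //.
- by rewrite /J mulr_ge0 ?expR_ge0//; have [] := b t t0.
- by rewrite ler_expR S_le.
Qed.

End Derivatives.

(** * Time derivatives of the discrete forms *)

Section TimeDerivatives.
Context {R : realType}.
Context (N : nat) (xs : nat -> R) (part : is_partition N xs) (nu rho delta c0 c1 wd : R).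
Implicit Types (t : R).

(** [n] is N.+1 for vectors indexed by nodes and N for vectors indexed by cells. *)
Definition nodal_der n (c : R -> nat -> R) (c' : nat -> R) t : Prop :=
  forall j, (j < n)%N -> is_derive t 1 (fun r => c r j) (c' j).

Definition nodal_cont n (c : R -> nat -> R) : Prop := forall j, (j < n)%N -> cont_ge0 (fun r => c r j).

Lemma der_incr c c' t j : nodal_der N.+1 c c' t -> (j < N)%N ->
  is_derive t 1 (fun r => incr (c r) j) (incr c' j).
Proof. by move=> dc jN; apply: derB; apply: dc => //; exact: ltnW. Qed.

Lemma der_quad c c' d d' t j : nodal_der N.+1 c c' t -> nodal_der N.+1 d d' t -> (j < N)%N ->
  is_derive t 1 (fun r => quad (c r) (d r) j) (quad c' (d t) j + quad (c t) d' j).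
Proof.
move=> dc dd jN; have c0j := dc j (ltnW jN); have c1j := dc j.+1 jN.
have d0j := dd j (ltnW jN); have d1j := dd j.+1 jN.
have h := derM (derD (derD (derD (derM (derZ 2 c0j) d0j) (derM c0j d1j)) (derM c1j d0j))
   (derM (derZ 2 c1j) d1j)) (derC 6^-1 t).
by apply: (derE h); rewrite /quad/=; field.
Qed.

Lemma der_mass c c' d d' t : nodal_der N.+1 c c' t -> nodal_der N.+1 d d' t ->
  is_derive t 1 (fun r => mass N xs (c r) (d r)) (mass N xs c' (d t) + mass N xs (c t) d').
Proof.
move=> dc dd; have h (j : 'I_N) := derZ (cell xs j) (der_quad dc dd (ltn_ord j)).
by apply: (derE (der_sum h)); rewrite /mass -big_split/=; apply: eq_bigr => j _; ring.
Qed.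

Lemma der_stiff c c' t : nodal_der N.+1 c c' t ->
  is_derive t 1 (fun r => stiff N xs (c r) (c r)) (2 * stiff N xs (c t) c').
Proof.
move=> dc; have h (j : 'I_N) := derM (derM (der_incr dc (ltn_ord j)) (der_incr dc (ltn_ord j)))
  (derC (cell xs j)^-1 t).
by apply: (derE (der_sum h)); rewrite /stiff mulr_sumr; apply: eq_bigr => j _; ring.
Qed.

Lemma der_sgrad c c' s s' t : nodal_der N s s' t -> nodal_der N.+1 c c' t ->
  is_derive t 1 (fun r => sgrad N (s r) (c r)) (sgrad N s' (c t) + sgrad N (s t) c').
Proof.
move=> ds dc; have h (j : 'I_N) := derM (ds j (ltn_ord j)) (der_incr dc (ltn_ord j)).
by apply: (derE (der_sum h)); rewrite /sgrad -big_split.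
Qed.

Lemma der_snorm s s' t : nodal_der N s s' t ->
  is_derive t 1 (fun r => snorm N xs (s r) (s r)) (2 * snorm N xs (s t) s').
Proof.
move=> ds; have h (j : 'I_N) := derM (derZ (cell xs j) (ds j (ltn_ord j))) (ds j (ltn_ord j)).
by apply: (derE (der_sum h)); rewrite /snorm mulr_sumr; apply: eq_bigr => j _; ring.
Qed.

Lemma der_load c c' X X' t : nodal_der N X X' t -> nodal_der N.+1 c c' t ->
  is_derive t 1 (fun r => load N xs (X r) (c r)) (load N xs X' (c t) + load N xs (X t) c').
Proof.
move=> dX dc; have h (j : 'I_N) := derM (derM (dX j (ltn_ord j)) (der_incr dc (ltn_ord j)))
  (derC (cell xs j)^-1 t).
by apply: (derE (der_sum h)); rewrite /load -big_split/=; apply: eq_bigr => j _; ring.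
Qed.

Lemma der_Qf (k b : R) (W x : R -> R) (W' x' : R) t : k != 0 ->
  is_derive t 1 W W' -> is_derive t 1 x x' ->
  is_derive t 1 (fun r => Qf k b (W r) (x r)) (dQf k b (W t) W' (x t) x').
Proof.
move=> k0 dW dx; have dx2 := derM dx dx.
have h := derD (derZ ((k + b) / 2) dx2) (derZ (2 / (9 * k))
  (derD (derB (derZ (3 / 2) (derM (derM dW dW) dx2)) (derM dW (derM dx dx2))) (derZ (1 / 4) (derM dx2 dx2)))).
rewrite (_ : (fun r => Qf _ _ _ _) = (fun r => (k + b) / 2 * (x r * x r) + 2 / (9 * k) *
  (3 / 2 * (W r * W r * (x r * x r)) - W r * (x r * (x r * x r)) + 1 / 4 * (x r * x r * (x r * x r)))));
  last by apply/funext => r; rewrite /Qf; field.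
by apply: (derE h); rewrite /dQf /bcub/=; field.
Qed.

Lemma quad_contt c d j : nodal_cont N.+1 c -> nodal_cont N.+1 d -> (j < N)%N ->
  cont_ge0 (fun r => quad (c r) (d r) j).
Proof.
move=> dc dd jN; have c0j := dc j (ltnW jN); have c1j := dc j.+1 jN.
have d0j := dd j (ltnW jN); have d1j := dd j.+1 jN.
apply: cont_ge0M; last exact: cont_ge0_cst.
by do 3 ?apply: cont_ge0D; repeat (apply: cont_ge0M => //; try exact: cont_ge0_cst).
Qed.

Lemma mass_contt c d : nodal_cont N.+1 c -> nodal_cont N.+1 d ->
  cont_ge0 (fun r => mass N xs (c r) (d r)).
Proof. by move=> cc cd; apply: cont_ge0_sum => j; apply: cont_ge0Z; exact: quad_contt. Qed.

Lemma incr_contt c j : nodal_cont N.+1 c -> (j < N)%N -> cont_ge0 (fun r => incr (c r) j).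
Proof. by move=> cc jN; apply: cont_ge0B; apply: cc => //; exact: ltnW. Qed.

Lemma stiff_contt c d : nodal_cont N.+1 c -> nodal_cont N.+1 d ->
  cont_ge0 (fun r => stiff N xs (c r) (d r)).
Proof.
move=> cc cd; apply: cont_ge0_sum => j; apply: cont_ge0M; last exact: cont_ge0_cst.
by apply: cont_ge0M; exact: incr_contt.
Qed.

Lemma sgrad_contt s c : nodal_cont N s -> nodal_cont N.+1 c ->
  cont_ge0 (fun r => sgrad N (s r) (c r)).
Proof.
by move=> cs cc; apply: cont_ge0_sum => j; apply: cont_ge0M; [exact: cs|exact: incr_contt].
Qed.

Lemma snorm_contt s : nodal_cont N s -> cont_ge0 (fun r => snorm N xs (s r) (s r)).
Proof.
move=> cs; apply: cont_ge0_sum => j; apply: cont_ge0M; last exact: cs.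
by apply: cont_ge0Z; exact: cs.
Qed.

Lemma load_contt X c : nodal_cont N X -> nodal_cont N.+1 c ->
  cont_ge0 (fun r => load N xs (X r) (c r)).
Proof.
move=> cX cc; apply: cont_ge0_sum => j; apply: cont_ge0M; last exact: cont_ge0_cst.
by apply: cont_ge0M; [exact: cX|exact: incr_contt].
Qed.

Lemma cont_ge0X (f : R -> R) n : cont_ge0 f -> cont_ge0 (fun r => f r ^+ n).
Proof.
move=> cf; elim: n => [|n IH]; first by under eq_fun do rewrite expr0; exact: cont_ge0_cst.
by under eq_fun do rewrite exprS; exact: cont_ge0M.
Qed.

Lemma Qf_contt (k b : R) (W x : R -> R) : cont_ge0 W -> cont_ge0 x ->
  cont_ge0 (fun r => Qf k b (W r) (x r)).
Proof.
move=> cW cx; have cX n := @cont_ge0X x n cx; have cW2 := @cont_ge0X W 2 cW.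
rewrite /Qf; apply: cont_ge0D; first by apply: cont_ge0Z.
apply: cont_ge0Z; apply: cont_ge0D; last by apply: cont_ge0M => //; exact: cont_ge0_cst.
apply: cont_ge0B; last exact: cont_ge0M.
by apply: cont_ge0M => //; exact: cont_ge0Z.
Qed.

(** The differential equation for s turns the derivatives of the memory terms into [stiff], [sgrad]
    and [snorm], which is the form that [energy_total] estimates. *)
Lemma der_total_energy (A : R) V Vd th td s X Xd t : c0 != 0 -> c1 != 0 ->
  nodal_der N.+1 V Vd t -> nodal_der N.+1 th td t ->
  nodal_der N s (fun j => incr (th t) j / cell xs j - delta * s t j) t ->
  nodal_der N X Xd t ->
  is_derive t 1 (fun r => total_energy N xs nu rho c0 c1 wd A (V r) (th r) (s r) (X r))
    (A * (2 * mass N xs td (th t) + rho * (2 * sgrad N (s t) (th t) - 2 * delta * snorm N xs (s t) (s t)))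
      + dgrad_energy N xs nu rho delta c0 c1 wd (V t) (Vd 0%N) (Vd N) (th t) td (s t) (X t) Xd).
Proof.
move=> c00 c10 dV dth ds dX.
have m := der_mass dth dth; have sn := der_snorm ds.
have g := derD (derD (derD (derZ (nu / 2) (der_stiff dth)) (derZ rho (der_sgrad ds dth)))
   (derD (der_Qf wd c00 (dV 0%N isT) (dth 0%N isT)) (der_Qf wd c10 (dV N (ltnSn N)) (dth N (ltnSn N)))))
   (derN (der_load dX dth)).
apply: (derE (derD (derZ A (derD m (derZ rho sn))) g)).
have mC : mass N xs (th t) td = mass N xs td (th t).
  by apply: eq_bigr => j _; rewrite /quad; ring.
have snE : snorm N xs (s t) (fun j => incr (th t) j / cell xs j - delta * s t j) =
    sgrad N (s t) (th t) - delta * snorm N xs (s t) (s t).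
  rewrite /snorm /sgrad mulr_sumr -sumrB; apply: eq_bigr => j _.
  by field; rewrite gt_eqF// (cell_gt0 part).
have sgE : sgrad N (fun j => incr (th t) j / cell xs j - delta * s t j) (th t) =
    stiff N xs (th t) (th t) - delta * sgrad N (s t) (th t).
  by rewrite /stiff /sgrad mulr_sumr -sumrB; apply: eq_bigr => j _; ring.
by rewrite mC snE sgE /dgrad_energy; field.
Qed.

End TimeDerivatives.

(** * A bound for abstract error systems *)

Section ErrorSystem.
Context {R : realType}.
Context (nu rho delta c0 c1 wd M K3 : R).

(** All that the energy argument uses: V and Y are the nodal values of w and w_h, s and sY the
    memory integrals of the slopes of V - Y and of Y, X the residual, e stands for ||eta_t||^2 and
    xh for a bound of [lnorm X]. In [es_eq] the number r depends on phi, as it stands for - (eta_t,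
    phi). *)
Record error_system (N : nat) (xs : nat -> R) (V Vd Y Yd s sY X Xd : R -> nat -> R)
    (e : R -> R) (xh : R) : Prop := ErrorSystem {
  es_V : nodal_cont N.+1 V /\ forall t, 0 < t -> nodal_der N.+1 V (Vd t) t;
  es_Y : nodal_cont N.+1 Y /\ forall t, 0 < t -> nodal_der N.+1 Y (Yd t) t;
  es_X : nodal_cont N X /\ forall t, 0 < t -> nodal_der N X (Xd t) t;
  es_s : [/\ nodal_cont N s, forall j, (j < N)%N -> s 0 j = 0 &
    forall t, 0 < t -> nodal_der N s
      (fun j => incr (fun i => V t i - Y t i) j / cell xs j - delta * s t j) t];
  es_sY : [/\ nodal_cont N sY, forall j, (j < N)%N -> sY 0 j = 0 &
    forall t, 0 < t -> nodal_der N sY (fun j => incr (Y t) j / cell xs j - delta * sY t j) t];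
  es_eq : forall t phi, 0 < t -> exists2 r,
    error_eq N xs nu rho c0 c1 wd (V t) (fun j => V t j - Y t j) (fun j => Vd t j - Yd t j)
      (s t) (X t) r phi & r ^+ 2 <= e t * mass N xs phi phi;
  es_eqY : forall t phi, 0 < t -> error_eq N xs nu rho c0 c1 wd (fun=> 0) (fun j => - Y t j)
    (fun j => - Yd t j) (fun j => - sY t j) (fun=> 0) 0 phi;
  es_e : forall t, 0 < t -> 0 <= e t;
  es_VM : forall t j, 0 <= t -> (j <= N)%N -> `|V t j| <= M;
  es_VdM : forall t j, 0 < t -> (j <= N)%N -> `|Vd t j| <= M;
  es_VsM : forall t j, 0 < t -> (j < N)%N -> `|incr (V t) j| <= M * cell xs j;
  es_lX : forall t, 0 <= t -> lnorm N xs (X t) <= xh;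
  es_lXd : forall t, 0 < t -> lnorm N xs (Xd t) <= K3 * (e t + xh) }.

Lemma total_energy_contt N xs A (V th s X : R -> nat -> R) : nodal_cont N.+1 V -> nodal_cont N.+1 th ->
  nodal_cont N s -> nodal_cont N X ->
  cont_ge0 (fun r => total_energy N xs nu rho c0 c1 wd A (V r) (th r) (s r) (X r)).
Proof.
move=> cV cth cs cX; rewrite /total_energy /grad_energy; apply: cont_ge0D.
  apply: cont_ge0Z; apply: cont_ge0D; first exact: mass_contt.
  by apply: cont_ge0Z; exact: snorm_contt.
apply: cont_ge0B; last exact: load_contt.
apply: cont_ge0D.
  apply: cont_ge0D; apply: cont_ge0Z; [exact: stiff_contt|exact: sgrad_contt].
by apply: cont_ge0D; apply: Qf_contt; [exact: cV|exact: cth|exact: cV|exact: cth].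
Qed.

(** [Psi] and [Phi] are primitives of |V|^2 and e; only the bounds Psim and Phim of these integrals
    enter the result, never t, which makes it uniform in time. *)
Lemma energy_bound : [/\ 0 < nu, 0 < rho, 0 < delta, 0 < c0 & 0 < c1] -> 0 <= wd -> 0 <= M ->
  0 <= K3 -> exists Ke Kc : R, [/\ 0 <= Ke, 0 <= Kc &
  forall N xs V Vd Y Yd s sY X Xd e xh (Psi Phi : R -> R) (Psim Phim b0 Q0 : R),
    is_partition N xs -> error_system N xs V Vd Y Yd s sY X Xd e xh ->
    cont_ge0 Psi -> cont_ge0 Phi ->
    (forall t : R, 0 < t -> is_derive t 1 Psi (bsq N xs (V t)) /\ is_derive t 1 Phi (e t)) ->
    (forall t, 0 <= t -> 0 <= Psi t <= Psim /\ 0 <= Phi t <= Phim) ->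
    bsq N xs (fun j => V 0 j - Y 0 j) <= b0 -> mass N xs (Y 0) (Y 0) <= Q0 ->
    forall t, 0 <= t -> bsq N xs (fun j => V t j - Y t j) <=
      Kc * expR (Ke * (Psim + Q0)) * (b0 + b0 ^+ 2 + Phim + xh)].
Proof.
move=> par wd0 M0 K30; have [nu0 rho0 delta0 c00 c10] := par.
have [A [al [K1 [K2 [k2 [K4 [K5 [[al0 K10 K20 k20 [K40 K50]] HE]]]]]]]] := energy_total par wd0 M0.
pose kap := Num.min (nu / 2) (Num.min (c0 / 2) (Num.min c1 (2 * rho * delta))).
have kap0 : 0 < kap by rewrite !lt_min !divr_gt0// c10 !mulr_gt0.
pose Ka := K2 * (1 + K3).
have Ka0 : 0 <= Ka by rewrite mulr_ge0// addr_ge0.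
have kk : 0 <= K1 / kap by rewrite divr_ge0// ltW.
have n4 : 0 <= 4 / nu by rewrite divr_ge0// ltW.
have Kal : 0 <= Ka / al by rewrite divr_ge0// ltW.
pose Kc0 := K4 + K5 + 4 / nu + Ka + Ka / al.
exists (K1 + K1 / kap), (Kc0 / k2); split.
- exact: addr_ge0.
- by rewrite divr_ge0 ?(ltW k20)// /Kc0 !addr_ge0.
move=> N xs V Vd Y Yd s sY X Xd e xh Psi Phi Psim Phim b0 Q0 part es cPsi cPhi dPP bPP hb0 hQ0 t t0.
have [HE1 HE2] := HE N xs part.
have [cV dV] := es_V es; have [cY dY] := es_Y es; have [cX dX] := es_X es.
have [cs s0 ds] := es_s es; have [csY sY0 dsY] := es_sY es.
pose th r j := V r j - Y r j; pose td r j := Vd r j - Yd r j.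
have cth : nodal_cont N.+1 th by move=> j jN; apply: cont_ge0B; [exact: cV|exact: cY].
have dth (r : R) : 0 < r -> nodal_der N.+1 th (td r) r.
  by move=> r0 j jN; apply: derB; [exact: dV|exact: dY].
pose H r := total_energy N xs nu rho c0 c1 wd A (V r) (th r) (s r) (X r) + 2 / nu * xh.
pose H' r := A * (2 * mass N xs (td r) (th r) + rho * (2 * sgrad N (s r) (th r) - 2 * delta * snorm N xs (s r) (s r)))
   + dgrad_energy N xs nu rho delta c0 c1 wd (V r) (Vd r 0%N) (Vd r N) (th r) (td r) (s r) (X r) (Xd r).
have cH : cont_ge0 H by apply: cont_ge0D; [exact: total_energy_contt|exact: cont_ge0_cst].
have dH (r : R) : 0 < r -> is_derive r 1 H (H' r).
  move=> r0; apply: (derE (derD (der_total_energy part nu rho wd A _ _ (dV r r0) (dth r r0) (ds r r0) (dX r r0)) (derC _ r))).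
  - by rewrite gt_eqF.
  - by rewrite gt_eqF.
  - by rewrite addr0.
(* The L^2 energy of the scheme: its decay at rate at least kap |w_h|^2 bounds the time integral of
   |w_h|^2 by P(0) / kap. *)
pose P r := mass N xs (Y r) (Y r) + rho * snorm N xs (sY r) (sY r).
pose P' r := 2 * mass N xs (Yd r) (Y r) + rho * (2 * sgrad N (sY r) (Y r) - 2 * delta * snorm N xs (sY r) (sY r)).
have cP : cont_ge0 P.
  by apply: cont_ge0D; [exact: mass_contt|apply: cont_ge0Z; exact: snorm_contt].
have dP (r : R) : 0 < r -> is_derive r 1 P (P' r).
  move=> r0; apply: (derE (derD (der_mass xs (dY r r0) (dY r r0)) (derZ rho (der_snorm xs (dsY r r0))))).
  have -> : mass N xs (Y r) (Yd r) = mass N xs (Yd r) (Y r).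
    by apply: eq_bigr => j _; rewrite /quad; ring.
  have -> : snorm N xs (sY r) (fun j => incr (Y r) j / cell xs j - delta * sY r j) =
      sgrad N (sY r) (Y r) - delta * snorm N xs (sY r) (sY r).
    rewrite /snorm /sgrad mulr_sumr -sumrB; apply: eq_bigr => j _.
    by field; rewrite gt_eqF// (cell_gt0 part).
  by rewrite /P'; ring.
have P0 (r : R) : 0 <= P r by rewrite /P addr_ge0 ?mulr_ge0 ?(mass_ge0 part) ?(snorm_ge0 part)// ltW.
have P'le (r : R) : 0 < r -> P' r <= - kap * bsq N xs (Y r).
  (* [energy1_diff] for V = 0 and theta = - w_h; the signs cancel in every bilinear term. *)
  move=> r0; have := energy1_diff part par wd0 (es_eqY es (fun j => - Y r j) r0) (lexx 0).
  rewrite expr0n/= !mul0r => /(_ (lexx _)).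
  have -> : mass N xs (fun j => - Yd r j) (fun j => - Y r j) = mass N xs (Yd r) (Y r).
    by apply: eq_bigr => j _; rewrite /quad; ring.
  have -> : sgrad N (fun j => - sY r j) (fun j => - Y r j) = sgrad N (sY r) (Y r).
    by apply: eq_bigr => j _; rewrite /incr; ring.
  have -> : snorm N xs (fun j => - sY r j) (fun j => - sY r j) = snorm N xs (sY r) (sY r).
    by apply: eq_bigr => j _; ring.
  have -> : bsq N xs (fun j => - Y r j) = bsq N xs (Y r).
    rewrite /bsq !sqrrN; congr (_ + _ + _).
    by apply: eq_bigr => j _; rewrite /incr; ring.
  have -> : bsq N xs (fun=> 0 : R) = 0.
    rewrite /bsq expr0n/= !addr0 /stiff big1// => j _.
    by rewrite /incr subrr !mul0r.
  have -> : lnorm N xs (fun=> 0 : R) = 0.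
    by rewrite /lnorm big1// => j _; rewrite expr0n/= mul0r.
  rewrite -/kap !(mulr0, mul0r, addr0) -/(P' r) => h; apply: (le_trans h).
  rewrite mulrDr gerDl mulNr oppr_le0.
  by apply: mulr_ge0; [exact: ltW|exact: snorm_ge0].
have xh0 : 0 <= xh by apply: le_trans (es_lX es (lexx 0)); exact: lnorm_ge0.
have Hb r : 0 <= r -> k2 * (bsq N xs (th r) + snorm N xs (s r) (s r)) <= H r /\
    H r <= K4 * (bsq N xs (th r) + snorm N xs (s r) (s r)) + K5 * bsq N xs (th r) ^+ 2 + 4 / nu * xh.
  by move=> r0; apply: HE1; [move=> j jN; exact: (es_VM es)|exact: (es_lX es)].
have thb r : 0 <= r -> k2 * bsq N xs (th r) <= H r.
  move=> r0; have [h _] := Hb r r0; apply: le_trans h.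
  by rewrite ler_wpM2l ?(ltW k20)// lerDl (snorm_ge0 part).
have H0 r : 0 <= r -> 0 <= H r.
  move=> r0; apply: le_trans (thb r r0).
  by apply: mulr_ge0; [exact: ltW|exact: bsq_ge0].
have H'le r : 0 < r -> H' r <= - al * H r + K1 * (bsq N xs (V r) - P' r / kap) * H r + Ka * e r + Ka * xh.
  move=> r0; have [r1 eq1 re1] := es_eq es (th r) r0; have [r2 eq2 re2] := es_eq es (td r) r0.
  have := HE2 _ _ _ _ _ _ _ (Xd r) r1 r2 (e r) xh eq1 eq2 (es_e es r0) re1 re2
    (fun j => es_VM es (ltW r0)) (fun j => es_VsM es r0) (es_VdM es r0 (leq0n N)) (es_VdM es r0 (leqnn N))
    (es_lX es (ltW r0)).
  cbv zeta; rewrite -/(H r) -/(H' r) => h; apply: (le_trans h).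
  have -> : (fun j => V r j - (V r j - Y r j)) = Y r by apply/funext => j; ring.
  have h1 : bsq N xs (Y r) <= - P' r / kap.
    by rewrite ler_pdivlMr// mulrC; have := P'le r r0; rewrite mulNr lerNr.
  have h2 : K1 * (bsq N xs (V r) + bsq N xs (Y r)) * H r <= K1 * (bsq N xs (V r) - P' r / kap) * H r.
    by rewrite ler_wpM2r ?(H0 _ (ltW r0))// ler_wpM2l// lerD2l -mulNr.
  have h3 : K2 * (e r + xh + lnorm N xs (Xd r)) <= Ka * e r + Ka * xh.
    rewrite -mulrDr /Ka -mulrA ler_wpM2l// mulrDl mul1r lerD2l; exact: (es_lXd es).
  by move: h2 h3; clear; lra.
have := @gronwall R H P Psi Phi H' P' (fun r => bsq N xs (V r)) e al K1 Ka kap (Ka * xh) Psim Phim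
  al0 K10 Ka0 kap0 (mulr_ge0 Ka0 xh0) (And4 cH cP cPsi cPhi) _ _ _ t t0.
have G1 (r : R) : 0 < r -> [/\ is_derive r 1 H (H' r), is_derive r 1 P (P' r),
     is_derive r 1 Psi (bsq N xs (V r)) & is_derive r 1 Phi (e r)].
  by move=> r0; have [? ?] := dPP r r0; split => //; [exact: dH|exact: dP].
have G2 (r : R) : 0 <= r -> [/\ 0 <= H r, 0 <= P r, 0 <= Psi r <= Psim & 0 <= Phi r <= Phim].
  by move=> r0; have [? ?] := bPP r r0; split => //; exact: H0.
have G3 (r : R) : 0 < r -> [/\ P' r <= 0, 0 <= e r &
     H' r <= - al * H r + K1 * (bsq N xs (V r) - P' r / kap) * H r + Ka * e r + Ka * xh].
  move=> r0; split; [|exact: (es_e es)|exact: H'le].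
  apply: (le_trans (P'le r r0)); rewrite mulNr oppr_le0.
  by apply: mulr_ge0; [exact: ltW|exact: bsq_ge0].
move=> /(_ G1 G2 G3) fin.
have [/andP[Ps0 Ps1] /andP[Ph0 Ph1]] := bPP 0 (lexx _).
have Psim0 : 0 <= Psim by exact: le_trans Ps1.
have Phim0 : 0 <= Phim by exact: le_trans Ph1.
have b00 : 0 <= b0 by apply: le_trans hb0; exact: bsq_ge0.
have sn0 (q : R -> nat -> R) : (forall j, (j < N)%N -> q 0 j = 0) -> snorm N xs (q 0) (q 0) = 0.
  by move=> q0; rewrite /snorm big1// => j _; rewrite q0// mulr0.
have PQ : P 0 <= Q0 by rewrite /P sn0// mulr0 addr0.
have HH0 : H 0 <= K4 * b0 + K5 * b0 ^+ 2 + 4 / nu * xh.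
  have [_ h] := Hb 0 (lexx _); apply: (le_trans h); rewrite sn0// addr0 lerD2r.
  apply: lerD; rewrite ler_wpM2l// ler_pXn2r ?nnegrE//; exact: bsq_ge0.
have e1 : expR (K1 * Psim + K1 * P 0 / kap) <= expR ((K1 + K1 / kap) * (Psim + Q0)).
  rewrite ler_expR.
  have u1 : K1 / kap * P 0 <= K1 / kap * Q0 by rewrite ler_wpM2l.
  have u2 : 0 <= K1 / kap * Psim by rewrite mulr_ge0.
  have u3 : 0 <= K1 * Q0 by rewrite mulr_ge0// (le_trans (P0 0)).
  have -> : K1 * P 0 / kap = K1 / kap * P 0 by ring.
  by move: u1 u2 u3; clear; lra.
have e2 : H 0 + Ka * Phim + Ka * xh / al <= Kc0 * (b0 + b0 ^+ 2 + Phim + xh).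
  have -> : Kc0 * (b0 + b0 ^+ 2 + Phim + xh) = K4 * b0 + K5 * b0 ^+ 2 + 4 / nu * xh + Ka * Phim + Ka * xh / al
    + (K4 * (b0 ^+ 2 + Phim + xh) + K5 * (b0 + Phim + xh) + 4 / nu * (b0 + b0 ^+ 2 + Phim)
       + Ka * (b0 + b0 ^+ 2 + xh) + Ka / al * (b0 + b0 ^+ 2 + Phim)) by rewrite /Kc0; ring.
  rewrite !addrA; have b02 := sqr_ge0 b0.
  have : 0 <= K4 * (b0 ^+ 2 + Phim + xh) by rewrite mulr_ge0 ?addr_ge0.
  have : 0 <= K5 * (b0 + Phim + xh) by rewrite mulr_ge0 ?addr_ge0.
  have : 0 <= 4 / nu * (b0 + b0 ^+ 2 + Phim) by rewrite mulr_ge0 ?addr_ge0.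
  have : 0 <= Ka * (b0 + b0 ^+ 2 + xh) by rewrite mulr_ge0 ?addr_ge0.
  have : 0 <= Ka / al * (b0 + b0 ^+ 2 + Phim) by rewrite mulr_ge0 ?addr_ge0.
  by move: HH0; clear; lra.
have e3 : H t <= expR ((K1 + K1 / kap) * (Psim + Q0)) * (Kc0 * (b0 + b0 ^+ 2 + Phim + xh)).
  apply: (le_trans fin); apply: ler_pM => //.
  apply: addr_ge0; last by apply: divr_ge0; [exact: mulr_ge0|exact: ltW].
  by apply: addr_ge0; [exact: H0|exact: mulr_ge0].
have := le_trans (thb t t0) e3; rewrite -ler_pdivlMl// => h; apply: (le_trans h).
by rewrite le_eqVlt; apply/orP; left; apply/eqP; rewrite /Kc0; ring.
Qed.
End ErrorSystem.

(** * Interpolation error and consistency *)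

Section InterpIntegrals.
Context {R : realType}.
Local Notation mu := (@lebesgue_measure R).
Local Notation I01 := (`]0, 1[%classic : set R).
Context (N : nat) (xs : nat -> R) (part : is_partition N xs).
Implicit Types (c d V : nat -> R) (x F : R) (f g phi : R -> R).
Local Notation interp := (interp N xs).
Local Notation cell := (cell xs).
Local Notation slope := (slope xs).

Lemma cell_itv j x : (j < N)%N -> xs j < x < xs j.+1 -> 0 < x < 1.
Proof.
move=> jN /andP[x1 x2]; have /andP[? _] := partition_itv part (ltnW jN).
by have /andP[_ ?] := partition_itv part jN; apply/andP; split; lra.
Qed.

Lemma interp_within a b c : {within `[a, b], continuous (interp c)}.
Proof. by apply: continuous_subspaceT; exact: continuous_interp. Qed.

Lemma interp_bound c F x : (forall j, (j <= N)%N -> `|c j| <= F) -> 0 <= x <= 1 ->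
  `|interp c x| <= F.
Proof.
move=> cF /(partition_cell part)[j jN xj]; have h0 := cell_gt0 part jN.
rewrite (interp_cell part c jN xj).
pose l := (x - xs j) / cell j.
have -> : c j + slope c j * (x - xs j) = (1 - l) * c j + l * c j.+1.
  by rewrite /slope /l; field; rewrite gt_eqF.
move/andP: xj => [x1 x2].
have l0 : 0 <= l by rewrite divr_ge0 ?(ltW h0)// subr_ge0.
have l1 : l <= 1 by rewrite ler_pdivrMr// mul1r /cell; lra.
have := cF j (ltnW jN); have := cF j.+1 jN.
rewrite !ler_norml => /andP[u1 u2] /andP[v1 v2]; apply/andP; split; nra.
Qed.

Lemma interp_one x : 0 <= x <= 1 -> interp (fun=> 1) x = 1.
Proof.
move=> /(partition_cell part)[j jN xj].
by rewrite (interp_cell part _ jN xj) /slope subrr !mul0r addr0.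
Qed.

Lemma rint_quad c d j : (j < N)%N ->
  rint (xs j) (xs j.+1) (fun x => interp c x * interp d x) = cell j * quad c d j.
Proof.
move=> jN; have h0 := cell_gt0 part jN; have lt : xs j <= xs j.+1 by move: h0; rewrite /cell; lra.
pose a := c j; pose b := slope c j; pose a' := d j; pose b' := slope d j.
rewrite (@eq_rint _ _ _ _ (fun x => (a + b * (x - xs j)) * (a' + b' * (x - xs j)))); last first.
  by move=> x /andP[x1 x2]; rewrite !(interp_cell part _ jN)// !ltW.
pose G (x : R) := a * a' * (x - xs j) + (a * b' + b * a') / 2 * ((x - xs j) * (x - xs j))
   + b * b' / 3 * ((x - xs j) * ((x - xs j) * (x - xs j))).
have cl : continuous (fun x : R => x - xs j).
  by move=> x; apply: cvgB; [exact: cvg_id|exact: cvg_cst].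
have cL (a0 b0 : R) : continuous (fun x : R => a0 + b0 * (x - xs j)).
  by move=> x; apply: cvgD; [exact: cvg_cst|apply: cvgM; [exact: cvg_cst|exact: cl]].
have dl x : is_derive x (1 : R) (fun x : R => x - xs j) 1.
  by apply: (derE (derB (is_derive_id x 1) (derC (xs j) x))); rewrite subr0.
transitivity (G (xs j.+1) - G (xs j)); first apply: rint_FTC => //; last first.
- rewrite /G subrr !(mulr0, addr0, subr0) /b /b' /slope /quad /cell.
  by rewrite -/a -/a'; field; rewrite gt_eqF.
- apply: continuous_subspaceT => x; have c2 := cvgM (cl x) (cl x).
  apply: cvgD; [apply: cvgD|]; apply: cvgM; try exact: cvg_cst; [exact: cl|exact: c2|].
  by apply: cvgM; [exact: cl|exact: c2].
- move=> x _; have h := derD (derD (derZ (a * a') (dl x)) (derZ ((a * b' + b * a') / 2) (derM (dl x) (dl x))))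
    (derZ (b * b' / 3) (derM (dl x) (derM (dl x) (dl x)))).
  by apply: (derE h); field.
- by apply: continuous_subspaceT => x; apply: cvgM; exact: cL.
Qed.

Lemma rint_interp c j : (j < N)%N ->
  rint (xs j) (xs j.+1) (interp c) = cell j * ((c j + c j.+1) / 2).
Proof.
move=> jN; rewrite (@eq_rint _ _ _ _ (fun x => interp c x * interp (fun=> 1) x)).
  by rewrite rint_quad//; congr (_ * _); rewrite /quad; field.
move=> x /(cell_itv jN)/andP[x0 x1].
by rewrite interp_one ?mulr1// !ltW.
Qed.

Lemma inner_mass c d : inner (interp c) (interp d) = mass N xs c d.
Proof.
rewrite innerE (rint_cells part).
  by apply: eq_bigr => j _; exact: rint_quad.
apply: rintegrable_cont => x; apply: cvgM; exact: interp_within.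
Qed.

Lemma interp_nodes c j : (j < N)%N -> slope (interp c \o xs) j = slope c j.
Proof. by move=> jN; apply: (eq_slope xs jN) => i iN /=; rewrite interp_node. Qed.

(** The derivative of [interp c] is constant on cells, and the integrals of f_x over cells are nodal
    increments: f and its interpolant cannot be told apart here. *)
Lemma inner_wD_interp f c : sobolev 1 f ->
  inner (wD f) (wD (interp c)) = stiff N xs (fun j => cont_rep f (xs j)) c.
Proof.
move=> f1; have [_ _ fE] := sobolev1_rep f1; have [_ _ gL] := f1.
rewrite (inner_wD_pl part); [|exact: L2_rintegrable|exact: pl_interp].
apply: eq_bigr => j _; have jN := ltn_ord j; rewrite interp_nodes//.
have h0 := cell_gt0 part jN.
rewrite -fE; last 3 first.
- by have /andP[] := partition_itv part (ltnW jN).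
- by move: h0; rewrite /cell; lra.
- by have /andP[] := partition_itv part jN.
by rewrite /slope /incr; ring.
Qed.

(** Written in the same form as [C1_pair_pl_ibp], so that subtracting the two leaves only cell
    integrals of w - V; [conv_ibp] does this for the halved squares. *)
Lemma conv_one_ibp V c : conv N V (fun=> 1) c =
  V N * c N - V 0%N * c 0%N - \sum_(j < N) slope c j * rint (xs j) (xs j.+1) (interp V).
Proof.
rewrite -(sum_incr N (fun j => V j * c j)) -sumrB; apply: eq_bigr => j _.
have h0 := cell_gt0 part (ltn_ord j).
by rewrite rint_interp// /slope /quad /incr; field; rewrite gt_eqF.
Qed.

Lemma conv_ibp V c : conv N V V c =
  V N ^+ 2 / 2 * c N - V 0%N ^+ 2 / 2 * c 0%N
  - \sum_(j < N) slope c j * rint (xs j) (xs j.+1) (fun x => interp V x ^+ 2 / 2).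
Proof.
rewrite -(sum_incr N (fun j => V j ^+ 2 / 2 * c j)) -sumrB; apply: eq_bigr => j _.
have h0 := cell_gt0 part (ltn_ord j).
rewrite (@eq_rint _ _ _ _ (fun x => 2^-1 * (interp V x * interp V x))); last first.
  by move=> x _; rewrite expr2 mulrC.
rewrite rintZ; last by apply: rintegrable_cont => x; apply: cvgM; exact: interp_within.
by rewrite rint_quad// /slope /quad /incr; field; rewrite gt_eqF.
Qed.

End InterpIntegrals.

(** * Differences of functions of H^1 *)

Section Difference.
Context {R : realType}.
Local Notation mu := (@lebesgue_measure R).
Local Notation I01 := (`]0, 1[%classic : set R).
Implicit Types (f g F k : R -> R).

Lemma L2B f g : L2 f -> L2 g -> L2 (f \- g).
Proof.
move=> /L2P[mf f2] /L2P[mg g2]; apply/L2P; split; first exact: measurable_funB.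
apply: (@rintegrable_le _ _ _ _ (fun x => 2 * f x ^+ 2 + 2 * g x ^+ 2)).
- by apply: measurable_funX; exact: measurable_funB.
- by apply: rintegrableD; exact: rintegrableZ.
- move=> x _; rewrite normrX /= real_normK ?num_real//.
  by have := sqr_ge0 (f x + g x); lra.
Qed.

Lemma weak_derivB f g F k : rintegrable 0 1 f -> rintegrable 0 1 g ->
  rintegrable 0 1 F -> rintegrable 0 1 k ->
  weak_deriv I01 f F -> weak_deriv I01 g k -> weak_deriv I01 (f \- g) (F \- k).
Proof.
move=> fi gi Fi ki [_ _ wf] [_ _ wg]; split.
- apply: open_integrable_locally; first exact: interval_open.
  exact: rintegrableB.
- apply: open_integrable_locally; first exact: interval_open.
  exact: rintegrableB.
move=> th tth; have [_ cth cdth dth [M thM]] := test_function_01 tth.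
have m1 : measurable_fun I01 th by apply: continuous_measurable_itv.
have m2 : measurable_fun I01 (derive1 th) by apply: continuous_measurable_itv.
have i1 h : rintegrable 0 1 h -> rintegrable 0 1 (fun x => h x * derive1 th x).
  by move=> hi; apply: (rintegrableM_bounded hi m2) => x _; have [_] := thM x; exact.
have i2 h : rintegrable 0 1 h -> rintegrable 0 1 (fun x => h x * th x).
  by move=> hi; apply: (rintegrableM_bounded hi m1) => x _; have [+ _] := thM x; exact.
have := wf th tth; have := wg th tth => eg ef.
rewrite -/(rint 0 1 _) -/(rint 0 1 _).
rewrite (@eq_rint _ _ _ _ (fun x => f x * derive1 th x - g x * derive1 th x)); last first.
  by move=> x _ /=; ring.
rewrite rintB; [|exact: i1|exact: i1].
rewrite [in RHS](@eq_rint _ _ _ _ (fun x => F x * th x - k x * th x)); last first.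
  by move=> x _ /=; ring.
rewrite rintB; [|exact: i2|exact: i2].
by rewrite /rint ef eg; ring.
Qed.

Lemma sobolev1B f g : sobolev 1 f -> sobolev 1 g ->
  [/\ sobolev 1 (f \- g), ae_eq mu I01 (wD (f \- g)) (wD f \- wD g) &
    forall x, 0 <= x <= 1 -> cont_rep (f \- g) x = cont_rep f x - cont_rep g x].
Proof.
move=> f1 g1; have [cf ff fE] := sobolev1_rep f1; have [cg gg gE] := sobolev1_rep g1.
have [fL wf DfL] := f1; have [gL wg DgL] := g1.
have wfg : weak_deriv I01 (f \- g) (wD f \- wD g).
  by apply: weak_derivB => //; exact: L2_rintegrable.
have w2 : weak_deriv I01 (f \- g) (wD (f \- g)) by apply: getPex; exists (wD f \- wD g).
have cfg : {within `[0, 1], continuous (fun x => cont_rep f x - cont_rep g x)}.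
  by move=> x; apply: cvgB; [exact: cf|exact: cg].
have ffg : ae_eq mu I01 (f \- g) (fun x => cont_rep f x - cont_rep g x).
  by apply: ae_imp (ae_and ff gg) => x [h1 h2] x01 /=; rewrite h1// h2.
have fgi := rintegrable_cont cfg.
have mfg : measurable_fun I01 (f \- g).
  by have [/L2P[? _] /L2P[? _]] := (fL, gL); exact: measurable_funB.
have u1 := (weak_deriv_ae _ fgi mfg ffg).1 wfg; have u2 := (weak_deriv_ae _ fgi mfg ffg).1 w2.
have aeD := weak_deriv_unique cfg u2 u1.
split => //; last exact: cont_rep_eq.
split => //; first exact: L2B.
have /L2P[m3 i3] := L2B DfL DgL.
have [_ [m4 _ _] _] := w2.
apply/L2P; split=> //; apply: ae_eq_rintegrable i3; first exact: measurable_funX.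
by apply: ae_imp aeD => x h x01; rewrite h.
Qed.

End Difference.

(** * Integrals depending on time *)

Section TimeIntegrals.
Context {R : realType}.
Local Notation mu := (@lebesgue_measure R).
Implicit Types (f df : R -> R -> R) (a b t k : R).

Lemma rint_der_param f df a b t k : 0 < t ->
  (forall s : R, 0 < s -> rintegrable a b (f s)) ->
  (forall s x : R, 0 < s -> a < x < b -> is_derive s 1 (f ^~ x) (df s x)) ->
  (forall s x : R, 0 < s -> a < x < b -> `|df s x| <= k) ->
  is_derive t 1 (fun s => rint a b (f s)) (rint a b (df t)).
Proof.
move=> t0 fi fd dk.
have Ia : (`]0, (t + 1)[%classic : set R) t by rewrite /= in_itv/= t0 ltrDl ltr01.
have intf s : (`]0, (t + 1)[%classic : set R) s -> mu.-integrable `]a, b[ (EFin \o f s).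
  by rewrite /= in_itv/= => /andP[s0 _]; exact: fi.
have derf s x : (`]0, (t + 1)[%classic : set R) s -> (`]a, b[%classic : set R) x -> derivable (f ^~ x) s 1.
  by rewrite /= !in_itv/= => /andP[s0 _] xab; have [] := fd s x s0 xab.
have d1E s x : 0 < s -> a < x < b -> partial1of2 f s x = df s x.
  by move=> s0 xab; rewrite partial1of2E; have [_ ->] := fd s x s0 xab.
have Gub s x : (`]0, (t + 1)[%classic : set R) s -> (`]a, b[%classic : set R) x -> `|partial1of2 f s x| <= `|k|.
  rewrite /= !in_itv/= => /andP[s0 _] xab; rewrite d1E// (le_trans (dk s x s0 xab))//; exact: ler_norm.
have intG : mu.-integrable `]a, b[ (EFin \o (fun=> `|k|)) by exact: rintegrable_cst.
have h1 := @derivable_under_integral _ _ _ mu f _ (measurable_itv `]a, b[) _ _ _ Ia intf derf (fun=> `|k|) (fun=> normr_ge0 k) intG Gub.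
have h2 := @differentiation_under_integral _ _ _ mu f _ (measurable_itv `]a, b[) _ _ _ Ia intf derf (fun=> `|k|) (fun=> normr_ge0 k) intG Gub.
apply: DeriveDef => //.
rewrite -derive1E [LHS]h2; apply: eq_rint => x xab; exact: d1E.
Qed.

Lemma rint_cont_param f a b t k : 0 < t ->
  (forall s : R, 0 < s -> rintegrable a b (f s)) ->
  (forall s x : R, 0 < s -> a < x < b -> {for s, continuous (f ^~ x)}) ->
  (forall s x : R, 0 < s -> a < x < b -> `|f s x| <= k) ->
  {for t, continuous (fun s => rint a b (f s))}.
Proof.
move=> t0 fi fc fk.
have Ia : t \in (`]0, (t + 1)[%classic : set R) by rewrite inE /= in_itv/= t0 ltrDl ltr01.
have intf s : (`]0, (t + 1)[%classic : set R) s -> mu.-integrable `]a, b[ (EFin \o f s).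
  by rewrite /= in_itv/= => /andP[s0 _]; exact: fi.
have intG : mu.-integrable `]a, b[ (EFin \o (fun=> k)) by exact: rintegrable_cst.
apply: (@continuity_under_integral _ _ _ mu f _ (measurable_itv `]a, b[) 0 (t + 1) intf _ _ intG) => //.
- apply: aeW => x; rewrite /= in_itv/= => xab s; rewrite inE/= in_itv/= => /andP[s0 _].
  exact: fc.
- by move=> s; rewrite /= in_itv/= => /andP[s0 _]; apply: aeW => x; rewrite /= in_itv/= => xab; exact: fk.
Qed.

(** g is continuous and bounded on (0,oo) and nothing is known at 0; boundedness gives integrability
    up to 0 and continuity of the primitive there. *)
Lemma rint_primitive (g : R -> R) k : (forall t : R, 0 < t -> {for t, continuous g}) ->
  (forall t, 0 < t -> `|g t| <= k) ->
  (forall t, rintegrable 0 t g) /\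
  cont_ge0 (fun t => rint 0 t g) /\
  forall t : R, 0 < t -> is_derive t 1 (fun t => rint 0 t g) (g t).
Proof.
move=> cg gk.
have gi t : rintegrable 0 t g.
  apply: (@rintegrable_bounded _ _ _ _ k); last by move=> x /andP[x0 _]; exact: gk.
  apply: open_continuous_measurable_fun; first exact: interval_open.
  by move=> x; rewrite inE/= in_itv/= => /andP[x0 _]; exact: cg.
split=> //.
have d (t : R) : 0 < t -> is_derive t 1 (fun t => rint 0 t g) (g t).
  move=> t0; apply: (@antideriv_is_derive _ 0 (t + 1) _ g) => //.
  - by rewrite t0 ltrDl ltr01.
  - move=> s r s0 sr _; rewrite (rint_split (ltW s0) sr)//; ring.
  - exact: cg.
split => //; apply: cont_ge0_of_derive d _ => e e0.
have k0 : 0 <= k by apply: le_trans (gk 1 ltr01).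
exists (e / (k + 1)); first by rewrite divr_gt0// ltr_wpDl.
move=> s /andP[s0 sd]; rewrite [rint 0 0 g]rint_nil// subr0.
apply: (le_trans (norm_rint_le s0 (gi s) _)); first by move=> x /andP[x0 _]; exact: gk.
move: sd; rewrite ltr_pdivlMr ?ltr_wpDl// subr0 => h; nra.
Qed.

Definition memint (delta : R) (g : R -> R) (t : R) : R :=
  \int[mu]_(s in `[0, t]) (expR (- delta * (t - s)) * g s).

Lemma memint_integrable delta g t : cont_ge0 g -> 0 <= t ->
  mu.-integrable `[0, t] (EFin \o (fun s => expR (- delta * (t - s)) * g s)).
Proof.
move=> cg t0; apply: continuous_compact_integrable; first exact: segment_compact.
have c1 : continuous (fun s => expR (- delta * (t - s))).
  move=> s; apply: (@cvg_comp _ _ _ (fun s => - delta * (t - s)) (@expR R)); last exact: continuous_expR.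
  by apply: cvgM; [exact: cvg_cst|apply: cvgB; [exact: cvg_cst|exact: cvg_id]].
have c2 := cont_ge0_sub (b := t) cg (lexx 0).
have c3 : {within `[0, t], continuous (fun s => expR (- delta * (t - s)))}.
  by apply: continuous_subspaceT.
by move=> s; apply: cvgM; [exact: c3|exact: c2].
Qed.

Lemma memint_sum delta n (g : 'I_n -> R -> R) (c : 'I_n -> R) t :
  (forall i, cont_ge0 (g i)) -> 0 <= t ->
  memint delta (fun s => \sum_i g i s * c i) t = \sum_i memint delta (g i) t * c i.
Proof.
move=> cg t0; elim: n g c cg => [|n IH] g c cg.
  rewrite big_ord0 /memint.
  rewrite (@eq_Rintegral _ _ _ mu _ (fun s => 0 * cst 0 s)).
    by rewrite RintegralZl ?mul0r//; apply: (integrableS measurableT) => //; exact: integrable0.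
  by move=> s _; rewrite big_ord0 mulr0 mul0r.
rewrite big_ord_recr/= -IH//.
have cz : cont_ge0 (fun s => \sum_(i < n) g (widen_ord (leqnSn n) i) s * c (widen_ord (leqnSn n) i)).
  by apply: (@cont_ge0_sum _ _ (fun i s => _)) => i; apply: cont_ge0M => //; exact: cont_ge0_cst.
rewrite /memint -RintegralZr//; last exact: memint_integrable.
rewrite -RintegralD//; last 2 first.
- exact: memint_integrable.
- have := memint_integrable delta (cont_ge0M (cg ord_max) (@cont_ge0_cst _ (c ord_max))) t0.
  by congr (mu.-integrable _ _); apply/funext => s /=; rewrite mulrA.
by apply: eq_Rintegral => s _; rewrite big_ord_recr/=; ring.
Qed.

End TimeIntegrals.

Section MeshSize.
Context {R : realType}.
Context (N : nat) (xs : nat -> R) (part : is_partition N xs).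
Local Notation h := (mesh_size N xs).

Lemma cell_le_mesh j : (j < N)%N -> cell xs j <= h.
Proof. by move=> jN; rewrite /mesh_size (le_bigmax_cond 0 (fun j : 'I_N => cell xs j) (j := Ordinal jN)). Qed.

Lemma mesh_ge0 : 0 <= h.
Proof. by rewrite /mesh_size bigmax_ge_id. Qed.

Lemma mesh_le1 : h <= 1.
Proof.
apply: bigmax_le => // j _; have jN := ltn_ord j.
have /andP[? _] := partition_itv part (ltnW jN).
by have /andP[_ ?] := partition_itv part jN; lra.
Qed.

(** The slope of the interpolant is the mean of f over the cell, hence within the oscillation K of
    every value of f; integrating the difference from the left node gives the second bound. *)
Lemma interp_error (F f : R -> R) (c : nat -> R) j (K : R) : (j < N)%N ->
  (forall a b, xs j <= a -> a <= b -> b <= xs j.+1 -> F b - F a = rint a b f) ->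
  rintegrable (xs j) (xs j.+1) f ->
  (forall x y, xs j < x < xs j.+1 -> xs j < y < xs j.+1 -> `|f x - f y| <= K) ->
  c j = F (xs j) -> c j.+1 = F (xs j.+1) ->
  (forall x, xs j < x < xs j.+1 -> `|f x - slope xs c j| <= K) /\
  (forall x, xs j <= x <= xs j.+1 -> `|F x - interp N xs c x| <= K * cell xs j).
Proof.
move=> jN FE fi fK c0 c1; have h0 := cell_gt0 part jN.
have lt : xs j < xs j.+1 by move: h0; rewrite subr_gt0.
have fs x : xs j < x < xs j.+1 -> `|f x - slope xs c j| <= K.
  move=> xj; have sE : slope xs c j * cell xs j = rint (xs j) (xs j.+1) f.
    by rewrite (slopeM part)// c0 c1 FE// ltW.
  have fxi : rintegrable (xs j) (xs j.+1) (fun=> f x) by exact: rintegrable_cst.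
  have : `|rint (xs j) (xs j.+1) (fun y => f x - f y)| <= K * (xs j.+1 - xs j).
    by apply: norm_rint_le; [exact: ltW|exact: rintegrableB|move=> y yj; exact: fK].
  rewrite rintB// rint_cst ?(ltW lt)// -sE -/(cell xs j) -mulrBl normrM (gtr0_norm h0).
  by rewrite ler_pM2r.
split=> // x xj; have /andP[x1 x2] := xj.
rewrite (interp_cell part _ jN xj) c0.
have -> : F x - (F (xs j) + slope xs c j * (x - xs j)) = rint (xs j) x (fun y => f y - slope xs c j).
  have fi2 : rintegrable (xs j) x f by apply: rintegrable_sub fi _ _.
  by rewrite rintB//; [rewrite rint_cst// -FE//; ring|exact: rintegrable_cst].
have K0 : 0 <= K.
  by apply: le_trans (fs ((xs j + xs j.+1) / 2) _) => //; apply/andP; split; lra.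
apply: (@le_trans _ _ (K * (x - xs j))).
  apply: norm_rint_le => //.
    by apply: rintegrableB; [apply: rintegrable_sub fi _ _|exact: rintegrable_cst].
  by move=> y /andP[y1 y2]; apply: fs; rewrite y1 (lt_le_trans y2).
by rewrite ler_wpM2l// /cell lerD2r.
Qed.

End MeshSize.

Section CauchySchwarz.
Context {R : realType}.
Implicit Types (a b : R) (f g : R -> R).

(** The discriminant of a nonnegative quadratic in r; for C = 0 the linear term has to vanish. *)
Lemma sqr_le_of_quadratic (A b C : R) : 0 <= C -> (forall r, 0 <= A - 2 * r * b + r ^+ 2 * C) ->
  b ^+ 2 <= A * C.
Proof.
rewrite le_eqVlt => /predU1P[<- H|C0 H].
  case: (eqVneq b 0) => [->|b0]; first by rewrite expr0n mulr0.
  have := H ((A + 1) / (2 * b)); rewrite mulr0 addr0.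
  have -> : A - 2 * ((A + 1) / (2 * b)) * b = -1 by field.
  by lra.
have := H (b / C).
have -> : A - 2 * (b / C) * b + (b / C) ^+ 2 * C = (A * C - b ^+ 2) / C by field; rewrite gt_eqF.
by rewrite ler_pdivlMr// mul0r subr_ge0.
Qed.

Lemma rint_sqr_mul_le a b f g : {within `[a, b], continuous f} -> {within `[a, b], continuous g} ->
  rint a b (fun x => f x * g x) ^+ 2 <=
  rint a b (fun x => f x ^+ 2) * rint a b (fun x => g x ^+ 2).
Proof.
move=> cf cg.
have fi := rintegrable_cont (within_continuous_sqr cf).
have gi := rintegrable_cont (within_continuous_sqr cg).
have fgi : rintegrable a b (fun x => f x * g x).
  by apply: rintegrable_cont => x; apply: cvgM; [exact: cf|exact: cg].
apply: sqr_le_of_quadratic; first by apply: rint_ge0 => x _; exact: sqr_ge0.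
move=> r; rewrite -!rintZ// -rintB//; last exact: rintegrableZ.
rewrite -rintD//; [|by apply: rintegrableB => //; exact: rintegrableZ|exact: rintegrableZ].
apply: rint_ge0 => x _.
have -> : f x ^+ 2 - 2 * r * (f x * g x) + r ^+ 2 * g x ^+ 2 = (f x - r * g x) ^+ 2 by ring.
exact: sqr_ge0.
Qed.

End CauchySchwarz.

(** * Interpolation error and residual of the exact solution *)

Section Consistency.
Context {R : realType}.
Local Notation mu := (@lebesgue_measure R).
Local Notation I01 := (`]0, 1[%classic : set R).
Context (nu rho delta c0 c1 wd M : R) (w wt z : R -> R -> R).
Context (reg : regular nu rho delta c0 c1 wd M w wt z).
Context (N : nat) (xs : nat -> R) (part : is_partition N xs).
Local Notation u := (fun t => cont_rep (w t)).
Local Notation p := (fun t => cont_rep (wD (w t))).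
Local Notation q := (fun t => cont_rep (wt t)).
Local Notation B := (1 + M).
Local Notation L := (2 * (B + wd * B + B * B) / nu).
Local Notation h := (mesh_size N xs).
Implicit Types (t x : R).

Definition nodal (F : R -> R -> R) (t : R) (j : nat) : R := F t (xs j).
Local Notation V := (nodal u).
Local Notation Vd := (nodal q).
Local Notation v := (fun t => interp N xs (V t)).
Local Notation vt := (fun t => interp N xs (Vd t)).

Lemma B_ge0 : 0 <= B.
Proof. by rewrite addr_ge0// (reg_M reg). Qed.

Lemma V_bound t j : 0 <= t -> (j <= N)%N -> `|V t j| <= B.
Proof. by move=> t0 jN; apply: (u_bound0 reg t0); exact: (partition_itv part). Qed.

Lemma Vd_bound t j : 0 < t -> (j <= N)%N -> `|Vd t j| <= B.
Proof. by move=> t0 jN; apply: (q_bound reg t0); exact: (partition_itv part). Qed.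

Lemma V_incr t j : 0 < t -> (j < N)%N -> `|incr (V t) j| <= B * cell xs j.
Proof.
move=> t0 jN; have h0 := cell_gt0 part jN.
apply: (le_trans (u_lip reg t0 (partition_itv part jN) (partition_itv part (ltnW jN)))).
by rewrite gtr0_norm.
Qed.

Lemma p_slope t j : 0 < t -> (j < N)%N ->
  (forall x, xs j < x < xs j.+1 -> `|p t x - slope xs (V t) j| <= L * cell xs j) /\
  (forall x, xs j <= x <= xs j.+1 -> `|u t x - v t x| <= L * cell xs j * cell xs j).
Proof.
move=> t0 jN; have [cp uE] := u_C1 reg t0.
have /andP[j0 _] := partition_itv part (ltnW jN); have /andP[_ j1] := partition_itv part jN.
apply: (interp_error part jN) => //.
- by move=> a b a0 ab b1; apply: uE => //; lra.
- by apply: rintegrable_sub (rintegrable_cont cp) _ _.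
- move=> x y xj yj; apply: (le_trans (p_lip' reg t0 _ _)).
  + exact: (cell_itv part jN).
  + exact: (cell_itv part jN).
  + rewrite ler_wpM2l ?(L_ge0 reg)//; move: xj yj => /andP[? ?] /andP[? ?].
    by rewrite ler_norml /cell; apply/andP; split; lra.
Qed.

Lemma eta_le_pos t x : 0 < t -> 0 <= x <= 1 -> `|u t x - v t x| <= L * h ^+ 2.
Proof.
move=> t0 /(partition_cell part)[j jN xj]; have [_ H] := p_slope t0 jN.
apply: (le_trans (H x xj)); rewrite -mulrA ler_wpM2l ?(L_ge0 reg)// expr2.
have h0 := ltW (cell_gt0 part jN); have := cell_le_mesh xs jN => hh.
by apply: ler_pM.
Qed.

Lemma V_contt : nodal_cont N.+1 V.
Proof. by move=> j jN; apply: (u_cont reg); exact: (partition_itv part). Qed.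

Lemma V_der t : 0 < t -> nodal_der N.+1 V (Vd t) t.
Proof. by move=> t0 j jN; apply: (u_derive reg t0); exact: (partition_itv part). Qed.

Lemma interp_contt (c : R -> nat -> R) x : nodal_cont N.+1 c -> 0 <= x <= 1 ->
  cont_ge0 (fun t => interp N xs (c t) x).
Proof.
move=> cc /(partition_cell part)[j jN xj].
apply: (@cont_ge0_eq _ (fun t => c t j + slope xs (c t) j * (x - xs j))).
  by move=> t _; rewrite (interp_cell part _ jN xj).
apply: cont_ge0D; first by apply: cc; exact: ltnW.
apply: cont_ge0M; last exact: cont_ge0_cst.
by apply: cont_ge0M; [exact: (incr_contt cc jN)|exact: cont_ge0_cst].
Qed.

Lemma interp_der (c : R -> nat -> R) (c' : nat -> R) t x : nodal_der N.+1 c c' t -> 0 <= x <= 1 ->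
  is_derive t 1 (fun t => interp N xs (c t) x) (interp N xs c' x).
Proof.
move=> dc /(partition_cell part)[j jN xj].
rewrite (_ : (fun t => _) = (fun t => c t j + slope xs (c t) j * (x - xs j))); last first.
  by apply/funext => s; rewrite (interp_cell part _ jN xj).
have h1 := derD (dc j (ltnW jN)) (derM (derM (der_incr dc jN) (derC (cell xs j)^-1 t)) (derC (x - xs j) t)).
by apply: (derE h1); rewrite (interp_cell part _ jN xj) /slope /incr; ring.
Qed.

(** The Lipschitz bound on w_x holds for t > 0; the time t = 0, needed for the initial error, is
    reached by continuity. *)
Lemma eta_le t x : 0 <= t -> 0 <= x <= 1 -> `|u t x - v t x| <= L * h ^+ 2.
Proof.
move=> t0 x01; apply/ler_addgt0Pr => e e0.
have c : cont_ge0 (fun t => u t x - v t x).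
  by apply: cont_ge0B; [exact: (u_cont reg)|exact: (interp_contt V_contt)].
have /cont_ge0P cc := c; have [d d0 dP] := cc t t0 e e0.
have h0 : 0 < t + d / 2 by rewrite ltr_wpDl// divr_gt0.
have h1 : `|t + d / 2 - t| < d by rewrite addrAC subrr add0r gtr0_norm ?divr_gt0//; lra.
have := dP _ (ltW h0) h1; have := eta_le_pos h0 x01.
by rewrite !ler_norml => /andP[? ?] /andP[? ?]; apply/andP; split; lra.
Qed.

Lemma v_bound t x : 0 <= t -> 0 <= x <= 1 -> `|v t x| <= B.
Proof. by move=> t0; apply: (interp_bound part) => j jN; exact: V_bound. Qed.
Lemma vt_bound t x : 0 < t -> 0 <= x <= 1 -> `|vt t x| <= B.
Proof. by move=> t0; apply: (interp_bound part) => j jN; exact: Vd_bound. Qed.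

Definition etat t x : R := q t x - vt t x.
Definition esq t : R := rint 0 1 (fun x => etat t x ^+ 2).

Lemma etat_within t : 0 < t -> {within `[0, 1], continuous (etat t)}.
Proof. by move=> t0 x; apply: cvgB; [exact: (q_within reg t0)|exact: interp_within]. Qed.

Lemma etat_bound t x : 0 < t -> 0 <= x <= 1 -> `|etat t x| <= 2 * B.
Proof.
move=> t0 x01; apply: (le_trans (ler_normB _ _)).
by have := q_bound reg t0 x01; have := vt_bound t0 x01; lra.
Qed.

Lemma etat_contt t x : 0 < t -> 0 <= x <= 1 -> {for t, continuous (fun s => etat s x)}.
Proof.
move=> t0 x01; apply: cvgB; first exact: (q_cont reg).
move/(partition_cell part): x01 => [j jN xj].
have E : (fun s => vt s x) = (fun s => Vd s j + slope xs (Vd s) j * (x - xs j)).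
  by apply/funext => s; rewrite (interp_cell part _ jN xj).
rewrite E.
have c i : (i <= N)%N -> {for t, continuous (fun s => Vd s i)}.
  by move=> iN; apply: (q_cont reg t0); exact: (partition_itv part).
rewrite (interp_cell part _ jN xj).
apply: cvgD; first by apply: c; exact: ltnW.
apply: cvgM; last exact: cvg_cst.
apply: cvgM; last exact: cvg_cst.
by apply: cvgB; apply: c => //; exact: ltnW.
Qed.

Lemma etat_sqr_rintegrable t : 0 < t -> rintegrable 0 1 (fun x => etat t x ^+ 2).
Proof. by move=> t0; apply: rintegrable_cont; apply: within_continuous_sqr; exact: etat_within. Qed.

Lemma etat_sqr_bound t x : 0 < t -> 0 <= x <= 1 -> `|etat t x ^+ 2| <= (2 * B) ^+ 2.
Proof.
move=> t0 x01; have := etat_bound t0 x01 => h1.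
by rewrite normrX ler_pXn2r ?nnegrE// mulr_ge0// B_ge0.
Qed.

Lemma esq_ge0 t : 0 <= esq t.
Proof. by apply: rint_ge0 => x _; exact: sqr_ge0. Qed.

Lemma esq_bound t : 0 < t -> `|esq t| <= (2 * B) ^+ 2.
Proof.
move=> t0; have := @norm_rint_le _ 0 1 (fun x => etat t x ^+ 2) ((2 * B) ^+ 2) ler01 (etat_sqr_rintegrable t0).
rewrite subr0 mulr1; apply=> x /andP[x0 x1]; apply: etat_sqr_bound => //.
by rewrite !ltW.
Qed.

Lemma esq_contt t : 0 < t -> {for t, continuous esq}.
Proof.
move=> t0; apply: (@rint_cont_param _ (fun s x => etat s x ^+ 2) 0 1 t ((2 * B) ^+ 2)) => //.
- exact: etat_sqr_rintegrable.
- move=> s x s0 /andP[x0 x1].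
  have c : {for s, continuous (fun r => etat r x)} by apply: etat_contt => //; rewrite !ltW.
  rewrite (_ : (fun r => etat r x ^+ 2) = (fun r => etat r x * etat r x)); first exact: (cvgM c c).
  by apply/funext => r; rewrite expr2.
- by move=> s x s0 /andP[x0 x1]; apply: etat_sqr_bound => //; rewrite !ltW.
Qed.

Lemma inner_etat_le t c : 0 < t ->
  inner (etat t) (interp N xs c) ^+ 2 <= esq t * mass N xs c c.
Proof.
move=> t0; rewrite -inner_mass// !innerE; apply: (le_trans (rint_sqr_mul_le (etat_within t0) _)).
  exact: interp_within.
by rewrite le_eqVlt; apply/orP; left; apply/eqP; congr (_ * _); apply: eq_rint => x _; rewrite expr2.
Qed.

(** On a cell w_tx oscillates by at most K = sqrt(cell S), where S is the integral of w_txx^2 there,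
    so |eta_t| <= K cell; squared and integrated over the cell this gives cell^4 S. *)
Lemma esq_le t : 0 < t -> sobolev 2 (wt t) -> esq t <= h ^+ 4 * L2norm (wD (wD (wt t))) ^+ 2.
Proof.
move=> t0 [_ _ wt2]; have [_ _ wt1] := reg_sobolev reg t0.
have [cg gg gE] := sobolev1_rep wt2; have [_ _ kL] := wt2.
have [cq qE] := C1_pair_of_sobolev2 wt1 wt2.
have /L2P[mk k2] := kL.
set g := cont_rep (wD (wt t)) in cg gg gE cq qE.
set k := wD (wD (wt t)) in gE kL mk k2 *.
rewrite L2norm_sqr /esq (rint_cells part (etat_sqr_rintegrable t0)) (rint_cells part k2) mulr_sumr.
apply: ler_sum => j _; have jN := ltn_ord j; have h0 := cell_gt0 part jN.
have lt : xs j < xs j.+1 by move: h0; rewrite subr_gt0.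
have /andP[j0 _] := partition_itv part (ltnW jN); have /andP[_ j1] := partition_itv part jN.
have k2j : rintegrable (xs j) (xs j.+1) (fun x => k x ^+ 2) by apply: rintegrable_sub k2 _ _.
set S := rint (xs j) (xs j.+1) (fun x => k x ^+ 2).
have S0 : 0 <= S by apply: rint_ge0 => x _; exact: sqr_ge0.
have gk a b : xs j <= a -> a <= b -> b <= xs j.+1 -> (g b - g a) ^+ 2 <= cell xs j * S.
  move=> ja ab bj; rewrite gE; try lra.
  apply: (@le_trans _ _ ((b - a) * rint a b (fun x => k x ^+ 2))).
    apply: sqr_rint_le => //; last by apply: rintegrable_sub k2 _ _; lra.
    by apply: measurable_funS mk => //; apply: subset_itvW; lra.
  apply: ler_pM; [lra|by apply: rint_ge0 => x _; exact: sqr_ge0|by rewrite /cell; lra|].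
  have bj' : a <= xs j.+1 by lra.
  rewrite /S (@rint_split _ (xs j) a (xs j.+1))//.
  rewrite (@rint_split _ a b (xs j.+1))//; last by apply: rintegrable_sub k2j _ _; lra.
  have : 0 <= rint (xs j) a (fun x => k x ^+ 2) by apply: rint_ge0 => x _; exact: sqr_ge0.
  have : 0 <= rint b (xs j.+1) (fun x => k x ^+ 2) by apply: rint_ge0 => x _; exact: sqr_ge0.
  by lra.
pose K := Num.sqrt (cell xs j * S).
have K2 : K ^+ 2 = cell xs j * S by rewrite sqr_sqrtr// mulr_ge0// ltW.
have gK x y : xs j < x < xs j.+1 -> xs j < y < xs j.+1 -> `|g x - g y| <= K.
  have H a b : xs j <= a -> a <= b -> b <= xs j.+1 -> `|g b - g a| <= K.
    move=> ja ab bj; rewrite -(@ler_pXn2r _ 2) ?nnegrE ?sqrtr_ge0// real_normK ?num_real//.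
    by rewrite K2 gk.
  move=> /andP[x1 x2] /andP[y1 y2]; case: (leP x y) => xy; first by rewrite distrC H// ltW.
  by apply: H; exact: ltW.
have [_ eb] := interp_error (c := Vd t) part jN (F := q t) (f := g)
  (fun a b a0 ab b1 => qE a b (le_trans j0 a0) ab (le_trans b1 j1))
  (rintegrable_sub (rintegrable_cont cq) j0 j1) gK erefl erefl.
apply: (@le_trans _ _ ((K * cell xs j) ^+ 2 * (xs j.+1 - xs j))).
  rewrite -rint_cst ?(ltW lt)//; apply: le_rint.
  - by apply: rintegrable_sub (etat_sqr_rintegrable t0) _ _.
  - exact: rintegrable_cst.
  - have K0 : 0 <= K * cell xs j by apply: mulr_ge0; [exact: sqrtr_ge0|exact: ltW].
    move=> x xj; rewrite -(real_normK (num_real (etat t x))) ler_pXn2r ?nnegrE//.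
    by apply: eb; move/andP: xj => [? ?]; rewrite !ltW.
rewrite exprMn K2 -/(cell xs j).
have -> : cell xs j * S * cell xs j ^+ 2 * cell xs j = cell xs j ^+ 4 * S by ring.
by rewrite ler_wpM2r// ler_pXn2r ?nnegrE ?(ltW h0) ?mesh_ge0// cell_le_mesh.
Qed.

Definition fluxerr t x : R := wd * (u t x - v t x) + (u t x ^+ 2 / 2 - v t x ^+ 2 / 2).
Definition fluxerrt t x : R := wd * etat t x + (u t x * q t x - v t x * vt t x).
(* The cell integrals of w_d eta + (w^2 - V^2) / 2 and of its time derivative. *)
Definition residual t (j : nat) : R := rint (xs j) (xs j.+1) (fluxerr t).
Definition residualt t (j : nat) : R := rint (xs j) (xs j.+1) (fluxerrt t).

Lemma v_within t : {within `[0, 1], continuous (v t)}.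
Proof. exact: interp_within. Qed.

Lemma half_sqr_within (f : R -> R) : {within `[0, 1], continuous f} ->
  {within `[0, 1], continuous (fun x => f x ^+ 2 / 2)}.
Proof. by move=> cf x; apply: cvgM; [exact: within_continuous_sqr|exact: cvg_cst]. Qed.

Lemma fluxerr_within t : 0 <= t -> {within `[0, 1], continuous (fluxerr t)}.
Proof.
move=> t0; have cu := u_within reg t0; have cv := @v_within t.
have cu2 := half_sqr_within cu; have cv2 := half_sqr_within cv.
move=> x; apply: cvgD; last by apply: cvgB; [exact: cu2|exact: cv2].
by apply: cvgM; [exact: cvg_cst|apply: cvgB; [exact: cu|exact: cv]].
Qed.

Lemma fluxerrt_within t : 0 < t -> {within `[0, 1], continuous (fluxerrt t)}.
Proof.
move=> t0; have cu := u_within reg (ltW t0); have cv := @v_within t.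
have cq := q_within reg t0; have ce := etat_within t0.
have cvt : {within `[0, 1], continuous (vt t)} by exact: interp_within.
move=> x; apply: cvgD; first by apply: cvgM; [exact: cvg_cst|exact: ce].
by apply: cvgB; apply: cvgM; [exact: cu|exact: cq|exact: cv|exact: cvt].
Qed.

Lemma residualE t j : 0 <= t -> (j < N)%N -> residual t j =
  wd * (rint (xs j) (xs j.+1) (u t) - rint (xs j) (xs j.+1) (v t))
  + (rint (xs j) (xs j.+1) (fun x => u t x ^+ 2 / 2) - rint (xs j) (xs j.+1) (fun x => v t x ^+ 2 / 2)).
Proof.
move=> t0 jN; have cu := u_within reg t0; have cv := @v_within t.
have i (f : R -> R) : {within `[0, 1], continuous f} -> rintegrable (xs j) (xs j.+1) f.
  by move=> /(cell_within part jN)/rintegrable_cont.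
have i1 := i _ cu; have i2 := i _ cv; have i3 := i _ (half_sqr_within cu).
have i4 := i _ (half_sqr_within cv).
rewrite /residual /fluxerr rintD; [|by apply: rintegrableZ; exact: rintegrableB|exact: rintegrableB].
by rewrite rintZ; [rewrite !rintB|exact: rintegrableB].
Qed.

Lemma residual_contt : nodal_cont N residual.
Proof.
move=> j jN; have [_ _ lt] := part.
have /andP[j0 _] := partition_itv part (ltnW jN); have /andP[_ j1] := partition_itv part jN.
apply: cont_ge0_eq; first by move=> t t0; exact: esym (residualE t0 jN).
apply: cont_ge0D; [apply: cont_ge0Z|]; apply: cont_ge0B.
- by apply: (rint_u_cont reg) => //; exact/ltW/lt.
- apply: (@cont_ge0_eq _ (fun t => cell xs j * ((V t j + V t j.+1) / 2))).
    by move=> t _; rewrite rint_interp.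
  apply: cont_ge0Z; apply: cont_ge0M; last exact: cont_ge0_cst.
  by apply: cont_ge0D; apply: V_contt => //; exact: ltnW.
- by apply: (rint_u_sqr_cont reg) => //; exact/ltW/lt.
- apply: (@cont_ge0_eq _ (fun t => 2^-1 * (cell xs j * quad (V t) (V t) j))).
    move=> t _; rewrite -(rint_quad part)// -rintZ.
      by apply: eq_rint => x _; rewrite expr2 mulrC.
    by apply: rintegrable_cont => x; apply: cvgM; exact: interp_within.
  by apply: cont_ge0Z; apply: cont_ge0Z; apply: (quad_contt V_contt V_contt jN).
Qed.

Lemma fluxerr_bound t x : 0 <= t -> 0 <= x <= 1 -> `|fluxerr t x| <= (wd + B) * (L * h ^+ 2).
Proof.
move=> t0 x01; have e := eta_le t0 x01; have [_ _ _ wd0] := reg_param reg.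
have b1 := u_bound0 reg t0 x01; have b2 := v_bound t0 x01.
have -> : fluxerr t x = (wd + (u t x + v t x) / 2) * (u t x - v t x) by rewrite /fluxerr; field.
rewrite normrM; apply: ler_pM => //; apply: (le_trans (ler_normD _ _)).
rewrite (ger0_norm wd0) lerD2l normrM (ger0_norm (_ : 0 <= 2^-1 :> R)) ?invr_ge0//.
by have := ler_normD (u t x) (v t x); lra.
Qed.

Lemma fluxerrt_bound t x : 0 < t -> 0 <= x <= 1 ->
  `|fluxerrt t x| <= (wd + B) * `|etat t x| + B * (L * h ^+ 2).
Proof.
move=> t0 x01; have e := eta_le (ltW t0) x01; have [_ _ _ wd0] := reg_param reg.
have b1 := u_bound0 reg (ltW t0) x01; have b2 := vt_bound t0 x01.
have -> : fluxerrt t x = (wd + u t x) * etat t x + vt t x * (u t x - v t x).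
  by rewrite /fluxerrt /etat; ring.
apply: (le_trans (ler_normD _ _)); rewrite !normrM; apply: lerD.
  rewrite ler_wpM2r//; apply: (le_trans (ler_normD _ _)).
  by rewrite (ger0_norm wd0) lerD2l.
exact: ler_pM.
Qed.

Lemma residual_der t : 0 < t -> nodal_der N residual (residualt t) t.
Proof.
move=> t0 j jN; have B0 := B_ge0; have [_ _ _ wd0] := reg_param reg; have L0 := L_ge0 reg.
pose k := (wd + B) * (2 * B) + B * (L * h ^+ 2).
apply: (@rint_der_param _ fluxerr fluxerrt _ _ t k) => //.
- by move=> s s0; apply: rintegrable_cont; apply: (cell_within part jN); exact/fluxerr_within/ltW.
- move=> s x s0 xj; have /andP[x0 x1] := cell_itv part jN xj.
  have x01 : 0 <= x <= 1 by rewrite !ltW.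
  have du := u_derive reg s0 x01; have dv := interp_der (V_der s0) x01.
  have du2 := derM (derM du du) (derC 2^-1 s); have dv2 := derM (derM dv dv) (derC 2^-1 s).
  have d := derD (derZ wd (derB du dv)) (derB du2 dv2).
  by apply: (derE d); rewrite /fluxerrt /etat /=; field.
- move=> s x s0 xj; have /andP[x0 x1] := cell_itv part jN xj.
  have x01 : 0 <= x <= 1 by rewrite !ltW.
  apply: (le_trans (fluxerrt_bound s0 x01)); rewrite /k lerD2r.
  by apply: ler_wpM2l; [exact: addr_ge0|exact: etat_bound].
Qed.

(** Cauchy-Schwarz on each cell; the division by the cell length in [lnorm] cancels the factor that
    this produces. *)
Lemma lnorm_le (Z : nat -> R) (f : R -> R) : {within `[0, 1], continuous f} ->
  (forall j, (j < N)%N -> Z j = rint (xs j) (xs j.+1) f) ->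
  lnorm N xs Z <= rint 0 1 (fun x => f x ^+ 2).
Proof.
move=> cf ZE; have cf2 := within_continuous_sqr cf.
rewrite (rint_cells part (rintegrable_cont cf2)); apply: ler_sum => j _; have jN := ltn_ord j.
have h0 := cell_gt0 part jN; rewrite ler_pdivrMr// mulrC ZE//.
apply: sqr_rint_le.
- by move: h0; rewrite /cell; lra.
- exact: (within_continuous_meas (cell_within part jN cf)).
- exact: (rintegrable_cont (cell_within part jN cf2)).
Qed.

Lemma lnorm_residual t : 0 <= t -> lnorm N xs (residual t) <= ((wd + B) * L) ^+ 2 * h ^+ 4.
Proof.
move=> t0; have cf := fluxerr_within t0; have cf2 := within_continuous_sqr cf.
apply: (le_trans (lnorm_le cf (fun j _ => erefl))).
have <- : ((wd + B) * (L * h ^+ 2)) ^+ 2 * (1 - 0) = ((wd + B) * L) ^+ 2 * h ^+ 4 by ring.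
rewrite -rint_cst ?ler01//; apply: le_rint.
- exact: rintegrable_cont.
- exact: rintegrable_cst.
- move=> x /andP[x0 x1]; have x01 : 0 <= x <= 1 by rewrite !ltW.
  have b := fluxerr_bound t0 x01.
  rewrite -(real_normK (num_real (fluxerr t x))) ler_pXn2r ?nnegrE//.
  exact: le_trans b.
Qed.

Lemma lnorm_residualt t : 0 < t ->
  lnorm N xs (residualt t) <= 2 * (wd + B) ^+ 2 * esq t + 2 * (B * L) ^+ 2 * h ^+ 4.
Proof.
move=> t0; have cf := fluxerrt_within t0; have cf2 := within_continuous_sqr cf.
have ei := etat_sqr_rintegrable t0.
apply: (le_trans (lnorm_le cf (fun j _ => erefl))).
have <- : 2 * (B * (L * h ^+ 2)) ^+ 2 * (1 - 0) = 2 * (B * L) ^+ 2 * h ^+ 4 by ring.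
rewrite -rint_cst ?ler01// -rintZ// -rintD; [|exact: rintegrableZ|exact: rintegrable_cst].
apply: le_rint.
- exact: rintegrable_cont.
- by apply: rintegrableD; [exact: rintegrableZ|exact: rintegrable_cst].
- move=> x /andP[x0 x1]; have x01 : 0 <= x <= 1 by rewrite !ltW.
  have b := fluxerrt_bound t0 x01.
  rewrite -(real_normK (num_real (fluxerrt t x))) -[X in _ <= 2 * _ ^+ 2 * X + _](real_normK (num_real (etat t x))).
  set a := (wd + B) * `|etat t x| in b *; set c := B * (L * h ^+ 2) in b *.
  apply: (@le_trans _ _ ((a + c) ^+ 2)).
    rewrite ler_pXn2r ?nnegrE//; exact: le_trans b.
  have -> : 2 * (wd + B) ^+ 2 * `|etat t x| ^+ 2 = 2 * a ^+ 2 by rewrite /a; ring.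
  by have := sqr_ge0 (a - c); lra.
Qed.

End Consistency.

(** * Error equation *)

Section DiscreteLinearity.
Context {R : realType}.
Context (N : nat) (xs : nat -> R).
Implicit Types (a b c : nat -> R).

Lemma massB a b c : mass N xs (fun j => a j - b j) c = mass N xs a c - mass N xs b c.
Proof. by rewrite /mass -sumrB; apply: eq_bigr => j _; rewrite /quad; field. Qed.
Lemma massN a c : mass N xs (fun j => - a j) c = - mass N xs a c.
Proof. by rewrite /mass -sumrN; apply: eq_bigr => j _; rewrite /quad; field. Qed.
Lemma stiffB a b c : stiff N xs (fun j => a j - b j) c = stiff N xs a c - stiff N xs b c.
Proof. by rewrite /stiff -sumrB; apply: eq_bigr => j _; rewrite /incr; ring. Qed.
Lemma stiffN a c : stiff N xs (fun j => - a j) c = - stiff N xs a c.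
Proof. by rewrite /stiff -sumrN; apply: eq_bigr => j _; rewrite /incr; ring. Qed.
Lemma sgradB a b c : sgrad N (fun j => a j - b j) c = sgrad N a c - sgrad N b c.
Proof. by rewrite /sgrad -sumrB; apply: eq_bigr => j _; ring. Qed.
Lemma sgradN a c : sgrad N (fun j => - a j) c = - sgrad N a c.
Proof. by rewrite /sgrad -sumrN; apply: eq_bigr => j _; ring. Qed.
Lemma convB a b d c : conv N (fun j => a j - b j) d c = conv N a d c - conv N b d c.
Proof. by rewrite /conv -sumrB; apply: eq_bigr => j _; rewrite /incr; ring. Qed.
Lemma convN a d c : conv N (fun j => - a j) d c = - conv N a d c.
Proof. by rewrite /conv -sumrN; apply: eq_bigr => j _; rewrite /incr; ring. Qed.
Lemma conv0 d c : conv N (fun=> 0) d c = 0 :> R.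
Proof. by rewrite /conv big1// => j _; rewrite /incr subrr mul0r. Qed.
Lemma load0 c : load N xs (fun=> 0) c = 0.
Proof. by rewrite /load big1// => j _; rewrite !mul0r. Qed.

End DiscreteLinearity.

(** * Memory integrals of slopes *)

Section Memory.
Context {R : realType}.
Context (N : nat) (xs : nat -> R) (part : is_partition N xs).
Context (delta : R) (delta0 : 0 < delta).
Implicit Types (F f Z : R -> R -> R) (c : nat -> R) (t : R).

Lemma slope_contt (c : R -> nat -> R) j : nodal_cont N.+1 c -> (j < N)%N ->
  cont_ge0 (fun s => slope xs (c s) j).
Proof. by move=> cc jN; apply: cont_ge0M; [exact: (incr_contt cc jN)|exact: cont_ge0_cst]. Qed.

Definition memslope (c : R -> nat -> R) t (j : nat) : R := memint delta (fun s => slope xs (c s) j) t.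

Lemma memslope_ode (c : R -> nat -> R) : nodal_cont N.+1 c ->
  [/\ nodal_cont N (memslope c), forall j, (j < N)%N -> memslope c 0 j = 0 &
    forall t, 0 < t -> nodal_der N (memslope c)
      (fun j => incr (c t) j / cell xs j - delta * memslope c t j) t].
Proof.
move=> cc.
have H j : (j < N)%N -> [/\ memslope c 0 j = 0, cont_ge0 (memslope c ^~ j) &
    forall t, 0 < t -> is_derive t 1 (memslope c ^~ j) (slope xs (c t) j - delta * memslope c t j)].
  by move=> jN; apply: (memory_ode delta0 (slope_contt cc jN)).
by split=> [j jN|j jN|t t0 j jN]; have [h1 h2 h3] := H j jN; [|exact: h1|exact: h3].
Qed.

(** [memory] is defined by testing; against the step function [wD (interp c)] it becomes a finite
    sum of scalar memory integrals of slopes, which depend on nodal values only. Hence w and V have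
    the same memory term. *)
Lemma inner_memory f Z F c t : memory delta (fun s => wD (f s)) Z ->
  (forall s, 0 <= s -> sobolev 1 (f s)) ->
  (forall s j, 0 <= s -> (j <= N)%N -> cont_rep (f s) (xs j) = F s (xs j)) ->
  nodal_cont N.+1 (nodal xs F) -> 0 <= t ->
  inner (Z t) (wD (interp N xs c)) = sgrad N (memslope (nodal xs F) t) c.
Proof.
move=> mZ f1 fF cF t0.
have [_ /(_ (wD (interp N xs c)))[]] := mZ t t0.
  by have [[_ _ ?] _ _] := pl_sobolev part (pl_interp part c).
move=> _ ->.
transitivity (memint delta (fun s => \sum_(j < N) slope xs (nodal xs F s) j * incr c j) t).
  apply: eq_Rintegral => s; rewrite inE/= in_itv/= => /andP[s0 _]; congr (_ * _).
  rewrite (inner_wD_interp part _ (f1 s s0)); apply: eq_bigr => j _; have jN := ltn_ord j.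
  by rewrite /incr /slope !fF ?(ltnW jN)// /nodal; ring.
rewrite (memint_sum delta (g := fun j s => slope xs (nodal xs F s) (nat_of_ord j)))//.
by move=> j; exact: slope_contt.
Qed.

End Memory.

(** * The scheme in nodal form *)

Section Scheme.
Context {R : realType}.
Local Notation I01 := (`]0, 1[%classic : set R).
Context (N : nat) (xs : nat -> R) (part : is_partition N xs).
Context (nu rho delta c0 c1 wd : R) (wh : R -> R -> R).
Context (sd : semi_discrete N xs nu rho delta c0 c1 wd wh) (delta0 : 0 < delta).
Local Notation Y := (nodal xs wh).
Definition Yd (t : R) (j : nat) : R := derive1 (wh ^~ (xs j)) t.
Implicit Types (t x : R) (c : nat -> R).

Lemma wh_pl t : 0 <= t -> pl N xs (wh t).
Proof. by move=> t0; have [H _ _ _] := sd; exact/fe_space_pl/H. Qed.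

Lemma wh_interp t x : 0 <= t -> 0 <= x <= 1 -> wh t x = interp N xs (Y t) x.
Proof.
move=> t0 /(partition_cell part)[j jN xj]; have [_ /(_ j jN x xj)->] := wh_pl t0.
by rewrite (interp_cell part _ jN xj).
Qed.

Lemma wh_der t x : 0 < t -> 0 <= x <= 1 -> is_derive t 1 (wh ^~ x) (derive1 (wh ^~ x) t).
Proof.
move=> t0 x01; have [_ _ H _] := sd; apply: DeriveDef; first exact: H.
by rewrite derive1E.
Qed.

Lemma Y_der t : 0 < t -> nodal_der N.+1 Y (Yd t) t.
Proof. by move=> t0 j jN; apply: (wh_der t0); exact: (partition_itv part). Qed.

Lemma Y_contt : nodal_cont N.+1 Y.
Proof.
move=> j jN; have xj := partition_itv part jN.
apply: cont_ge0_of_derive; first by move=> t t0; exact: (wh_der t0 xj).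
move=> e e0.
have [_ H _ _] := sd; have /cvgrPdist_le/(_ _ e0) := H (xs j) xj.
rewrite near_withinE => -[d /= d0 dP]; exists d => // s /andP[s0 sd'].
move: s0; rewrite le_eqVlt => /predU1P[<-|s0]; first by rewrite subrr normr0 ltW.
by rewrite distrC; apply: dP => //=; rewrite sub0r normrN gtr0_norm.
Qed.

Lemma derive_wh t x : 0 < t -> 0 <= x <= 1 -> derive1 (wh ^~ x) t = interp N xs (Yd t) x.
Proof.
move=> t0 x01; have h1 := interp_der part (Y_der t0) x01.
have h2 : is_derive t 1 (wh ^~ x) (interp N xs (Yd t) x).
  apply: near_eq_is_derive h1; near=> s; apply/esym/wh_interp => //.
  by apply: ltW; near: s; exact: lt_nbhsr.
by rewrite derive1E; have [_ ->] := h2.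
Unshelve. all: by end_near. Qed.

Lemma wh_sobolev t : 0 <= t -> sobolev 1 (wh t) /\ forall x, 0 <= x <= 1 -> cont_rep (wh t) x = wh t x.
Proof. by move=> t0; have [? _ ?] := pl_sobolev part (wh_pl t0). Qed.

Lemma wh_within t : 0 <= t -> {within `[0, 1], continuous (wh t)}.
Proof. by move=> /wh_pl[]. Qed.

Lemma scheme_eq t c : 0 < t ->
  mass N xs (Yd t) c + nu * stiff N xs (Y t) c + wd * conv N (Y t) (fun=> 1) c + conv N (Y t) (Y t) c
  + rho * sgrad N (memslope xs delta Y t) c
  + (bcub c0 wd (Y t 0%N) * c 0%N + bcub c1 wd (Y t N) * c N) = 0.
Proof.
move=> t0; have [_ _ _ [zh [mz zE]]] := sd; have [x0 x1 _] := part.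
have [w1 wE] := wh_sobolev (ltW t0); have cw := wh_within (ltW t0).
have plc := pl_interp part c; have [_ _ cE] := pl_sobolev part plc.
have := zE t t0 _ (pl_fe_space plc).
rewrite /weak_form !wE ?cE ?lexx ?ler01//.
have i1 : inner (fun x => derive1 (wh ^~ x) t) (interp N xs c) = mass N xs (Yd t) c.
  rewrite -(inner_mass part) !innerE; apply: eq_rint => x /andP[? ?].
  by rewrite derive_wh// !ltW.
have i2 : inner (wD (wh t)) (wD (interp N xs c)) = stiff N xs (Y t) c.
  rewrite (inner_wD_interp part _ w1); apply: eq_bigr => j _; have jN := ltn_ord j.
  by rewrite /incr !wE//; apply: (partition_itv part) => //; exact: ltnW.
have i3 : inner (wD (wh t)) (interp N xs c) = conv N (Y t) (fun=> 1) c.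
  transitivity (inner (interp N xs c) (wD (wh t))).
    by apply: eq_Rintegral => x _; rewrite mulrC.
  rewrite (inner_wD_pl part); [|apply: rintegrable_cont; exact: interp_within|exact: wh_pl (ltW t0)].
  apply: eq_bigr => j _; have jN := ltn_ord j; have h0 := cell_gt0 part jN.
  by rewrite rint_interp// /slope /quad /incr /nodal /=; field; rewrite gt_eqF.
have i4 : inner (fun x => wh t x * wD (wh t) x) (interp N xs c) = conv N (Y t) (Y t) c.
  transitivity (inner (fun x => wh t x * interp N xs c x) (wD (wh t))).
    by apply: eq_Rintegral => x _; ring.
  rewrite (inner_wD_pl part); [|apply: rintegrable_cont|exact: wh_pl (ltW t0)]; last first.
    by move=> x; apply: cvgM; [exact: cw|exact: interp_within].
  apply: eq_bigr => j _; have jN := ltn_ord j; have h0 := cell_gt0 part jN.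
  rewrite (@eq_rint _ _ _ _ (fun x => interp N xs (Y t) x * interp N xs c x)).
    by rewrite (rint_quad part)// /slope /incr /nodal /=; field; rewrite gt_eqF.
  by move=> x /(cell_itv part jN)/andP[? ?]; rewrite wh_interp ?(ltW t0)// !ltW.
have i5 : inner (zh t) (wD (interp N xs c)) = sgrad N (memslope xs delta Y t) c.
  apply: (inner_memory part c mz _ _ Y_contt (ltW t0)).
    by move=> s /wh_sobolev[].
  by move=> s j s0 jN; have [_ ->//] := wh_sobolev s0; exact: (partition_itv part).
have e0 : interp N xs c 0 = c 0%N by rewrite -{1}x0 interp_node.
have e1 : interp N xs c 1 = c N by rewrite -{1}x1 interp_node.
rewrite i1 i2 i3 i4 i5 e0 e1 => <-; rewrite /bcub /nodal x0 x1.
by set k0 := 2 / (9 * c0); set k1 := 2 / (9 * c1); ring.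
Qed.

Lemma scheme_error_eq t c : 0 < t ->
  error_eq N xs nu rho c0 c1 wd (fun=> 0) (fun j => - Y t j) (fun j => - Yd t j)
    (fun j => - memslope xs delta Y t j) (fun=> 0) 0 c.
Proof.
move=> t0; have := scheme_eq c t0; rewrite /error_eq.
rewrite massN stiffN sgradN convN conv0 load0.
have -> : (fun j => 0 - - Y t j) = Y t by apply/funext => j; ring.
by rewrite /bcub => h; move: h; set k0 := 2 / (9 * c0); set k1 := 2 / (9 * c1); lra.
Qed.

End Scheme.

(** * The equation for theta *)

Section ErrorEquation.
Context {R : realType}.
Local Notation I01 := (`]0, 1[%classic : set R).
Context (nu rho delta c0 c1 wd M : R) (w wt z : R -> R -> R).
Context (reg : regular nu rho delta c0 c1 wd M w wt z).
Context (N : nat) (xs : nat -> R) (part : is_partition N xs).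
Local Notation u := (fun t => cont_rep (w t)).
Local Notation p := (fun t => cont_rep (wD (w t))).
Local Notation q := (fun t => cont_rep (wt t)).
Local Notation V := (nodal xs u).
Local Notation Vd := (nodal xs q).
Local Notation X := (residual wd w N xs).
Local Notation etat := (etat wt N xs).
Implicit Types (t x : R) (c : nat -> R).

(** The left-hand side is that of [scheme_eq] with V in place of w_h, so that subtraction gives the
    equation for theta; the right-hand side is the consistency error. *)
Lemma exact_eq t c : 0 < t ->
  mass N xs (Vd t) c + nu * stiff N xs (V t) c + wd * conv N (V t) (fun=> 1) c + conv N (V t) (V t) c
  + rho * sgrad N (memslope xs delta V t) c
  + (bcub c0 wd (V t 0%N) * c 0%N + bcub c1 wd (V t N) * c N)
  = - inner (etat t) (interp N xs c) + load N xs (X t) c.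
Proof.
move=> t0; have [x0 x1 _] := part; have [_ _ delta0 _] := reg_param reg.
have [w1 w2 wt1] := reg_sobolev reg t0.
have plc := pl_interp part c; have [phi1 _ cE] := pl_sobolev part plc.
have cphi : {within `[0, 1], continuous (interp N xs c)} by exact: interp_within.
have mphi := within_continuous_meas cphi.
have := reg_weak reg t0 phi1; rewrite /weak_form !cE ?lexx ?ler01//.
have i1 : inner (wt t) (interp N xs c) = mass N xs (Vd t) c + inner (etat t) (interp N xs c).
  rewrite (inner_wt_rep reg t0 mphi) -(inner_mass part) !innerE -rintD.
  - by apply: eq_rint => x _; rewrite /etat; ring.
  - by apply: rintegrable_cont => x; apply: cvgM; exact: interp_within.
  - have ce := @etat_within _ _ _ _ _ _ _ _ _ _ _ reg N xs t t0.
    by apply: rintegrable_cont => x; apply: cvgM; [exact: ce|exact: interp_within].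
have i2 : inner (wD (w t)) (wD (interp N xs c)) = stiff N xs (V t) c.
  exact: inner_wD_interp.
have C := u_C1 reg t0.
have slE (j : 'I_N) : slope xs (interp N xs c \o xs) j = slope xs c j.
  exact: interp_nodes.
have e0 : interp N xs c 0 = c 0%N by rewrite -{1}x0 interp_node.
have e1 : interp N xs c 1 = c N by rewrite -{1}x1 interp_node.
have V0 : u t 0 = V t 0%N by rewrite /nodal x0.
have V1 : u t 1 = V t N by rewrite /nodal x1.
have i3 : inner (wD (w t)) (interp N xs c) = V t N * c N - V t 0%N * c 0%N
    - \sum_(j < N) slope xs c j * rint (xs j) (xs j.+1) (u t).
  rewrite (inner_wD_rep w2 mphi) (C1_pair_pl_ibp part plc C) e0 e1 V0 V1.
  by congr (_ - _); apply: eq_bigr => j _; rewrite slE.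
have i4 : inner (fun x => w t x * wD (w t) x) (interp N xs c) =
    V t N ^+ 2 / 2 * c N - V t 0%N ^+ 2 / 2 * c 0%N
    - \sum_(j < N) slope xs c j * rint (xs j) (xs j.+1) (fun x => u t x ^+ 2 / 2).
  rewrite (inner_w_wD_rep w1 w2 mphi) (C1_pair_pl_ibp part plc (C1_pair_sqr C)) e0 e1 V0 V1.
  by congr (_ - _); apply: eq_bigr => j _; rewrite slE.
have i5 : inner (z t) (wD (interp N xs c)) = sgrad N (memslope xs delta V t) c.
  apply: (inner_memory part c (reg_mem reg) _ (F := u) _ (V_contt reg part) (ltW t0)) => //.
  by move=> s /(reg_H1 reg)[].
have lE : load N xs (X t) c =
    wd * (\sum_(j < N) slope xs c j * rint (xs j) (xs j.+1) (u t)
       - \sum_(j < N) slope xs c j * rint (xs j) (xs j.+1) (interp N xs (V t)))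
    + (\sum_(j < N) slope xs c j * rint (xs j) (xs j.+1) (fun x => u t x ^+ 2 / 2)
       - \sum_(j < N) slope xs c j * rint (xs j) (xs j.+1) (fun x => interp N xs (V t) x ^+ 2 / 2)).
  rewrite -!sumrB mulr_sumr -big_split/=; apply: eq_bigr => j _.
  by rewrite (residualE reg part (ltW t0) (ltn_ord j)) /slope /incr; ring.
rewrite i1 i2 i3 i4 i5 e0 e1 V0 V1 lE (conv_one_ibp part) (conv_ibp part) /bcub.
set k0 := 2 / (9 * c0); set k1 := 2 / (9 * c1).
set S1 := \sum_(j < N) _; set S2 := \sum_(j < N) _; set S3 := \sum_(j < N) _; set S4 := \sum_(j < N) _.
by move=> H; apply/eqP; rewrite -subr_eq0 -[X in _ == X]H; apply/eqP; ring.
Qed.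

Context (wh : R -> R -> R).
Context (sd : semi_discrete N xs nu rho delta c0 c1 wd wh).
Local Notation Y := (nodal xs wh).
Local Notation Yd := (Yd xs wh).
Local Notation memslope := (memslope xs delta).
Local Notation h := (mesh_size N xs).
Local Notation B := (1 + M).
Local Notation L := (2 * (B + wd * B + B * B) / nu).
Local Notation esq := (esq wt N xs).

Lemma scheme_error t c : 0 < t ->
  error_eq N xs nu rho c0 c1 wd (V t) (fun j => V t j - Y t j) (fun j => Vd t j - Yd t j)
    (fun j => memslope V t j - memslope Y t j) (X t) (- inner (etat t) (interp N xs c)) c.
Proof.
move=> t0; have [_ _ delta0 _] := reg_param reg.
have E1 := exact_eq c t0; have E2 := scheme_eq part sd c t0.
rewrite /error_eq massB stiffB sgradB convB.
have -> : (fun j => V t j - (V t j - Y t j)) = Y t by apply/funext => j; ring.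
have e j : V t j - (V t j - Y t j) = Y t j by ring.
by rewrite !e; move: E1 E2; lra.
Qed.

(** The constant 2 (wd + B)^2 + 2 reads off [lnorm_residualt]: the first term multiplies
    ||eta_t||^2, and in the second (B L)^2 h^4 is at most the bound chosen for [lnorm X]. *)
Lemma es_of_scheme : error_system nu rho delta c0 c1 wd B (2 * (wd + B) ^+ 2 + 2) N xs
  V Vd Y Yd (fun t j => memslope V t j - memslope Y t j) (memslope Y) X (residualt wd w wt N xs) esq
  (((wd + B) * L) ^+ 2 * h ^+ 4).
Proof.
have [_ _ delta0 wd0] := reg_param reg; have B0 := B_ge0 reg; have L0 := L_ge0 reg.
have cV := V_contt reg part; have cY := Y_contt part sd.
have [cmV mV0 dmV] := memslope_ode xs delta0 cV; have [cmY mY0 dmY] := memslope_ode xs delta0 cY.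
split.
- by split=> [|t t0]; [exact: cV|exact: (V_der reg part t0)].
- by split=> [|t t0]; [exact: cY|exact: (Y_der part sd t0)].
- by split=> [|t t0]; [exact: (residual_contt reg part)|exact: (residual_der reg part t0)].
- split=> [j jN|j jN|t t0 j jN].
  + by apply: cont_ge0B; [exact: cmV|exact: cmY].
  + by rewrite mV0// mY0// subrr.
  + apply: (derE (derB (dmV t t0 j jN) (dmY t t0 j jN))).
    by rewrite /incr; ring.
- by split; [exact: cmY|exact: mY0|exact: dmY].
- move=> t c t0; exists (- inner (etat t) (interp N xs c)); first exact: scheme_error.
  by rewrite sqrrN; exact: (inner_etat_le reg part).
- by move=> t c t0; exact: (scheme_error_eq part sd).
- by move=> t _; exact: esq_ge0.
- by move=> t j t0 jN; exact: (V_bound reg part).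
- by move=> t j t0 jN; exact: (Vd_bound reg part).
- by move=> t j t0 jN; exact: (V_incr reg part).
- by move=> t t0; exact: (lnorm_residual reg part).
- move=> t t0; apply: (le_trans (lnorm_residualt reg part t0)).
  set k := (wd + B) ^+ 2; have k0 : 0 <= k by exact: sqr_ge0.
  have h4 : 0 <= h ^+ 4 by rewrite exprn_ge0// mesh_ge0.
  have e0 := esq_ge0 wt N xs t.
  have kk : (B * L) ^+ 2 * h ^+ 4 <= ((wd + B) * L) ^+ 2 * h ^+ 4.
    have a1 : 0 <= B * L by exact: mulr_ge0.
    have a2 : B * L <= (wd + B) * L by rewrite ler_wpM2r// lerDr.
    by apply: ler_wpM2r => //; rewrite ler_pXn2r ?nnegrE// (le_trans a1).
  set b := (B * L) ^+ 2 * h ^+ 4 in kk; set a := (_ * h ^+ 4) in kk *.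
  have a0 : 0 <= a by rewrite /a mulr_ge0// sqr_ge0.
  have -> : 2 * (B * L) ^+ 2 * h ^+ 4 = 2 * b by rewrite /b; ring.
  have := mulr_ge0 k0 a0; lra.
Qed.

End ErrorEquation.

Section AeLe.
Context {R : realType}.
Local Notation mu := (@lebesgue_measure R).

(** g is replaced by the maximum of f and g, which equals g almost everywhere and dominates f
    everywhere. *)
Lemma ae_le_rint (a b : R) (f g : R -> R) : rintegrable a b f -> rintegrable a b g ->
  {ae mu, forall x, a < x < b -> f x <= g x} -> rint a b f <= rint a b g.
Proof.
move=> fi gi fg; have mf := rintegrable_meas fi; have mg := rintegrable_meas gi.
have mm : measurable_fun `]a, b[ (fun x => Num.max (f x) (g x)) by exact: measurable_maxr.
have E : ae_eq mu (`]a, b[%classic : set R) g (fun x => Num.max (f x) (g x)).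
  by apply: ae_imp fg => x h /=; rewrite in_itv/= => /h fgx; rewrite max_r.
rewrite (ae_eq_rint mg mm E); apply: le_rint => //; first exact: ae_eq_rintegrable mm E gi.
by move=> x _; rewrite le_max lexx.
Qed.

End AeLe.

(** * The error at t = 0 *)

Section InitialError.
Context {R : realType}.
Local Notation I01 := (`]0, 1[%classic : set R).
Context (nu rho delta c0 c1 wd M : R) (w wt z : R -> R -> R).
Context (reg : regular nu rho delta c0 c1 wd M w wt z).
Context (N : nat) (xs : nat -> R) (part : is_partition N xs).
Context (lambda : R) (lambda0 : 0 < lambda) (wtil : R -> R -> R).
Context (rv : ritz_volterra N xs nu rho delta lambda w wtil).
Local Notation u := (fun t => cont_rep (w t)).
Local Notation V := (nodal xs u).
Local Notation h := (mesh_size N xs).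
Local Notation B := (1 + M).
Local Notation L := (2 * (B + wd * B + B * B) / nu).
Local Notation th := (fun j => V 0 j - wtil 0 (xs j)).

(** The projection is tested with theta(0) itself. Orthogonality of eta_x leaves lambda (eta, theta)
    as the only forcing, so ||theta|| and ||theta_x|| are bounded by multiples of the maximum of
    |eta|. *)
Lemma initial_error : bsq N xs th <= (36 + 9 * lambda / (2 * nu)) * (L * h ^+ 2) ^+ 2.
Proof.
have [nu0 _ _ _] := reg_param reg; have l0 : 0 < lambda := lambda0.
have [fe [E [mE HE]]] := rv.
have plw := fe_space_pl part (fe 0 (lexx _)).
have [s1 _ wE] := pl_sobolev part plw.
have [w1 _] := reg_H1 reg (lexx 0).
have [d1 _ dE] := sobolev1B w1 s1.
pose phi := interp N xs th; have plphi := pl_interp part th.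
have cphi : {within `[0, 1], continuous phi} by exact: interp_within.
have mphi := within_continuous_meas cphi.
have i1 : inner (wD (w 0 \- wtil 0)) (wD phi) = stiff N xs th th.
  rewrite (inner_wD_interp part _ d1); apply: eq_bigr => j _; have jN := ltn_ord j.
  have p1 := partition_itv part jN; have p0 := partition_itv part (ltnW jN).
  by rewrite /incr !dE// !wE.
have i2 : inner (E 0) (wD phi) = 0.
  have [_ H] := mE 0 (lexx 0); have [[_ _ L2phi] _ _] := pl_sobolev part plphi.
  by have [_ ->] := H _ L2phi; rewrite set_itv1 Rintegral_set1.
pose eta x := u 0 x - interp N xs (V 0) x.
have cu := u_within reg (lexx 0).
have ceta : {within `[0, 1], continuous eta}.
  by move=> x; apply: cvgB; [exact: cu|exact: interp_within].
have i3 : inner (w 0 \- wtil 0) phi = inner eta phi + mass N xs th th.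
  have [[/L2P[md _] _ _] [_ wd0 _]] := (d1, sobolev1_rep d1).
  have ceta2 : {within `[0, 1], continuous (fun x => eta x * phi x + phi x * phi x)}.
    by move=> x; apply: cvgD; apply: cvgM; [exact: ceta|exact: cphi|exact: cphi|exact: cphi].
  rewrite -(inner_mass part) !innerE -rintD; first last.
  - by apply: rintegrable_cont => x; apply: cvgM; exact: cphi.
  - by apply: rintegrable_cont => x; apply: cvgM; [exact: ceta|exact: cphi].
  apply: ae_eq_rint; [exact: measurable_funM|exact: within_continuous_meas|].
  apply: ae_imp wd0 => x hx x01; have x01' := x01; rewrite hx//; move: x01'; rewrite /= in_itv/= => /andP[x0 x1].
  have x01' : 0 <= x <= 1 by rewrite !ltW.
  have [_ plE] := plw.
  rewrite dE// wE// -mulrDl; congr (_ * _).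
  have [j jN xj] := partition_cell part x01'.
  rewrite /eta /phi !(interp_cell part _ jN xj) (plE j jN x xj) /slope /=.
  by rewrite /nodal; ring.
have ieta : inner eta phi ^+ 2 <= (L * h ^+ 2) ^+ 2 * mass N xs th th.
  have L0 := L_ge0 reg; have h0 := mesh_ge0 N xs.
  have k0 : 0 <= L * h ^+ 2 by rewrite mulr_ge0// sqr_ge0.
  apply: (le_trans (rint_sqr_mul_le ceta cphi)).
  have -> : rint 0 1 (fun x => phi x ^+ 2) = mass N xs th th.
    by rewrite -(inner_mass part) innerE; apply: eq_rint => x _; rewrite expr2.
  apply: ler_wpM2r; first exact: mass_ge0.
  rewrite -[X in _ <= X]mulr1 -[X in _ * X](subr0 1) -rint_cst ?ler01//.
  apply: le_rint; [exact: rintegrable_cont (within_continuous_sqr ceta)|exact: rintegrable_cst|].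
  move=> x /andP[x0 x1]; rewrite -(real_normK (num_real (eta x))) ler_pXn2r ?nnegrE//.
  by apply: (eta_le reg part (lexx 0)); rewrite !ltW.
have := HE 0 (lexx 0) _ (pl_fe_space plphi); rewrite i1 i2 i3 mulr0 addr0 => eq.
set k := L * h ^+ 2 in ieta *; set r := inner eta phi in ieta eq.
have m0 := mass_ge0 part th; have st0 := stiff_ge0 part th.
have rb : `|r| <= mass N xs th th / 2 + k ^+ 2 / 2.
  apply: amgm; [by rewrite divr_ge0|by rewrite divr_ge0// sqr_ge0|].
  by have -> : 4 * (mass N xs th th / 2) * (k ^+ 2 / 2) = k ^+ 2 * mass N xs th th by field.
have eq2 : nu * stiff N xs th th + lambda / 2 * mass N xs th th <= lambda / 2 * k ^+ 2.
  have : lambda * `|r| <= lambda * (mass N xs th th / 2 + k ^+ 2 / 2) by rewrite ler_wpM2l// ltW.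
  have : lambda * - r <= lambda * `|r| by rewrite ler_wpM2l ?(ltW l0)// -normrN ler_norm.
  by move: eq; lra.
have mk : mass N xs th th <= k ^+ 2.
  rewrite -(ler_pM2l (_ : 0 < lambda / 2)) ?divr_gt0//.
  by apply: le_trans eq2; rewrite lerDr mulr_ge0// ltW.
have sk : stiff N xs th th <= lambda / (2 * nu) * k ^+ 2.
  rewrite -(ler_pM2l nu0).
  have -> : nu * (lambda / (2 * nu) * k ^+ 2) = lambda / 2 * k ^+ 2 by field; rewrite gt_eqF.
  by apply: le_trans eq2; rewrite lerDl mulr_ge0// divr_ge0// ltW.
(* At the last node theta^2 <= 2 theta(0)^2 + 2 stiff, so |theta|^2 <= 3 stiff + 3 theta(0)^2; with
   theta(0)^2 <= 12 mass + 2 stiff this is at most 36 mass + 9 stiff. *)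
have t0 := trace_le part th; have tN := node_le part th (leqnn N).
have -> : (36 + 9 * lambda / (2 * nu)) * k ^+ 2 = 36 * k ^+ 2 + 9 * (lambda / (2 * nu) * k ^+ 2) by ring.
by rewrite /bsq; move: mk sk t0 tN; lra.
Qed.

End InitialError.

(** * Time integrals of |V|^2 and of ||eta_t||^2 *)

Section TimeIntegrated.
Context {R : realType}.
Local Notation mu := (@lebesgue_measure R).
Local Notation I01 := (`]0, 1[%classic : set R).
Context (nu rho delta c0 c1 wd M : R) (w wt z : R -> R -> R).
Context (reg : regular nu rho delta c0 c1 wd M w wt z).
Definition energy (t : R) : R :=
  triple_norm (w t) ^+ 2 + sobolev_norm 2 (wt t) ^+ 2 + L2norm (z t) ^+ 2.
Context (wtH2 : {ae mu, forall s, 0 < s -> sobolev 2 (wt s)}).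
Context (enM : forall t, 0 < t -> rintegrable 0 t energy /\ rint 0 t energy <= M).
Context (N : nat) (xs : nat -> R) (part : is_partition N xs).
Local Notation u := (fun t => cont_rep (w t)).
Local Notation p := (fun t => cont_rep (wD (w t))).
Local Notation V := (nodal xs u).
Local Notation h := (mesh_size N xs).
Local Notation B := (1 + M).
Local Notation esq := (esq wt N xs).
Implicit Types (t : R).

(** Interpolation does not increase ||w_x||, by Cauchy-Schwarz on each cell, and it keeps the
    boundary values. *)
Lemma bsq_V_le t : 0 < t -> bsq N xs (V t) <= triple_norm (w t) ^+ 2.
Proof.
move=> t0; have [x0 x1 _] := part; have [_ w2 _] := reg_sobolev reg t0.
rewrite /triple_norm sqr_sqrtr; last by rewrite !addr_ge0// sqr_ge0.
rewrite /bsq /nodal x0 x1 !lerD2r.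
have [cp pE _] := sobolev1_rep w2; have [/L2P[mp _] _ _] := w2.
have -> : L2norm (wD (w t)) ^+ 2 = rint 0 1 (fun x => p t x ^+ 2).
  rewrite L2norm_sqr; apply: ae_eq_rint; first exact: measurable_funX.
    by apply: within_continuous_meas; exact: within_continuous_sqr.
  by apply: ae_imp pE => x H x01; rewrite H.
rewrite (_ : stiff _ _ _ _ = lnorm N xs (incr (fun j => u t (xs j)))); last first.
  by apply: eq_bigr => j _; rewrite expr2.
apply: (lnorm_le part cp) => j jN.
have [_ uE] := u_C1 reg t0; have [_ _ lt] := part.
have /andP[j0 _] := partition_itv part (ltnW jN); have /andP[_ j1] := partition_itv part jN.
by rewrite -uE// ltW// lt.
Qed.

Lemma bsq_V_bound t : 0 < t -> `|bsq N xs (V t)| <= 3 * B ^+ 2.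
Proof.
move=> t0; rewrite ger0_norm; last exact: bsq_ge0.
have B0 := B_ge0 reg.
have sq j : (j <= N)%N -> V t j ^+ 2 <= B ^+ 2.
  move=> jN; rewrite -(real_normK (num_real (V t j))) ler_pXn2r ?nnegrE//.
  exact: (V_bound reg part (ltW t0)).
have st : stiff N xs (V t) (V t) <= B ^+ 2.
  set K := B ^+ 2; rewrite -[K]mul1r -(sum_cell part) mulr_suml; apply: ler_sum => j _.
  have jN := ltn_ord j; have h0 := cell_gt0 part jN.
  rewrite ler_pdivrMr// -expr2 -(real_normK (num_real (incr _ _))).
  have -> : cell xs j * K * cell xs j = (B * cell xs j) ^+ 2 by rewrite /K; ring.
  rewrite ler_pXn2r ?nnegrE ?mulr_ge0 ?(ltW h0)//.
  exact: (V_incr reg part t0).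
by rewrite /bsq; have := sq 0%N (leq0n N); have := sq N (leqnn N); lra.
Qed.

Lemma bsq_V_contt : cont_ge0 (fun t => bsq N xs (V t)).
Proof.
have cV := V_contt reg part.
by do 2 ?apply: cont_ge0D; [exact: stiff_contt|apply: cont_ge0X; exact: cV|apply: cont_ge0X; exact: cV].
Qed.

Lemma energy_ge t : triple_norm (w t) ^+ 2 <= energy t /\ sobolev_norm 2 (wt t) ^+ 2 <= energy t.
Proof.
have := sqr_ge0 (triple_norm (w t)); have := sqr_ge0 (sobolev_norm 2 (wt t)).
by have := sqr_ge0 (L2norm (z t)); rewrite /energy; split; lra.
Qed.

Lemma Psi_primitive : [/\ cont_ge0 (fun t => rint 0 t (fun s => bsq N xs (V s))),
  forall t, 0 < t -> is_derive t 1 (fun t => rint 0 t (fun s => bsq N xs (V s))) (bsq N xs (V t)) &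
  forall t, 0 <= t -> 0 <= rint 0 t (fun s => bsq N xs (V s)) <= M].
Proof.
have cb (t : R) : 0 < t -> {for t, continuous (fun t => bsq N xs (V t))}.
  by move=> t0; apply: cont_ge0_at => //; exact: bsq_V_contt.
have [i [c d]] := rint_primitive cb bsq_V_bound.
split=> // t; rewrite le_eqVlt => /predU1P[<-|t0].
  by rewrite rint_nil// lexx (reg_M reg).
apply/andP; split; first by apply: rint_ge0 => s _; exact: bsq_ge0.
have [ei eM] := enM t0; apply: le_trans eM; apply: le_rint => // s /andP[s0 _].
by apply: (le_trans (bsq_V_le s0)); have [] := energy_ge s.
Qed.

Lemma Phi_primitive : [/\ cont_ge0 (fun t => rint 0 t esq),
  forall t, 0 < t -> is_derive t 1 (fun t => rint 0 t esq) (esq t) &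
  forall t, 0 <= t -> 0 <= rint 0 t esq <= h ^+ 4 * M].
Proof.
have h4 : 0 <= h ^+ 4 by rewrite exprn_ge0// mesh_ge0.
have [i [c d]] := rint_primitive (esq_contt reg part) (esq_bound reg part).
split=> // t; rewrite le_eqVlt => /predU1P[<-|t0].
  by rewrite rint_nil// lexx mulr_ge0// (reg_M reg).
apply/andP; split; first by apply: rint_ge0 => s _; exact: esq_ge0.
have [ei eM] := enM t0; apply: (@le_trans _ _ (h ^+ 4 * rint 0 t energy)); last by rewrite ler_wpM2l.
(* The H^2 regularity of w_t is available for almost every time only. *)
rewrite -rintZ//; apply: ae_le_rint => //; first exact: rintegrableZ.
apply: ae_imp wtH2 => s H /andP[s0 _]; apply: (le_trans (esq_le reg part s0 (H s0))).
rewrite ler_wpM2l//; have [_] := energy_ge s; apply: le_trans.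
rewrite sobolev_norm2_sqr; have := sqr_ge0 (L2norm (wt s)).
by have := sqr_ge0 (L2norm (wD (wt s))); lra.
Qed.

End TimeIntegrated.

(** * Error bounds *)

Section NodalError.
Context {R : realType}.
Local Notation mu := (@lebesgue_measure R).

(** The constant D is chosen from the parameters and M, before the solution and the mesh; the
    exponential exp(Ke (M + Q0)) of the Gronwall step is part of it. *)
Lemma nodal_error (nu rho delta c0 c1 lambda wd M : R) :
  [/\ 0 < nu, 0 < rho, 0 < delta, 0 < c0 & 0 < c1] -> 0 < lambda -> 0 <= wd -> 0 <= M ->
  exists2 D : R, 0 <= D &
  forall (w wt z : R -> R -> R) N xs (wtil wh : R -> R -> R),
    regular nu rho delta c0 c1 wd M w wt z ->
    {ae mu, forall s, 0 < s -> sobolev 2 (wt s)} ->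
    (forall t, 0 < t -> rintegrable 0 t (energy w wt z) /\ rint 0 t (energy w wt z) <= M) ->
    is_partition N xs ->
    ritz_volterra N xs nu rho delta lambda w wtil ->
    semi_discrete N xs nu rho delta c0 c1 wd wh ->
    (forall x, 0 <= x <= 1 -> wh 0 x = wtil 0 x) ->
    forall t, 0 <= t ->
      bsq N xs (fun j => cont_rep (w t) (xs j) - wh t (xs j)) <= D * mesh_size N xs ^+ 4.
Proof.
move=> par lambda0 wd0 M0; have [nu0 rho0 delta0 c00 c10] := par.
pose B := 1 + M; pose L := 2 * (B + wd * B + B * B) / nu.
have B0 : 0 <= B by rewrite addr_ge0.
have wB : 0 <= wd + B by exact: addr_ge0.
have K30 : 0 <= 2 * (wd + B) ^+ 2 + 2 by rewrite addr_ge0// mulr_ge0// sqr_ge0.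
have [Ke [Kc [Ke0 Kc0 H]]] := energy_bound par wd0 B0 K30.
pose Ci := (36 + 9 * lambda / (2 * nu)) * L ^+ 2.
have Ci0 : 0 <= Ci.
  apply: mulr_ge0; last exact: sqr_ge0.
  by apply: addr_ge0 => //; apply: divr_ge0; apply: mulr_ge0 => //; exact: ltW.
(* Bounds ||w_h(0)||^2: at each node w_h^2 <= 2 V^2 + 2 theta^2, where theta^2 <= 2 |theta|^2 and
   |theta|^2 <= Ci h^4 <= Ci. *)
pose Q0 := 2 * B ^+ 2 + 4 * Ci.
(* The four forcing terms of [energy_bound] divided by h^4; the square of Ci h^4 is at most Ci^2 h^4
   because h <= 1. *)
pose S := Ci + Ci ^+ 2 + M + ((wd + B) * L) ^+ 2.
have S0 : 0 <= S by rewrite /S !addr_ge0// sqr_ge0.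
exists (Kc * expR (Ke * (M + Q0)) * S).
  by apply: mulr_ge0 => //; apply: mulr_ge0 => //; exact: expR_ge0.
move=> w wt z N xs wtil wh reg wtH2 enM part rv sd wh0 t t0.
pose h := mesh_size N xs.
have h0 : 0 <= h by exact: mesh_ge0.
have h1 : h <= 1 by exact: mesh_le1.
have h4 : 0 <= h ^+ 4 by rewrite exprn_ge0.
have h41 : h ^+ 4 <= 1 by rewrite exprn_ile1.
have [cPsi dPsi bPsi] := Psi_primitive reg enM part.
have [cPhi dPhi bPhi] := Phi_primitive reg wtH2 enM part.
have b0 : bsq N xs (fun j => nodal xs (fun t => cont_rep (w t)) 0 j - nodal xs wh 0 j) <= Ci * h ^+ 4.
  have -> : Ci * h ^+ 4 = (36 + 9 * lambda / (2 * nu)) * (L * h ^+ 2) ^+ 2 by rewrite /Ci; ring.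
  apply: le_trans (initial_error reg part lambda0 rv).
  rewrite le_eqVlt; apply/orP; left; apply/eqP.
  rewrite /bsq /stiff /nodal; have [x0 x1 _] := part.
  rewrite x0 x1 !wh0 ?lexx ?ler01//; congr (_ + _ + _); apply: eq_bigr => j _.
  have jN := ltn_ord j.
  by rewrite /incr !wh0//; [exact: (partition_itv part (ltnW jN))|exact: (partition_itv part jN)].
have Cih : Ci * h ^+ 4 <= Ci by rewrite ler_piMr.
have hQ0 : mass N xs (nodal xs wh 0) (nodal xs wh 0) <= Q0.
  apply: (mass_le part) => j jN.
  have tj := node_le_bsq part (fun j => nodal xs (fun t => cont_rep (w t)) 0 j - nodal xs wh 0 j) jN.
  have Vj := V_bound reg part (lexx 0) jN.
  set a := nodal xs _ 0 j in tj Vj; set b := nodal xs wh 0 j in tj *.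
  have a2 : a ^+ 2 <= B ^+ 2 by rewrite -(real_normK (num_real a)) ler_pXn2r ?nnegrE.
  rewrite /Q0; have := sqr_ge0 (a + (a - b)); move: tj a2 b0 Cih.
  set bb := bsq _ _ _; set B2 := B ^+ 2; set ch := Ci * _; move=> *; lra.
have := H N xs _ _ _ _ _ _ _ _ _ _ _ _ M (h ^+ 4 * M) (Ci * h ^+ 4) Q0 part (es_of_scheme reg part sd) cPsi cPhi
  (fun t t0 => conj (dPsi t t0) (dPhi t t0)) (fun t t0 => conj (bPsi t t0) (bPhi t t0)) b0 hQ0 t t0.
move=> Ht; apply: (le_trans Ht); rewrite -[X in _ <= X]mulrA; apply: ler_wpM2l.
  by apply: mulr_ge0 => //; exact: expR_ge0.
have -> : S * h ^+ 4 = Ci * h ^+ 4 + Ci ^+ 2 * h ^+ 4 + h ^+ 4 * M + ((wd + B) * L) ^+ 2 * h ^+ 4.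
  by rewrite /S; ring.
rewrite !lerD2r lerD2l exprMn; apply: ler_wpM2l; first exact: sqr_ge0.
by rewrite expr2 ler_piMr.
Qed.

End NodalError.

(** * Norms of the error *)

Section ErrorNorms.
Context {R : realType}.
Local Notation mu := (@lebesgue_measure R).
Local Notation I01 := (`]0, 1[%classic : set R).

Lemma Linfnorm_le (f F : R -> R) (k : R) : 0 <= k -> ae_eq mu I01 f F ->
  (forall x, 0 < x < 1 -> `|F x| <= k) -> (Linfnorm f <= k%:E)%E.
Proof.
move=> k0 fF Fk; rewrite /Linfnorm unlock; case: ifPn => _; last by rewrite lee_fin.
apply/ess_sup_inf.ess_supP; apply: ae_imp fF => x fx; rewrite /= lee_fin patchE.
case: ifPn => [/set_mem x01|_]; last by rewrite normr0.
by rewrite fx//; apply: Fk; move: x01; rewrite /= in_itv.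
Qed.

Context (nu rho delta c0 c1 wd M : R) (w wt z : R -> R -> R).
Context (reg : regular nu rho delta c0 c1 wd M w wt z).
Context (N : nat) (xs : nat -> R) (part : is_partition N xs).
Context (wh : R -> R -> R) (sd : semi_discrete N xs nu rho delta c0 c1 wd wh).
Local Notation u := (fun t => cont_rep (w t)).
Local Notation p := (fun t => cont_rep (wD (w t))).
Local Notation V := (nodal xs u).
Local Notation Y := (nodal xs wh).
Local Notation h := (mesh_size N xs).
Local Notation B := (1 + M).
Local Notation L := (2 * (B + wd * B + B * B) / nu).
Context (t D : R) (t0 : 0 < t) (D0 : 0 <= D).
Local Notation th := (fun j => V t j - Y t j).
Context (thD : bsq N xs th <= D * h ^+ 4).

(** The error is eta plus the interpolant of theta; the latter is bounded by its nodal values, where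
    theta^2 <= 2 |theta|^2. *)
Lemma pointwise_error x : 0 <= x <= 1 ->
  `|u t x - wh t x| <= (L + Num.sqrt (2 * D)) * h ^+ 2.
Proof.
move=> x01; have h0 := mesh_ge0 N xs; have d0 : 0 <= D := D0.
have e := eta_le reg part (ltW t0) x01.
have k0 : 0 <= Num.sqrt (2 * D) * h ^+ 2 by rewrite mulr_ge0 ?sqrtr_ge0// sqr_ge0.
have ithx : `|interp N xs th x| <= Num.sqrt (2 * D) * h ^+ 2.
  apply: (interp_bound part) => // j jN; have := node_le_bsq part th jN => tj.
  rewrite -(@ler_pXn2r _ 2) ?nnegrE// real_normK ?num_real// exprMn sqr_sqrtr ?mulr_ge0//.
  apply: (le_trans tj); rewrite -mulrA ler_wpM2l//; apply: (le_trans thD).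
  by rewrite le_eqVlt; apply/orP; left; apply/eqP; ring.
have -> : u t x - wh t x = (u t x - interp N xs (V t) x) + interp N xs th x.
  rewrite (wh_interp part sd (ltW t0) x01); have [j jN xj] := partition_cell part x01.
  by rewrite !(interp_cell part _ jN xj) /slope; ring.
by rewrite mulrDl; apply: (le_trans (ler_normD _ _)); exact: lerD.
Qed.

(** The first-order term is the interpolation error w_x - V_x, at most L h; theta contributes O(h^4)
    to the square, here weakened to h^2 by h <= 1. *)
Lemma gradient_error : sobolev 1 (w t \- wh t) /\
  L2norm (wD (w t \- wh t)) ^+ 2 <= (2 * L ^+ 2 + 2 * D) * h ^+ 2.
Proof.
have [w1 w2 _] := reg_sobolev reg t0; have h0 := mesh_ge0 N xs; have L0 := L_ge0 reg.
have plw := wh_pl part sd (ltW t0); have [s1 sE _] := pl_sobolev part plw.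
have [d1 dE _] := sobolev1B w1 s1; split => //.
have [nu0 _ _ _] := reg_param reg; have [cp pE _] := sobolev1_rep w2.
pose g x := p t x - plD N xs (wh t \o xs) x.
have mp := within_continuous_meas cp.
have mg : measurable_fun I01 g by apply: measurable_funB => //; exact: measurable_plD.
have [Mp MpP] := plD_bound N xs (wh t \o xs).
have g2i : rintegrable 0 1 (fun x => g x ^+ 2).
  apply: (@rintegrable_bounded _ _ _ _ ((B + Mp) ^+ 2)); first exact: measurable_funX.
  move=> x /andP[x0 x1].
  have gb : `|g x| <= B + Mp.
    apply: (le_trans (ler_normB _ _)); apply: lerD; last exact: MpP.
    by apply: (p_bound reg t0); rewrite !ltW.
  by rewrite normrX ler_pXn2r ?nnegrE// (le_trans _ gb).
have [_ _ /L2P[md _]] := d1.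
have -> : L2norm (wD (w t \- wh t)) ^+ 2 = rint 0 1 (fun x => g x ^+ 2).
  rewrite L2norm_sqr; apply: ae_eq_rint; [exact: measurable_funX|exact: measurable_funX|].
  apply: ae_imp (ae_and dE (ae_and pE sE)) => x [e1 [e2 e3]] x01.
  by rewrite e1//= e2// e3.
rewrite (rint_cells part g2i).
have -> : (2 * L ^+ 2 + 2 * D) * h ^+ 2 = \sum_(j < N) cell xs j * (2 * L ^+ 2 * h ^+ 2) + 2 * D * h ^+ 2.
  by rewrite -mulr_suml (sum_cell part); ring.
apply: (@le_trans _ _ (\sum_(j < N) cell xs j * (2 * L ^+ 2 * h ^+ 2) + 2 * stiff N xs th th)); last first.
  rewrite lerD2l -mulrA; apply: ler_wpM2l => //.
  apply: (@le_trans _ _ (D * h ^+ 4)).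
    by apply: le_trans thD; rewrite /bsq -addrA lerDl addr_ge0// sqr_ge0.
  have h1 := mesh_le1 part.
  rewrite ler_wpM2l// (_ : h ^+ 4 = h ^+ 2 * h ^+ 2); last by ring.
  by rewrite ler_piMr ?sqr_ge0// exprn_ile1.
rewrite mulr_sumr -big_split/=; apply: ler_sum => j _; have jN := ltn_ord j.
have c0' := cell_gt0 part jN; have lt : xs j <= xs j.+1 by move: c0'; rewrite /cell; lra.
have -> : cell xs j * (2 * L ^+ 2 * h ^+ 2) + 2 * (incr th j * incr th j / cell xs j) =
    (2 * (L * h) ^+ 2 + 2 * slope xs th j ^+ 2) * (xs j.+1 - xs j).
  by rewrite -/(cell xs j) /slope /incr; field; rewrite !gt_eqF.
rewrite -rint_cst//; apply: le_rint; last 1 first.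
- move=> x xj; have [ps _] := p_slope reg part t0 jN; have := ps x xj => psx.
  have a1 : (p t x - slope xs (V t) j) ^+ 2 <= (L * h) ^+ 2.
    have Lh : 0 <= L * h by exact: mulr_ge0.
    rewrite -(real_normK (num_real (p t x - slope xs (V t) j))) ler_pXn2r ?nnegrE//.
    by apply: (le_trans psx); rewrite ler_wpM2l// cell_le_mesh.
  have -> : g x = (p t x - slope xs (V t) j) + slope xs th j.
    by rewrite /g (plD_cell part _ jN xj) /slope /nodal /=; ring.
  set a := _ - slope _ (V t) j in a1 *; set b := slope _ th j.
  by have := sqr_ge0 (a - b); lra.
- have /andP[? _] := partition_itv part (ltnW jN).
  by have /andP[_ ?] := partition_itv part jN; apply: rintegrable_sub g2i _ _.
- exact: rintegrable_cst.
Qed.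

Lemma error_norms C0 : (L + Num.sqrt (2 * D)) ^+ 2 + 2 * L ^+ 2 + 2 * D <= C0 ^+ 2 -> 0 <= C0 ->
  (forall j, (j <= 1)%N -> sobolev j (w t \- wh t) /\
     sobolev_norm j (w t \- wh t) <= C0 * h ^+ (2 - j)) /\
  (Linfnorm (w t \- wh t)%R <= (C0 * h ^+ 2)%:E)%E.
Proof.
move=> CC C00; have [s1 gE] := gradient_error; have h0 := mesh_ge0 N xs.
have h1 := mesh_le1 part; have L0 := L_ge0 reg; have d0 : 0 <= D := D0.
have [w1 _ _] := reg_sobolev reg t0.
have [sw wE] := wh_sobolev part sd (ltW t0).
have [_ _ dE] := sobolev1B w1 sw; have [cd dd _] := sobolev1_rep s1.
have [sL _ _] := s1; have /L2P[md _] := sL.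
set P := L + Num.sqrt (2 * D) in CC.
have P0 : 0 <= P by rewrite addr_ge0// sqrtr_ge0.
have PC : P <= C0.
  rewrite -(@ler_pXn2r _ 2) ?nnegrE//; apply: le_trans CC.
  by rewrite -addrA lerDl addr_ge0// mulr_ge0// sqr_ge0.
have pw x : 0 <= x <= 1 -> `|cont_rep (w t \- wh t) x| <= P * h ^+ 2.
  by move=> x01; rewrite dE// wE//; exact: pointwise_error.
have L2le : L2norm (w t \- wh t) ^+ 2 <= (P * h ^+ 2) ^+ 2.
  have cd2 := within_continuous_sqr cd.
  have -> : L2norm (w t \- wh t) ^+ 2 = rint 0 1 (fun x => cont_rep (w t \- wh t) x ^+ 2).
    rewrite L2norm_sqr; apply: ae_eq_rint; [exact: measurable_funX|exact: within_continuous_meas|].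
    by apply: ae_imp dd => x e x01; rewrite e.
  set K := (P * h ^+ 2) ^+ 2; rewrite -[K]mulr1 -[X in K * X](subr0 1) -rint_cst ?ler01//.
  apply: le_rint; [exact: rintegrable_cont|exact: rintegrable_cst|].
  move=> x /andP[x0 x1]; rewrite -(real_normK (num_real (cont_rep _ _))) ler_pXn2r ?nnegrE ?mulr_ge0 ?sqr_ge0//.
  by apply: pw; rewrite !ltW.
split; last first.
  apply: (@Linfnorm_le _ (cont_rep (w t \- wh t))) => //; first by rewrite mulr_ge0// sqr_ge0.
  move=> x /andP[x0 x1]; apply: (@le_trans _ _ (P * h ^+ 2)); first by apply: pw; rewrite !ltW.
  by rewrite ler_wpM2r// sqr_ge0.
have n0 k : 0 <= sobolev_norm k (w t \- wh t) by exact: sqrtr_ge0.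
case=> [|[|//]] _; split => //.
- rewrite subn0 -(@ler_pXn2r _ 2) ?nnegrE ?mulr_ge0 ?sqr_ge0//.
  rewrite sobolev_norm_sqr big_ord_recl big_ord0/= addr0; apply: (le_trans L2le).
  by rewrite ler_pXn2r ?nnegrE ?mulr_ge0 ?sqr_ge0// ler_wpM2r// sqr_ge0.
- rewrite expr1 -(@ler_pXn2r _ 2) ?nnegrE ?mulr_ge0//.
  rewrite sobolev_norm1_sqr exprMn.
  have e1 : (P * h ^+ 2) ^+ 2 <= P ^+ 2 * h ^+ 2.
    rewrite exprMn ler_wpM2l ?sqr_ge0// -[X in _ <= X]mul1r expr2 ler_wpM2r ?sqr_ge0//.
    by rewrite exprn_ile1.
  have e2 : (P ^+ 2 + 2 * L ^+ 2 + 2 * D) * h ^+ 2 <= C0 ^+ 2 * h ^+ 2.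
    by rewrite ler_wpM2r// sqr_ge0.
  by move: e1 e2 gE L2le; lra.
Qed.

End ErrorNorms.

Theorem theorem4p1 (R : realType) (nu rho delta c0 c1 lambda wd K : R)
    (nu_gt0 : 0 < nu) (rho_gt0 : 0 < rho) (delta_gt0 : 0 < delta)
    (c0_gt0 : 0 < c0) (c1_gt0 : 0 < c1) (lambda_gt0 : 0 < lambda)
    (wd_ge0 : 0 <= wd) (K_gt0 : 0 < K) :
  exists C : R -> R,
    forall (w0 : R -> R) (w wt z : R -> R -> R),
      weak_solution nu rho delta c0 c1 wd w0 w wt z ->
      assumption_A1 nu rho c0 c1 wd w0 w z ->
      assumption_A2 nu rho delta c0 c1 wd K w0 ->
    forall (N : nat) (xs : nat -> R) (wtil wh : R -> R -> R),
      is_partition N xs ->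
      ritz_volterra N xs nu rho delta lambda w wtil ->
      semi_discrete N xs nu rho delta c0 c1 wd wh ->
      (forall x, 0 <= x <= 1 -> wh 0 x = wtil 0 x) ->
    let h := mesh_size N xs in
    let C0 := C (sobolev_norm 3 w0) in
    forall t : R, 0 < t ->
      (forall j, (j <= 1)%N ->
        sobolev j (w t \- wh t) /\
        sobolev_norm j (w t \- wh t)
          <= C0 * h ^+ (2 - j) * expR (C0 * sobolev_norm 2 w0)) /\
      (Linfnorm (w t \- wh t)%R
         <= (C0 * h ^+ 2 * expR (C0 * sobolev_norm 2 w0))%:E)%E.
Proof.
have par : [/\ 0 < nu, 0 < rho, 0 < delta, 0 < c0 & 0 < c1] by [].
have KM s : 0 <= K * s ^+ 2 by rewrite mulr_ge0 ?sqr_ge0// ltW.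
(* For s = ||w0||_3 the bound M is K s^2; the choice makes D a function of s, since C has to be
   given before w0. *)
have /choice[D DP] : forall s : R, exists D : R, 0 <= D /\
  forall (w wt z : R -> R -> R) N xs (wtil wh : R -> R -> R),
    regular nu rho delta c0 c1 wd (K * s ^+ 2) w wt z ->
    {ae @lebesgue_measure R, forall s, 0 < s -> sobolev 2 (wt s)} ->
    (forall t, 0 < t -> rintegrable 0 t (energy w wt z) /\ rint 0 t (energy w wt z) <= K * s ^+ 2) ->
    is_partition N xs ->
    ritz_volterra N xs nu rho delta lambda w wtil ->
    semi_discrete N xs nu rho delta c0 c1 wd wh ->
    (forall x, 0 <= x <= 1 -> wh 0 x = wtil 0 x) ->
    forall t, 0 <= t ->
      bsq N xs (fun j => cont_rep (w t) (xs j) - wh t (xs j)) <= D * mesh_size N xs ^+ 4.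
  by move=> s; have [D D0 DP] := nodal_error par lambda_gt0 wd_ge0 (KM s); exists D.
pose B s := 1 + K * s ^+ 2; pose L s := 2 * (B s + wd * B s + B s * B s) / nu.
(* The square of C collects the pointwise constant and the gradient constant, as [error_norms]
   asks. *)
pose C s := Num.sqrt ((L s + Num.sqrt (2 * D s)) ^+ 2 + 2 * L s ^+ 2 + 2 * D s).
exists C => w0 w wt z ws _ [_ _ A2] N xs wtil wh part rv sd wh0 h C0 t t0.
have [wtH2 A2t] := A2 _ _ _ ws.
pose s := sobolev_norm 3 w0; rewrite -/s in A2t.
have [D0 Ds] := DP s.
have enge r : 0 <= energy w wt z r by rewrite /energy !addr_ge0// sqr_ge0.
have reg : regular nu rho delta c0 c1 wd (K * s ^+ 2) w wt z.
  have [_ H1 [_ wtd] _ [mem weak]] := ws; split => // r r0.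
  have [S1 S2 ei eb] := A2t r r0; split => //; apply: le_trans eb.
  have : 0 <= rint 0 r (energy w wt z) by apply: rint_ge0.
  by rewrite /rint /energy; have := sqr_ge0 (L2norm (z r)); lra.
have enM r : 0 < r -> rintegrable 0 r (energy w wt z) /\ rint 0 r (energy w wt z) <= K * s ^+ 2.
  move=> r0; have [_ _ ei eb] := A2t r r0; split; first exact: ei.
  apply: le_trans eb; have := sqr_ge0 (sobolev_norm 2 (w r)).
  have := sqr_ge0 (sobolev_norm 1 (wt r)); have := sqr_ge0 (L2norm (z r)).
  by rewrite -/(rint 0 r (energy w wt z)); lra.
have thD := Ds _ _ _ _ _ _ _ reg wtH2 enM part rv sd wh0 t (ltW t0).
have C00 : 0 <= C0 by exact: sqrtr_ge0.
have CC : (L s + Num.sqrt (2 * D s)) ^+ 2 + 2 * L s ^+ 2 + 2 * D s <= C0 ^+ 2.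
  by rewrite /C0 sqr_sqrtr// !addr_ge0 ?sqr_ge0// mulr_ge0// sqr_ge0.
have [En Ei] := error_norms reg part sd t0 D0 thD CC C00.
(* The Gronwall exponential is already contained in D, so the factor exp(C0 ||w0||_2) enters through
   being at least 1. *)
have e1 : 1 <= expR (C0 * sobolev_norm 2 w0).
  by rewrite -expR0 ler_expR mulr_ge0// sqrtr_ge0.
have hn n : 0 <= C0 * h ^+ n by rewrite mulr_ge0// exprn_ge0// mesh_ge0.
split=> [j j1|].
  have [sj nj] := En j j1; split => //; apply: (le_trans nj); exact: ler_peMr.
by apply: (le_trans Ei); rewrite lee_fin; exact: ler_peMr.
Qed.
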